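(* Let $\lambda\in(0,\infty)$, let $R$ be a random variable with $R\in(0,C]$ almost surely for some constant $C<\infty$, and let $\mathfrak V$ be the total visibility from the origin in the vacant set of the Poisson Boolean model in $\mathbb H^2$ with intensity $\lambda$ and radius distribution $R$. Let $\alpha=2\lambda\,\mathbf E[\sinh(R)]$. Then there exist constants $0<c\le c'<\infty$ and $r_0<\infty$, depending only on $\lambda$ and the law of $R$, such that for all $r\ge r_0$: (i) if $\alpha=1$, then $c\,\frac1r\le \mathbf P[\mathfrak V\ge r]\le c'\,\frac1r$; (ii) if $\alpha>1$, then $c\,e^{-(\alpha-1)r}\le \mathbf P[\mathfrak V\ge r]\le c'\,e^{-(\alpha-1)r}$.
   Context: $\mathbb H^2$ is the hyperbolic plane in the Poincaré disc model: the unit disc $\{|z|<1\}$ with metric $ds^2=4\frac{dx^2+dy^2}{(1-(x^2+y^2))^2}$ and area measure $\mu(dx,dy)=\frac{4}{(1-(x^2+y^2))^2}\,dx\,dy$. Let $X$ be a Poisson point process in $\mathbb H^2$ with intensity measure $\lambda\mu$, and let $\{R_x\}_{x\in X}$ be i.i.d. copies of $R$, independent of $X$. The occupied set is $\mathcal C=\bigcup_{x\in X}B(x,R_x)$, where $B(x,r)$ is the closed hyperbolic ball of radius $r$ centered at $x$; the vacant set is $\mathcal W=\overline{\mathbb H^2\setminus\mathcal C}$. $L_r(\theta)$ denotes the geodesic segment of length $r$ starting at the origin $0$ whose continuation hits the boundary of the disc at $e^{i\theta}$. The visibility in direction $\theta$ is $V(\theta)=\inf\{r\ge 0: L_r(\theta)\cap\mathcal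 C\ne\emptyset\}$, and the total visibility is $\mathfrak V=\sup_{\theta\in[0,2\pi)}V(\theta)$. The number $\alpha$ is equivalently the unique $\alpha\ge0$ such that the probability $f(r)$ that a fixed geodesic segment of length $r$ is contained in $\mathcal W$ lies between two positive constant multiples of $e^{-\alpha r}$ for all $r\ge0$. *)

(* Defs.v *)
From mathcomp Require Import all_boot all_order all_algebra.
From mathcomp Require Import all_classical all_reals all_analysis.

Set Implicit Arguments.
Unset Strict Implicit.
Unset Printing Implicit Defensive.

Import Order.TTheory GRing.Theory Num.Theory.
Import numFieldNormedType.Exports.

Local Open Scope classical_set_scope.
Local Open Scope ring_scope.

Section HyperbolicPlane.
Variable R : realType.
Implicit Types (z w : R * R) (r theta : R).

Definition sinh (x : R) : R := (expR x - expR (- x)) / 2.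

Definition arcosh (x : R) : R := ln (x + Num.sqrt (x ^+ 2 - 1)).

Definition sqnorm z : R := z.1 ^+ 2 + z.2 ^+ 2.

Definition hplane : set (R * R) := [set z | sqnorm z < 1].

(* The distance of the metric 4 (dx^2 + dy^2) / (1 - (x^2 + y^2))^2, of
   curvature -1.  It is meaningful only for z and w in [hplane]. *)
Definition hdist z w : R :=
  arcosh (1 + 2 * sqnorm (z.1 - w.1, z.2 - w.2)
              / ((1 - sqnorm z) * (1 - sqnorm w))).

Definition harea (A : set (R * R)) : \bar R :=
  (\int[@lebesgue_measure R \x @lebesgue_measure R]_(z in A `&` hplane)
     (4 / (1 - sqnorm z) ^+ 2)%:E)%E.

Definition hball z r : set (R * R) :=
  [set w | hplane w /\ hdist z w <= r].

(* Geodesics through the origin are Euclidean diameters, so the segment is the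
   part of the Euclidean ray in direction theta within distance r of 0. *)
Definition hsegment r theta : set (R * R) :=
  [set w | hball (0, 0) r w /\
           exists2 t, 0 <= t & w = (t * cos theta, t * sin theta)].

(* Values are extended reals: an unobstructed direction has visibility +oo. *)
Definition visibility (Occ : set (R * R)) theta : \bar R :=
  ereal_inf [set r%:E | r in [set r | 0 <= r /\
                                      hsegment r theta `&` Occ !=set0]].

Definition total_visibility (Occ : set (R * R)) : \bar R :=
  ereal_sup [set visibility Occ theta | theta in `[0, 2 * pi[%classic].

End HyperbolicPlane.

Section PoissonBooleanModel.
Context (R : realType) (d : measure_display) (Om : measurableType d)
  (P : probability Om R).
Implicit Types (X : nat -> {RV P >-> (R * R)%type}) (rho : nat -> {RV P >-> R}).

(* As the total intensity is infinite, a Poisson process in the plane has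
   almost surely infinitely many points; it is given by a measurable
   enumeration X 0, X 1, ... of its points.  [point_count X A w] is the number
   of points in A. *)
Definition point_count X (A : set (R * R)) (w : Om) : \bar R :=
  (\sum_(n <oo) \d_(X n w) A)%E.

Definition count_event X (A : set (R * R)) (k : nat) : set Om :=
  [set w | point_count X A w = k%:R%:E].

Record poisson_process (lam : R) X : Prop := PoissonProcess {
  poisson_in_hplane : forall n w, hplane (X n w) ;
  poisson_count_law : forall (A : set (R * R)) (k : nat),
    measurable A -> (harea A < +oo)%E ->
    let m := lam * fine (harea A) in
    P (count_event X A k) = (expR (- m) * m ^+ k / k`!%:R)%:E ;
  poisson_count_indep :
    forall (n : nat) (A : 'I_n -> set (R * R)) (k : 'I_n -> nat),
    (forall i, measurable (A i)) -> (forall i, (harea (A i) < +oo)%E) ->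
    trivIset setT A ->
    P (\bigcap_(i in [set: 'I_n]) count_event X (A i) (k i)) =
      (\prod_(i < n) P (count_event X (A i) (k i)))%E
}.

(* [rho n] is the radius attached to the point [X n].  Subfamilies are covered
   by the two independence clauses, some of the sets being allowed to be
   [setT]. *)
Record poisson_boolean_model (lam : R) (nu : probability R R) X rho : Prop :=
    PoissonBooleanModel {
  boolean_centers : poisson_process lam X ;
  radii_law : forall n (B : set R),
    measurable B -> distribution P (rho n) B = nu B ;
  radii_indep : forall (n : nat) (B : 'I_n -> set R),
    (forall i, measurable (B i)) ->
    P (\bigcap_(i in [set: 'I_n]) (rho i @^-1` B i)) =
      (\prod_(i < n) P (rho i @^-1` B i))%E ;
  radii_centers_indep :
    forall (n : nat) (A : 'I_n -> set (R * R)) (B : 'I_n -> set R),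
    (forall i, measurable (A i)) -> (forall i, measurable (B i)) ->
    let EX := \bigcap_(i in [set: 'I_n]) (X i @^-1` A i) in
    let Erho := \bigcap_(i in [set: 'I_n]) (rho i @^-1` B i) in
    P (EX `&` Erho) = (P EX * P Erho)%E
}.

Definition occupied X rho (w : Om) : set (R * R) :=
  \bigcup_n hball (X n w) (rho n w).

Definition visible_event X rho (r : R) : set Om :=
  [set w | (r%:E <= total_visibility (occupied X rho w))%E].

(* [completed_prob E p]: E is measurable for the completion of P, and p is its
   probability there.  The total visibility is a supremum over uncountably many
   directions, so its events need be measurable only up to a P-null set. *)
Definition completed_prob (E : set Om) (p : \bar R) : Prop :=
  exists A : set Om,
    [/\ measurable A, {ae P, forall w, E w <-> A w} & P A = p].

End PoissonBooleanModel.

(* Main.v *)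
(* In the coordinates w = cosh d(0, z) and phi = arg z the area measure is
   dw dphi, and a ball of radius t centred at (w, phi) meets the segments whose
   direction lies within about sinh(t) / w of phi.  Hence a segment of length r
   is avoided with probability of order exp(- alpha r), two segments at angle
   k / W, with W of order exp r, are both avoided with probability of order
   exp(- alpha r) k^(- alpha), and the sum of the latter over k is of order r
   when alpha = 1 and bounded when alpha > 1.
   Lower bound: second moment of the number of avoided directions in a grid of
   mesh 1 / W.  Upper bound: cover the directions by arcs of length of order
   1 / W, each blocked as a whole, and scan them in order; given the first arc
   left unblocked, the expected number of unblocked arcs behind it is of order
   sum k^(- alpha), so that this sum times the probability of an unblocked arc is
   at most the expected number of such arcs.
   Void probabilities of the marked process are computed from the counting laws
   by approximating the mark probability by simple functions. *)
From HB Require Import structures.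
Require Import Defs.
From mathcomp Require Import all_boot all_order all_algebra.
From mathcomp Require Import all_classical all_reals all_analysis.
From mathcomp Require Import measurable_realfun ring lra.
Import Order.TTheory GRing.Theory Num.Theory.
Import numFieldNormedType.Exports.
Local Open Scope classical_set_scope.
Local Open Scope ring_scope.

Set Implicit Arguments.
Unset Strict Implicit.
Unset Printing Implicit Defensive.

(** A set of marked points (centre, radius) contains no point of the process with probability exp(-
    [lam] m), where m is its measure under hyperbolic area times the radius law. An error O(1) in m
    thus costs only a constant factor, and all geometric estimates are made up to additive
    constants: obstacles near the origin or near the far end of the segment are never treated
    precisely. Two families of obstacles occur. [hit] is exact and enters through an upper bound of
    its mass, hence a lower bound of a probability. [blk] is a smaller set with an explicit polar
    description; avoiding [hit] forces avoiding [blk], so [blk] serves for every upper bound. At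
    fixed height and radius it is an interval in the direction, which is what the scan relies on.
    The counting laws concern the centres alone, so the radii are integrated out before a void
    probability is computed. The argument is read off by [atan], which is correct on a half plane
    only; hence the restriction to a sector. *)

Lemma measurable_set_ltr d (T : measurableType d) (R : realType) (f g : T -> R) :
  measurable_fun setT f -> measurable_fun setT g -> measurable [set x | f x < g x].
Proof.
move=> mf mg; have := measurable_fun_ltr mf mg measurableT (Y := [set true]).
by rewrite setTI; apply.
Qed.

Lemma measurable_set_ler d (T : measurableType d) (R : realType) (f g : T -> R) :
  measurable_fun setT f -> measurable_fun setT g -> measurable [set x | f x <= g x].
Proof.
move=> mf mg; have := measurable_fun_ler mf mg measurableT (Y := [set true]).
by rewrite setTI; apply.
Qed.

Lemma ge0_integral_mrestr d (T : measurableType d) (R : realType)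
    (mu : {measure set T -> \bar R}) (D : set T) (mD : measurable D)
    (f : T -> \bar R) :
  measurable_fun setT f -> (forall x, 0 <= f x)%E ->
  (\int[mrestr mu mD]_x f x = \int[mu]_(x in D) f x)%E.
Proof.
move=> mf f0.
have D0 : mrestr mu mD (~` D) = 0%E by rewrite /mrestr setICl measure0.
rewrite (ge0_negligible_integral (measurableC mD) measurableT mf (fun x _ => f0 x) D0).
rewrite setTD setCK; apply: eq_measure_integral => A mA AD /=.
by rewrite /mrestr setIidl.
Qed.

(** * Changes of variables on the line *)

Section change_of_variables.
Variable R : realType.
Local Notation leb := (@lebesgue_measure R).

Lemma integral_itvoc_cst (c : \bar R) (t : R) : (0 <= c)%E -> 0 <= t ->
  (\int[leb]_(s in `]0%R, t]) c = c * t%:E)%E.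
Proof.
move=> c0 t0; rewrite integral_cst//= lebesgue_measure_itv/= lte_fin.
case: ltP => t0'; rewrite ?oppr0 ?adde0//.
by rewrite (_ : t = 0) ?mule0//; apply/eqP; rewrite eq_le t0 t0'.
Qed.

(** The image under [F] of the measure [f] dx on [I] has the right mass on half-open intervals,
    hence is Lebesgue measure. To have this image as a measure at once, [f] dx is realised as planar
    Lebesgue measure restricted to the subgraph of [f] and projected to the first coordinate. *)
Lemma ge0_change_of_variables (I : set R) (F f : R -> R) (g : R -> \bar R) :
  measurable I -> measurable_fun I F -> measurable_fun I f ->
  (forall x, I x -> 0 <= f x) ->
  (forall a b : R, (a < b)%R ->
    \int[leb]_(x in I `&` F @^-1` `]a, b]) (f x)%:E = (b - a)%R%:E)%E ->
  measurable_fun setT g -> (forall y, 0 <= g y)%E ->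
  (\int[leb]_y g y = \int[leb]_(x in I) (g (F x) * (f x)%:E))%E.
Proof.
move=> mI mF mf f0 intf mg g0.
have mF' : measurable_fun setT (F \_ I) by exact: (iffLR (measurable_restrictT F mI) mF).
have mf' : measurable_fun setT (f \_ I) by exact: (iffLR (measurable_restrictT f mI) mf).
have f'0 x : 0 <= (f \_ I) x.
  by rewrite patchE; case: ifPn => // /set_mem; exact: f0.
pose G := [set z : R * R | 0 < z.2] `&` [set z | z.2 <= (f \_ I) z.1].
have mG : measurable G.
  apply: measurableI.
    exact: (measurable_set_ltr (f := fun=> 0)).
  by apply: measurable_set_ler => //; apply: measurableT_comp.
have GE x : (fun s => (x, s)) @^-1` G = `]0, (f \_ I) x]%classic.
  by apply/seteqP; split => s; rewrite /G /= in_itv/= => /andP.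
have intG (h : R -> \bar R) : measurable_fun setT h -> (forall x, 0 <= h x)%E ->
    (\int[leb \x leb]_(z in G) h z.1 = \int[leb]_(x in I) (h x * (f x)%:E))%E.
  move=> mh h0; rewrite integral_mkcond fubini_tonelli1//=; last 2 first.
  - apply: (iffLR (measurable_restrictT _ mG)); apply: measurable_funTS.
    exact: measurableT_comp.
  - by move=> z; rewrite patchE; case: ifPn.
  rewrite [RHS]integral_mkcond; apply: eq_integral => x _; rewrite /fubini_F.
  transitivity (\int[leb]_(s in `]0%R, (f \_ I) x]) h x)%E.
    rewrite [RHS]integral_mkcond; apply: eq_integral => s _.
    by rewrite !patchE/= -GE.
  rewrite integral_itvoc_cst// !patchE; case: ifPn => //.
  by rewrite mule0.
have mphi : measurable_fun setT (F \_ I \o fst : R * R -> measurableTypeR R).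
  by apply: measurableT_comp.
pose phi : {mfun _ >-> _} := HB.pack (F \_ I \o fst : R * R -> measurableTypeR R)
  (isMeasurableFun.Build _ _ _ _ _ mphi).
pose nu := pushforward (mrestr (leb \x leb)%E mG) phi.
have nuE (A : set R) : measurable A -> leb A = nu A.
  apply: lebesgue_measure_unique => /= _ [[a b] _ <-] /=.
  rewrite /nu /pushforward /mrestr /=.
  have mab : measurable ((F \_ I) @^-1` `]a, b]).
    by rewrite -[X in measurable X]setTI; apply: mF'.
  rewrite -[RHS]mul1e -integral_cst; last first.
    apply: measurableI => //; rewrite -[X in measurable X]setTI.
    by apply: (@mphi).
  transitivity (\int[leb \x leb]_(z in G) (\1_((F \_ I) @^-1` `]a, b]) z.1)%:E)%E; last first.
    rewrite setIC [RHS]integral_mkcondr; apply: eq_integral => z _.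
    rewrite patchE indicE/= -[z \in _]/(z.1 \in (F \_ I) @^-1` `]a, b]).
    by case: (_ \in _).
  rewrite (intG (fun x => (\1_((F \_ I) @^-1` `]a, b]) x)%:E)) .
    2: by apply/measurable_EFinP; exact: measurable_indic.
    2: by move=> x; rewrite lee_fin.
  have [ab|ba] := ltP a b.
    rewrite lebesgue_measure_itv/= lte_fin ab -EFinB -intf// integral_mkcondr.
    apply: eq_integral => x /set_mem Ix; rewrite patchE indicE.
    rewrite (_ : (x \in F \_ I @^-1` _) = (x \in F @^-1` `]a, b])).
      by case: ifPn; rewrite ?mul1e ?mul0e.
    by apply/idP/idP; rewrite !inE /= patchE mem_set.
  rewrite set_itv_ge ?measure0 -?leNgt// preimage_set0.
  by under eq_integral do rewrite indic0 mul0e; rewrite integral0.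
transitivity (\int[nu]_y g y)%E.
  by apply: eq_measure_integral => A mA _; exact: nuE.
rewrite ge0_integral_pushforward// preimage_setT ge0_integral_mrestr; last 2 first.
- exact: measurableT_comp.
- by move=> x; exact: g0.
rewrite (intG (fun x => g ((F \_ I) x))); last 2 first.
- exact: measurableT_comp.
- by move=> x; exact: g0.
by apply: eq_integral => x xI; rewrite patchE xI.
Qed.

End change_of_variables.

Section onto.
Variable R : realType.
Local Notation leb := (@lebesgue_measure R).
Implicit Types (F f G : R -> R) (a b : R).

Lemma is_derive1_continuous F (x y : R) : is_derive x 1 F y -> {for x, continuous F}.
Proof.
move=> dF; apply: differentiable_continuous; apply/derivable1_diffP.
by case: dF.
Qed.

Lemma integral_itvcc_derive F f a b : a <= b ->
  (forall x : R, a <= x <= b -> is_derive x 1 F (f x)) ->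
  (forall x, a <= x <= b -> {for x, continuous f}) ->
  (\int[leb]_(x in `[a, b]) (f x)%:E = (F b - F a)%:E)%E.
Proof.
rewrite le_eqVlt => /predU1P[<- _ _|ab dF cf].
  by rewrite set_itv1 integral_set1 subrr.
have cF x : a <= x <= b -> {for x, continuous F}.
  by move=> xab; exact: is_derive1_continuous (dF _ xab).
rewrite (@continuous_FTC2 _ f F) ?EFinB//.
- apply: continuous_in_subspaceT => x; rewrite inE /= in_itv/= => xab.
  exact: cf.
- split.
  + move=> x; rewrite in_itv/= => /andP[ax xb].
    by have [] := dF x; rewrite ?(ltW ax) ?(ltW xb).
  + by apply: cvg_at_right_filter; apply: cF; rewrite lexx ltW.
  + by apply: cvg_at_left_filter; apply: cF; rewrite lexx ltW.
- move=> x; rewrite in_itv/= => /andP[ax xb].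
  rewrite derive1E; have := dF x; rewrite (ltW ax) (ltW xb) => /(_ isT) d.
  exact: derive_val.
Qed.

(** As [F] maps [I] increasingly onto the whole line, the preimage of ]a, b] is ]G a, G b]. The
    fundamental theorem of calculus is then used on a closed interval inside [I], so nothing is
    asked of [F] at the ends of [I]. *)
Lemma ge0_change_of_variables_onto (I : interval R) F f G (g : R -> \bar R) :
  open [set` I] -> (forall y, G y \in I) -> cancel G F ->
  {in I &, {homo F : x y / x < y}} ->
  {in I, forall x : R, is_derive x 1 F (f x)} ->
  {in I, forall x : R, {for x, continuous f}} ->
  {in I, forall x, 0 <= f x} ->
  measurable_fun setT g -> (forall y, 0 <= g y)%E ->
  (\int[leb]_y g y = \int[leb]_(x in [set` I]) (g (F x) * (f x)%:E))%E.
Proof.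
move=> oI GI GK Fi dF cf f0 mg g0.
have Fm : {in I &, {mono F : x y / x < y}} by apply: leW_mono_in; apply: le_mono_in.
have mf : measurable_fun [set` I] f.
  by apply: open_continuous_measurable_fun => // x; rewrite inE => /cf.
apply: ge0_change_of_variables => //.
- apply: open_continuous_measurable_fun => // x; rewrite inE => xI.
  exact: is_derive1_continuous (dF _ xI).
move=> a b ab.
have Gab : G a < G b by rewrite -Fm// !GK.
have sub x : G a <= x <= G b -> x \in I.
  move=> xab; apply: (interval_is_interval (GI a) (GI b)) => //=.
rewrite (_ : _ `&` _ = `]G a, G b]%classic).
  rewrite integral_itv_obnd_cbnd.
    have := integral_itvcc_derive (ltW Gab) (fun x h => dF _ (sub x h)) (fun x h => cf _ (sub x h)).
    by rewrite !GK.
  apply/measurable_EFinP; apply: measurable_funS mf => //.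
  by move=> x /=; rewrite in_itv/= => /andP[/ltW ax xb]; apply: sub; rewrite ax.
have FGl x : x \in I -> (a < F x) = (G a < x) by move=> xI; rewrite -{1}(GK a) Fm.
have FGr x : x \in I -> (F x <= b) = (x <= G b).
  by move=> xI; rewrite -{1}(GK b) leNgt Fm// -leNgt.
apply/seteqP; split=> [x [xI /=]|x].
  by rewrite !in_itv/= FGl ?FGr.
move=> xab; rewrite /= in_itv/= in xab; have xI : x \in I by apply: sub; case/andP: xab => /ltW -> ->.
by split; [exact: xI|rewrite /= in_itv/= FGl ?FGr].
Qed.

End onto.

(** * Substitutions along a ray and the polar map *)

Section polar.
Variable R : realType.
Local Notation leb := (@lebesgue_measure R).

Lemma measurable_inv : measurable_fun setT (fun x : R => x^-1).
Proof.
rewrite (_ : (fun _ => _) = (fun x => x * (x ^+ 2) `^ (-1))).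
  apply: measurable_funM => //.
  apply: (measurableT_comp (measurable_powR (-1))).
  exact: exprn_measurable.
apply/funext => x; rewrite powR_inv1 ?sqr_ge0//.
have [->|x0] := eqVneq x 0; first by rewrite invr0 mul0r.
by rewrite expr2 invfM mulrA divff// mul1r.
Qed.

Lemma measurable_funV d (T : measurableType d) (f : T -> R) :
  measurable_fun setT f -> measurable_fun setT (fun x => (f x)^-1).
Proof. by move=> mf; apply: measurableT_comp; [exact: measurable_inv|]. Qed.

Lemma measurable_atan : measurable_fun setT (@atan R).
Proof. by apply: continuous_measurable_fun => x; exact: continuous_atan. Qed.

(* [hcosh z] is cosh of the hyperbolic distance from the origin to [z]. *)
Definition hcosh (z : R * R) : R := (1 + sqnorm z) / (1 - sqnorm z).

Definition hpolar (z : R * R) : R * R := (hcosh z, atan (z.2 / z.1)).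

Definition strip : set (R * R) := `]1, +oo[ `*` `](- (pi / 2)), (pi / 2)[.

Lemma measurable_sqnorm : measurable_fun setT (@sqnorm R).
Proof.
by apply: measurable_funD; apply: measurable_funX;
  [exact: measurable_fst|exact: measurable_snd].
Qed.

Lemma measurable_hcosh : measurable_fun setT hcosh.
Proof.
apply: measurable_funM; last apply: measurable_funV.
  exact: measurable_funD measurable_sqnorm.
exact: measurable_funB measurable_sqnorm.
Qed.

Lemma measurable_hpolar : measurable_fun setT hpolar.
Proof.
apply: measurable_fun_pair; first exact: measurable_hcosh.
apply: measurableT_comp; first exact: measurable_atan.
apply: measurable_funM; first exact: measurable_snd.
by apply: measurable_funV; exact: measurable_fst.
Qed.

Lemma measurable_hplane : measurable (@hplane R).
Proof. exact: measurable_set_ltr measurable_sqnorm _. Qed.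

Lemma measurable_preimageT d d' (T : measurableType d) (T' : measurableType d')
    (f : T -> T') (B : set T') :
  measurable_fun setT f -> measurable B -> measurable (f @^-1` B).
Proof. by move=> mf mB; rewrite -[X in measurable X]setTI; exact: mf. Qed.

Lemma ge0_scaling (x : R) (g : R -> \bar R) : 0 < x ->
  measurable_fun setT g -> (forall y, 0 <= g y)%E ->
  (\int[leb]_y g y = \int[leb]_t (g (x * t)%R * x%:E))%E.
Proof.
move=> x0 mg g0; rewrite -[in RHS]set_itvNyy.
apply: (@ge0_change_of_variables_onto _ _ ( *%R x) (fun=> x) (fun y => x^-1 * y)) => //.
- by move=> y; rewrite mulrA divff ?mul1r// gt_eqF.
- by move=> y z _ _; rewrite ltr_pM2l.
- by move=> y _; apply: is_derive_eq; rewrite ?scaler0 ?add0r//= /GRing.scale/= mulr1.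
- by move=> y _; exact: cst_continuous.
- by move=> y _; exact: ltW.
Qed.

(** Substitution w = (1 + c x^2) / (1 - c x^2): with c = 1 + t^2 this is [hcosh] at the point (x, x
    t). Both sides are carried to the whole line by u = ln (w - 1), since the line is the target of
    the change of variables above. *)
Lemma ge0_radial (c : R) (p : R -> \bar R) : 0 < c ->
  measurable_fun setT p -> (forall y, 0 <= p y)%E ->
  (\int[leb]_(w in `]1%R, +oo[) p w =
   \int[leb]_(x in `]0%R, ((Num.sqrt c)^-1)%R[)
     (p ((1 + c * x ^+ 2) / (1 - c * x ^+ 2))%R *
      (4 * c * x / (1 - c * x ^+ 2) ^+ 2)%:E))%E.
Proof.
move=> c0 mp p0.
pose q u := (p (1 + expR u)%R * (expR u)%:E)%E.
have q0 u : (0 <= q u)%E by rewrite mule_ge0// lee_fin expR_ge0.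
have mq : measurable_fun setT q.
  have me : measurable_fun setT (@expR R) by exact: measurable_expR.
  have m1 : measurable_fun setT (fun u : R => 1 + expR u).
    exact: measurable_funD.
  have m2 : measurable_fun setT (fun u : R => (expR u)%:E).
    exact: (iffRL (measurable_EFinP _ _) me).
  exact: (emeasurable_funM (measurableT_comp mp m1) m2).
transitivity (\int[leb]_u q u)%E.
  rewrite (@ge0_change_of_variables_onto _ `]1%R, +oo[ (fun w => ln (w - 1))
     (fun w => (w - 1)^-1) (fun u => 1 + expR u) q)//.
  - apply: eq_integral => w; rewrite inE/= in_itv/= andbT => w1.
    rewrite /q lnK ?posrE ?subr_gt0// -muleA -EFinM divff ?mule1 ?subr_eq0 ?gt_eqF//.
    by rewrite addrC subrK.
  - by move=> y; rewrite in_itv/= ltrDl expR_gt0.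
  - by move=> u /=; rewrite addrC addrA addNr add0r expRK.
  - move=> x y; rewrite !in_itv/= !andbT => x1 y1 xy.
    by rewrite ltr_ln ?posrE ?subr_gt0// ltrD2r.
  - move=> x; rewrite in_itv/= andbT => x1.
    have l1 : 0 < x - 1 by rewrite subr_gt0.
    have := is_derive1_ln l1 => d1.
    rewrite -[X in is_derive _ _ _ X]mulr1.
    apply: (@is_derive1_comp _ (@ln R) (fun w => w - 1)).
    by apply: is_derive_eq; rewrite subr0.
  - move=> x; rewrite in_itv/= andbT => x1.
    apply: continuousV; first by rewrite subr_eq0 gt_eqF.
    by apply: continuousB; [exact: cvg_id|exact: cst_continuous].
  - by move=> x; rewrite in_itv/= andbT => x1; rewrite invr_ge0 subr_ge0 ltW.
pose e (x : R) := 1 - c * x ^+ 2.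
have sc0 : 0 < Num.sqrt c by rewrite sqrtr_gt0.
have e0 x : x \in `]0, (Num.sqrt c)^-1[ -> 0 < x /\ 0 < e x.
  rewrite in_itv/= => /andP[x0 xc]; split => //; rewrite subr_gt0.
  rewrite -[c in c * _]sqr_sqrtr ?ltW// -exprMn expr_lt1// ?mulr_ge0 ?ltW//.
  by rewrite mulrC -ltr_pdivlMr// mul1r.
have ex0 u : 0 < expR u :> R by exact: expR_gt0.
have e20 u : 0 < 2 + expR u :> R by rewrite addr_gt0.
(* Solves w - 1 = e^u for x, as c x^2 = (w - 1) / (w + 1). *)
pose G u := Num.sqrt (expR u / (c * (2 + expR u))).
have G2 u : G u ^+ 2 = expR u / (c * (2 + expR u)).
  by rewrite sqr_sqrtr// divr_ge0 ?mulr_ge0 ?ltW.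
rewrite (@ge0_change_of_variables_onto _ `]0, (Num.sqrt c)^-1[
  (fun x => ln (2 * (e x)^-1 - 2)) (fun x => 2 / (x * e x)) G q)//.
- apply: eq_integral => x; rewrite inE/= => /e0[x0 ex].
  have gE : 2 * (e x)^-1 - 2 = 2 * c * x ^+ 2 / e x.
    by rewrite /e; field; rewrite -/(e x) gt_eqF.
  have g0 : 0 < 2 * (e x)^-1 - 2.
    by rewrite gE divr_gt0// mulr_gt0 ?exprn_gt0// mulr_gt0.
  rewrite /q lnK ?posrE// -muleA -EFinM; congr (p _ * _%:E)%E; rewrite -/(e x).
    by rewrite /e; field; rewrite -/(e x) gt_eqF.
  by rewrite gE /e; field; rewrite -/(e x) !gt_eqF.
- move=> u; rewrite in_itv/=; apply/andP; split.
    by rewrite sqrtr_gt0 divr_gt0// mulr_gt0.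
  rewrite -sqrtrV ?ltW// ltr_sqrt ?invr_gt0// ltr_pdivrMr ?mulr_gt0// mulrA.
  by rewrite mulVf ?gt_eqF// mul1r ltrDr.
- move=> u /=; rewrite /e G2 (_ : _ - 2 = expR u) ?expRK//.
  by field; rewrite !gt_eqF//=; move: (ex0 u); lra.
- move=> x y /e0[x0 ex] /e0[y0 ey] xy.
  have exy : e y < e x by rewrite /e ltrD2l ltrN2 ltr_pM2l// ltr_pXn2r ?nnegrE ?ltW.
  have ge z : 0 < z -> 0 < e z -> 0 < 2 * (e z)^-1 - 2.
    move=> z0 ez; rewrite subr_gt0 ltr_pdivlMr// gtr_pMr// /e ltrBlDr ltrDl.
    by rewrite mulr_gt0// exprn_gt0.
  by rewrite ltr_ln ?posrE ?ge// ltrD2r ltr_pM2l// ltf_pV2.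
- move=> x /e0[x0 ex].
  have gE : 2 * (e x)^-1 - 2 = 2 * c * x ^+ 2 / e x.
    by rewrite /e; field; rewrite -/(e x) gt_eqF.
  have g0 : 0 < 2 * (e x)^-1 - 2.
    by rewrite gE divr_gt0// mulr_gt0 ?exprn_gt0// mulr_gt0.
  have d1 := is_derive1_ln g0.
  have de : is_derive x (1 : R) e (- (2 * c * x)).
    rewrite /e; apply: is_derive_eq.
    by rewrite /GRing.scale/=; ring.
  have dV := is_deriveV (lt0r_neq0 ex) de.
  rewrite (_ : 2 / _ = (2 * (e x)^-1 - 2)^-1 * (4 * c * x / e x ^+ 2)).
    apply: (@is_derive1_comp _ (@ln R) (fun x => 2 * (e x)^-1 - 2)).
    apply: is_derive_eq; rewrite /GRing.scale/= subr0.
    by field; rewrite gt_eqF.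
  by rewrite gE; field; rewrite !gt_eqF.
- move=> x /e0[x0 ex].
  apply: continuousM; first exact: cst_continuous.
  apply: continuousV; first by rewrite mulf_neq0// gt_eqF.
  apply: continuousM; first exact: cvg_id.
  apply: continuousB; first exact: cst_continuous.
  by apply: continuousM; [exact: cst_continuous|exact: exprn_continuous].
- by move=> x /e0[x0 ex]; rewrite divr_ge0// mulr_ge0 ?ltW.
Qed.
End polar.

(** * Hyperbolic area in polar coordinates *)

Section polar.
Variable R : realType.
Local Notation leb := (@lebesgue_measure R).

Definition hdensity (z : R * R) : \bar R := (4 / (1 - sqnorm z) ^+ 2)%:E.

Lemma hdensity_ge0 z : (0 <= hdensity z)%E.
Proof. by rewrite lee_fin divr_ge0// exprn_even_ge0. Qed.

Lemma measurable_hdensity : measurable_fun setT hdensity.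
Proof.
apply/measurable_EFinP; apply: measurable_funM => //.
apply: measurable_funV; apply: measurable_funX.
by apply: measurable_funB => //; exact: measurable_sqnorm.
Qed.

Lemma hdensity_restrict_ge0 (A : set (R * R)) z : (0 <= (hdensity \_ A) z)%E.
Proof. by rewrite patchE; case: ifPn => // _; exact: hdensity_ge0. Qed.

Lemma measurable_hdensity_restrict (A : set (R * R)) :
  measurable A -> measurable_fun setT (hdensity \_ A).
Proof.
by move=> mA; apply: (iffLR (measurable_restrictT _ mA)); apply: measurable_funTS;
  exact: measurable_hdensity.
Qed.

(** Three substitutions: y = x t at fixed x, then x to w at fixed slope t, then t = tan phi. The
    second leaves dw dt / (1 + t^2), and the third absorbs the remaining factor. In the half plane 0
    < x the second coordinate of [hpolar] is the true argument. *)
Theorem harea_polar (B : set (R * R)) : measurable B ->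
  harea ([set z | 0 < z.1] `&` @hpolar R @^-1` B) =
  (leb \x leb)%E (B `&` @strip R).
Proof.
move=> mB.
pose A := ([set z : R * R | 0 < z.1] `&` @hpolar R @^-1` B) `&` @hplane R.
have mx : measurable [set z : R * R | 0 < z.1].
  exact: measurable_set_ltr measurable_fst.
have mA : measurable A.
  apply: measurableI; last exact: measurable_hplane.
  apply: measurableI => //; apply: measurable_preimageT => //.
  exact: measurable_hpolar.
pose k := hdensity \_ A.
have mk : measurable_fun setT k by exact: measurable_hdensity_restrict.
have k0 z : (0 <= k z)%E by exact: hdensity_restrict_ge0.
pose h := (fun z : R * R => k (z.1, z.1 * z.2)%R * (z.1)%:E)%E \_ [set z | 0 < z.1].
have h0 z : (0 <= h z)%E.
  rewrite /h patchE; case: ifPn => //; rewrite inE /= => z0.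
  by rewrite mule_ge0// lee_fin ltW.
have mh : measurable_fun setT h.
  apply: (iffLR (measurable_restrictT _ mx)); apply: measurable_funTS.
  apply: emeasurable_funM; last by apply/measurable_EFinP; exact: measurable_fst.
  apply: (measurableT_comp mk); apply: measurable_fun_pair; first exact: measurable_fst.
  by apply: measurable_funM; [exact: measurable_fst|exact: measurable_snd].
pose b := (fun z : R * R => (\1_(B `&` (`]1, +oo[%classic `*` setT)) z)%:E : \bar R).
have mb : measurable_fun setT b.
  apply/measurable_EFinP; apply: measurable_indic; apply: measurableI => //.
  exact: measurableX.
have b0 z : (0 <= b z)%E by rewrite lee_fin.
pose N phi := (\int[leb]_w b (w, phi))%E.
have N0 phi : (0 <= N phi)%E by exact: integral_ge0.
have mN : measurable_fun setT N by exact: (@measurable_fun_fubini_tonelli_G _ _ _ _ R leb b mb b0).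
transitivity (\int[leb]_x \int[leb]_t h (x, t))%E.
  rewrite /harea integral_mkcond -/k fubini_tonelli1//.
  apply: eq_integral => x _; rewrite /fubini_F.
  have [x0|x0] := ltP 0 x.
    rewrite (@ge0_scaling _ x (fun y => k (x, y)))//; last exact: measurableT_comp.
    by apply: eq_integral => t _; rewrite /h patchE mem_set.
  rewrite !integral0_eq// => y _.
    by rewrite /h patchE memNset//= => /(le_lt_trans x0); rewrite ltxx.
  by rewrite /k patchE memNset//= => -[[/= /(le_lt_trans x0)]]; rewrite ltxx.
rewrite fubini_tonelli//.
transitivity (\int[leb]_t ((1 + t ^+ 2)^-1%:E * N (atan t)))%E.
  apply: eq_integral => t _.
  set c := 1 + t ^+ 2.
  have c0 : 0 < c by rewrite ltr_pwDl// sqr_ge0.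
  have sc0 : 0 < Num.sqrt c by rewrite sqrtr_gt0.
  pose p w := (\1_B (w, atan t))%:E : \bar R.
  have mp : measurable_fun setT p.
    apply/measurable_EFinP; apply: (measurableT_comp (measurable_indic mB)) => //.
  have NE : N (atan t) = (\int[leb]_(w in `]1%R, +oo[) p w)%E.
    rewrite [RHS]integral_mkcond; apply: eq_integral => w _.
    rewrite patchE /b /p !indicE.
    have [w1|w1] := boolP (w \in _).
      congr (_%:R%:E); congr nat_of_bool.
      apply/idP/idP; rewrite !inE /=; first by case.
      by move=> Bw; split => //; rewrite inE in w1.
    rewrite memNset//= => -[_ [/= w1' _]]; move/negP: w1; apply.
    by rewrite inE.
  have p0 w : (0 <= p w)%E by rewrite lee_fin.
  transitivity (\int[leb]_(x in `]0%R, ((Num.sqrt c)^-1)%R[)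
     ((c^-1)%:E * (p ((1 + c * x ^+ 2) / (1 - c * x ^+ 2))%R *
      (4 * c * x / (1 - c * x ^+ 2) ^+ 2)%:E)))%E; last first.
    rewrite NE (ge0_radial c0)// ge0_integralZl//; last first.
    - by rewrite lee_fin invr_ge0 ltW.
    - move=> x /=; rewrite in_itv/= => /andP[x0 _]; rewrite mule_ge0// lee_fin.
      by apply: divr_ge0; [rewrite !mulr_ge0// ltW|exact: sqr_ge0].
    have me : measurable_fun setT (fun x : R => 1 - c * x ^+ 2).
      by apply: measurable_funB => //; apply: measurable_funM => //; exact: exprn_measurable.
    have me' : measurable_fun setT (fun x : R => 1 + c * x ^+ 2).
      by apply: measurable_funD => //; apply: measurable_funM => //; exact: exprn_measurable.
    apply: measurable_funTS; apply: emeasurable_funM.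
      apply: (measurableT_comp mp); apply: measurable_funM => //.
      exact: measurable_funV.
    apply/measurable_EFinP; apply: measurable_funM.
      exact: measurable_funM.
    by apply: measurable_funV; exact: measurable_funX.
  rewrite [RHS]integral_mkcond; apply: eq_integral => x _.
  rewrite [RHS]patchE; have [|xI] := boolP (x \in _).
    rewrite inE/= in_itv/= => /andP[x0 xc].
    have xc1 : c * x ^+ 2 < 1.
      rewrite -[c in c * _]sqr_sqrtr ?ltW// -exprMn expr_lt1// ?mulr_ge0 ?ltW//.
      by rewrite mulrC -ltr_pdivlMr// mul1r.
    have sqE : sqnorm (x, x * t) = c * x ^+ 2 by rewrite /sqnorm/= /c; ring.
    have HE : hpolar (x, x * t) = ((1 + c * x ^+ 2) / (1 - c * x ^+ 2), atan t).
      by rewrite /hpolar /hcosh sqE/= mulrAC divff ?mul1r// gt_eqF.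
    rewrite /h patchE mem_set//= /k patchE /p indicE -HE.
    rewrite (_ : (_ \in A) = (hpolar (x, x * t) \in B)); last first.
      apply/idP/idP; rewrite !inE /A /hplane/= sqE; first by case=> -[].
      by move=> ?; split.
    case: ifPn => _; last by rewrite !mul0e mule0.
    rewrite mul1e /hdensity sqE -!EFinM; congr (_%:E).
    by field; rewrite !gt_eqF// subr_gt0.
  rewrite /h patchE; case: ifPn => //; rewrite inE/= => x0.
  rewrite /k patchE memNset ?mul0e// => -[[_ _]]; rewrite /hplane/= => sq.
  move/negP: xI; apply; rewrite inE/= in_itv/= x0/=.
  rewrite -[ltRHS]mul1r ltr_pdivlMr// mulrC.
  rewrite -(@ltr_pXn2r _ 2)// ?nnegrE ?mulr_ge0 ?ltW// exprMn sqr_sqrtr ?ltW//.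
  by rewrite expr1n (_ : c * _ = sqnorm (x, x * t))// /sqnorm/= /c; ring.
rewrite (@ge0_change_of_variables_onto _ `](- (pi / 2)), (pi / 2)[ (@tan R)
   (fun x => cos x ^- 2) (@atan R)); last 9 first.
- exact: interval_open.
- by move=> y; rewrite in_itv/= atan_gtNpi2 atan_ltpi2.
- exact: atanK.
- by move=> x y xJ yJ; rewrite ltr_tan.
- move=> x; rewrite in_itv/= => xJ; apply: is_derive_tan.
  by rewrite gt_eqF// cos_gt0_pihalf.
- move=> x; rewrite in_itv/= => xJ; apply: continuousV.
    by rewrite expf_neq0// gt_eqF// cos_gt0_pihalf.
  apply: (@continuous_comp _ _ _ (@cos R) (fun x => x ^+ 2)).
    exact: continuous_cos.
  exact: exprn_continuous.
- by move=> x _; rewrite invr_ge0 sqr_ge0.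
- apply: emeasurable_funM; last exact: (measurableT_comp mN (@measurable_atan R)).
  by apply/measurable_EFinP; apply: measurable_funV; exact: measurable_funD.
- by move=> y; rewrite mule_ge0// lee_fin invr_ge0 addr_ge0// sqr_ge0.
have mBS : measurable (B `&` @strip R).
  by apply: measurableI => //; apply: measurableX; exact: measurable_itv.
rewrite -[RHS]mul1e -integral_cst//.
rewrite [RHS]integral_mkcond fubini_tonelli2; last 2 first.
- by apply: (iffLR (measurable_restrictT _ mBS)).
- by move=> z; rewrite patchE; case: ifPn.
rewrite [LHS]integral_mkcond; apply: eq_integral => phi _.
rewrite patchE /fubini_G; case: ifPn => [|Jphi].
  rewrite inE/= => Jphi; rewrite tanK// cos2_tan2; last first.
    by rewrite gt_eqF// cos_gt0_pihalf.
  rewrite muleAC -EFinM mulVf ?mul1e; last by rewrite gt_eqF// ltr_pwDl// sqr_ge0.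
  apply: eq_integral => w _; rewrite patchE /b indicE.
  rewrite (_ : (_ \in B `&` @strip R) = ((w, phi) \in B `&` (`]1, +oo[ `*` setT))).
    by case: ifPn.
  by apply/idP/idP; rewrite !inE /strip/= => -[? [? ?]]; split.
rewrite integral0_eq// => w _; rewrite patchE memNset// /strip/= => -[_ [_ Jphi']].
by move/negP: Jphi; apply; rewrite inE.
Qed.
End polar.

(** * Void probabilities *)

Section pgf.
Context (R : realType) (d : measure_display) (Om : measurableType d)
  (P : {measure set Om -> \bar R}).

(** [C i k] stands for the event N_i = k, and [g i] for z_i^(N_i). The induction fixes the last
    count by moving its event into [W] and its probability into [a]; this is why both are
    general. *)
Lemma integral_prod_pgf (C : nat -> nat -> set Om) (z : nat -> R)
    (g : nat -> Om -> R) (p : nat -> nat -> R) (phi : nat -> R) :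
  (forall i k, measurable (C i k)) -> (forall i, 0 <= z i) ->
  (forall i k, 0 <= p i k) ->
  (forall i, measurable_fun setT (g i)) -> (forall i w, 0 <= g i w) ->
  (forall i w, (g i w)%:E = \sum_(k <oo) (z i ^+ k * \1_(C i k) w)%:E)%E ->
  (forall i, (phi i)%:E = \sum_(k <oo) (z i ^+ k * p i k)%:E)%E ->
  forall m W a, measurable W -> 0 <= a ->
  (forall k : nat -> nat,
     P (W `&` [set w | forall i, (i < m)%N -> C i (k i) w]) =
     (a * \prod_(i < m) p i (k i))%:E) ->
  (\int[P]_(w in W) (\prod_(i < m) g i w)%:E = (a * \prod_(i < m) phi i)%:E)%E.
Proof.
move=> mC z0 p0 mg g0 gE phiE; elim=> [|m IH] W a mW a0 HP.
  rewrite big_ord0 mulr1; under eq_integral do rewrite big_ord0.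
  rewrite integral_cst//= mul1e; have := HP (fun=> 0%N).
  rewrite big_ord0 mulr1 => <-; congr (P _).
  by apply/seteqP; split=> w; [split|case].
have F0 w : 0 <= \prod_(i < m) g i w by apply: prodr_ge0.
have mF : measurable_fun setT (fun w => \prod_(i < m) g i w).
  by apply: measurable_prod => i _.
transitivity (\sum_(k <oo) \int[P]_(w in W)
   ((\prod_(i < m) g i w) * (z m ^+ k * \1_(C m k) w))%:E)%E.
  rewrite -integral_nneseries//; last 2 first.
  - move=> k; apply/measurable_EFinP; apply: measurable_funTS; apply: measurable_funM => //.
    by apply: measurable_funM => //; exact: measurable_indic.
  - by move=> k w _; rewrite lee_fin !mulr_ge0// exprn_ge0.
  apply: eq_integral => w _; rewrite big_ord_recr/= EFinM gE.
  rewrite -nneseriesZl//; last by move=> k _; rewrite lee_fin mulr_ge0// exprn_ge0.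
rewrite big_ord_recr/= mulrA EFinM phiE -nneseriesZl; last first.
  by move=> k _; rewrite lee_fin mulr_ge0// exprn_ge0.
apply: eq_eseriesr => k _.
transitivity ((z m ^+ k)%:E * \int[P]_(w in W `&` C m k) (\prod_(i < m) g i w)%:E)%E.
  rewrite integral_mkcondr -ge0_integralZl//; last 3 first.
  - apply: measurable_funTS; apply: (iffLR (measurable_restrictT _ (mC m k))).
    by apply: measurable_funTS; apply/measurable_EFinP.
  - by move=> w _; rewrite patchE; case: ifPn => _; rewrite ?lee_fin.
  - by rewrite lee_fin exprn_ge0.
  apply: eq_integral => w _; rewrite patchE indicE mulrCA EFinM; congr (_ * _)%E.
  by case: ifPn; rewrite ?mulr1 ?mulr0.
rewrite (IH _ (a * p m k)).
- by rewrite -!EFinM; congr (_%:E); ring.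
- exact: measurableI.
- exact: mulr_ge0.
move=> kk; have := HP (fun i => if i == m then k else kk i).
rewrite big_ord_recr/= eqxx => HPk.
transitivity (a * ((\prod_(i < m) p i (kk i)) * p m k))%:E; last first.
  by congr (_%:E); ring.
rewrite (eq_bigr (fun i : 'I_m => p i (if i == m :> nat then k else kk i))).
  rewrite -HPk; congr (P _); apply/seteqP; split=> w /=.
    move=> [[Ww Cw] H]; split=> // i; rewrite ltnS leq_eqVlt => /orP[/eqP->|im].
      by rewrite eqxx.
    by rewrite ltn_eqF//; exact: H.
  move=> [Ww H]; split; first by split=> //; have := H m (ltnSn m); rewrite eqxx.
  by move=> i im; have := H i (ltnW im); rewrite ltn_eqF.
by move=> i _; rewrite ltn_eqF.
Qed.

Lemma indic_series (C : nat -> set Om) (z : R) (w : Om) (k : nat) :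
  (forall i j, C i w -> C j w -> i = j) -> 0 <= z -> C k w ->
  (\sum_(j <oo) (z ^+ j * \1_(C j) w)%:E = (z ^+ k)%:E)%E.
Proof.
move=> tC z0 Ck; rewrite (@nneseriesD1 _ _ k)//; last first.
  by move=> j _; rewrite lee_fin mulr_ge0// exprn_ge0.
rewrite indicE mem_set// mulr1 eseries0 ?adde0// => j _ /= jk.
rewrite indicE memNset ?mulr0// => Cj; move/negP: jk; apply; apply/eqP; exact: tC Cj Ck.
Qed.

End pgf.

Section poisson_series.
Variable R : realType.

Lemma expR_eseries (x : R) : 0 <= x ->
  (\sum_(k <oo) (x ^+ k / k`!%:R)%:E = (expR x)%:E)%E.
Proof.
move=> x0; rewrite (_ : (fun _ => _) = EFin \o series (exp_coeff x)).
  by rewrite EFin_lim//; exact: is_cvg_series_exp_coeff.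
by apply/funext => N; rewrite /= /series/= sumEFin.
Qed.

Lemma poisson_pgf (m z : R) : 0 <= m -> 0 <= z ->
  (\sum_(k <oo) (z ^+ k * (expR (- m) * m ^+ k / k`!%:R))%:E =
   (expR (- (m * (1 - z))))%:E)%E.
Proof.
move=> m0 z0.
transitivity (\sum_(k <oo) ((expR (- m))%:E * ((m * z) ^+ k / k`!%:R)%:E))%E.
  by apply: eq_eseriesr => k _; rewrite -EFinM exprMn; congr (_%:E); ring.
rewrite nneseriesZl; last first.
  by move=> k _; rewrite lee_fin divr_ge0// exprn_ge0// mulr_ge0.
rewrite expR_eseries ?mulr_ge0// -EFinM -expRD; congr (expR _)%:E; ring.
Qed.

End poisson_series.

Section count.
Context (R : realType) (d : measure_display) (Om : measurableType d)
  (P : probability Om R) (X : nat -> {RV P >-> (R * R)%type}).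
Implicit Types A : set (R * R).

Lemma point_countE A w : point_count X A w = (\sum_(n <oo) (\1_A (X n w))%:E)%E.
Proof. by apply: eq_eseriesr => n _; rewrite diracE indicE. Qed.

Lemma measurable_count_event A k : measurable A -> measurable (count_event X A k).
Proof.
move=> mA; rewrite /count_event.
have mp : measurable_fun setT (point_count X A).
  rewrite (_ : point_count X A = (fun w => \sum_(n <oo) (\1_A (X n w))%:E)%E); last first.
    by apply/funext => w; exact: point_countE.
  apply: ge0_emeasurable_sum => [n w _ _|n _]; first by rewrite lee_fin.
  apply/measurable_EFinP; apply: measurableT_comp => //.
rewrite (_ : mkset _ = point_count X A @^-1` [set k%:R%:E])//.
by apply: measurable_preimageT => //; exact: emeasurable_set1.
Qed.

(** A finite count is reached after finitely many points, so the infinite product over the points is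
    the limit of an eventually constant sequence. *)
Lemma count_event_eventually A k w (z : R) : count_event X A k w ->
  \forall N \near \oo, \prod_(n < N) (if X n w \in A then z else 1) = z ^+ k.
Proof.
rewrite /count_event/= point_countE => Ck.
pose s N := (\sum_(n < N) (X n w \in A : nat))%N.
have prodE N : \prod_(n < N) (if X n w \in A then z else 1) = z ^+ s N.
  rewrite /s; elim: N => [|N IH]; first by rewrite !big_ord0.
  by rewrite !big_ord_recr/= IH exprD; case: (_ \in _); rewrite ?expr1.
have smono M N : (M <= N)%N -> (s M <= s N)%N.
  move=> /subnKC <-; elim: (N - M)%N => [|j IH]; first by rewrite addn0.
  by rewrite addnS (leq_trans IH)// /s big_ord_recr/= leq_addr.
have sE N : (\sum_(0 <= n < N) (\1_A (X n w))%:E = (s N)%:R%:E :> \bar R)%E.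
  rewrite big_mkord /s natr_sum -sumEFin; apply: eq_bigr => n _.
  by rewrite indicE.
have sk N : (s N <= k)%N.
  rewrite -(ler_nat R) -lee_fin -sE -Ck; apply: nneseries_lim_ge.
  by move=> n _; rewrite lee_fin.
(* Partial counts below k at every stage would stay at most k - 1, and so would their limit, which
   is k. *)
have [N0 sN0] : exists N0, s N0 = k.
  apply: contrapT => /forallNP sNk.
  have sk1 N : (s N < k)%N by rewrite ltn_neqAle sk andbT; apply/eqP.
  suff : ((k%:R)%:E <= (k%:R - 1)%:E :> \bar R)%E by rewrite lee_fin; lra.
  rewrite -Ck; apply: lime_le.
    by apply: is_cvg_nneseries => n _ _; rewrite lee_fin.
  apply: nearW => N /=; rewrite sE lee_fin lerBrDr.
  by rewrite -[X in _ + X](_ : 1%:R = 1)// -natrD ler_nat addn1.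
near=> N; rewrite prodE; congr (z ^+ _); apply/eqP.
rewrite eqn_leq sk -{1}sN0 smono//; near: N; exact: nbhs_infty_ge.
Unshelve. all: by end_near. Qed.

Lemma prod_ler1 (I : Type) (s : seq I) (F : I -> R) :
  (forall i, 0 <= F i <= 1) -> 0 <= \prod_(i <- s) F i <= 1.
Proof.
move=> F01; elim: s => [|i s /andP[IH0 IH1]]; rewrite ?big_nil ?big_cons ?ler01 ?lexx//.
have /andP[Fi0 Fi1] := F01 i.
by rewrite mulr_ge0// mulr_ile1.
Qed.

Variables (lam : R) (lam_gt0 : 0 < lam) (XP : poisson_process lam X).

Lemma harea_ge0 A : (0 <= harea A)%E.
Proof.
by apply: integral_ge0 => z _; rewrite lee_fin divr_ge0// exprn_even_ge0.
Qed.

Lemma count_event_inj A w k l : count_event X A k w -> count_event X A l w -> k = l.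
Proof. by rewrite /count_event/= => -> [] /eqP; rewrite eqr_nat => /eqP. Qed.

(** The Poisson weights sum to 1, by the generating function at z = 1, so no probability is left for
    an infinite count. *)
Lemma ae_count_event A : measurable A -> (harea A < +oo)%E ->
  {ae P, forall w, exists k, count_event X A k w}.
Proof.
move=> mA Aoo; pose C k := count_event X A k.
have mC k : measurable (C k) by exact: measurable_count_event.
have mu0 : 0 <= lam * fine (harea A).
  by apply: mulr_ge0; [exact: ltW|exact/fine_ge0/harea_ge0].
have mU : measurable (\bigcup_k C k) by exact: bigcupT_measurable.
exists (~` \bigcup_k C k); split; first exact: measurableC.
  rewrite probability_setC// measure_bigcup//; last first.
    by move=> k l _ _ [w [Ck Cl]]; exact: count_event_inj Ck Cl.
  rewrite (_ : (\sum_(_ <oo | _) _)%E = 1%E) ?subee//.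
  have := @poisson_pgf _ (lam * fine (harea A)) 1 mu0 ler01.
  rewrite subrr mulr0 oppr0 expR0 => <-; apply: congr_lim; apply/funext => n.
  apply: eq_big => k; first by rewrite in_setT.
  by move=> _; rewrite expr1n mul1r; exact: (poisson_count_law XP).
by move=> w /= nC [k _ Ck]; apply: nC; exists k.
Qed.

(** Almost surely the finite products stabilise at the product of the z_i^(N_i); all of them lie in
    [0, 1], so dominated convergence applies. *)
Lemma generating_functional (A : nat -> set (R * R)) (z : nat -> R) (m : nat) :
  (forall i, measurable (A i)) -> (forall i, (harea (A i) < +oo)%E) ->
  trivIset setT A -> (forall i, 0 <= z i <= 1) ->
  (\int[P]_w (\prod_(n < N) \prod_(i < m) (if X n w \in A i then z i else 1))%:E)%E
    @[N --> \oo] -->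
  (\prod_(i < m) expR (- (lam * fine (harea (A i)) * (1 - z i))))%:E.
Proof.
move=> mA Aoo tA z01.
have z0 i : 0 <= z i by case/andP: (z01 i).
pose mu i := lam * fine (harea (A i)).
have mu0 i : 0 <= mu i by apply: mulr_ge0; [exact: ltW|exact/fine_ge0/harea_ge0].
pose C i k := count_event X (A i) k.
have mC i k : measurable (C i k) by exact: measurable_count_event.
have Cinj i w k l : C i k w -> C i l w -> k = l.
  exact: count_event_inj.
pose p i k := expR (- mu i) * mu i ^+ k / k`!%:R.
have PC i k : P (C i k) = (p i k)%:E by exact: poisson_count_law XP _ _ _ _.
have p0 i k : 0 <= p i k by rewrite divr_ge0// mulr_ge0 ?expR_ge0// exprn_ge0.
(* z_i^(N_i) as a series over the level events, hence measurable; the value is 0 where the count is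
   infinite. *)
pose gs i w := (\sum_(k <oo) (z i ^+ k * \1_(C i k) w)%:E : \bar R)%E.
pose g i w := fine (gs i w).
have gsE i k w : C i k w -> gs i w = (z i ^+ k)%:E.
  by move=> Cw; apply: indic_series => // j l; exact: Cinj.
have gsfin i w : gs i w \is a fin_num.
  have [[k /gsE->//]|/forallNP nC] := pselect (exists k, C i k w).
  by rewrite /gs eseries0// => k _ _; rewrite indicE memNset ?mulr0//; exact: nC.
have g01 i w : 0 <= g i w <= 1.
  rewrite /g; have [[k /gsE->//]|/forallNP nC] := pselect (exists k, C i k w).
    by rewrite /= exprn_ge0//= exprn_ile1//; case/andP: (z01 i).
  by rewrite /gs eseries0 ?lexx ?ler01// => k _ _; rewrite indicE memNset ?mulr0//; exact: nC.
have mg i : measurable_fun setT (g i).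
  rewrite /g; apply: measurableT_comp; first exact: fine_measurable.
  apply: ge0_emeasurable_sum => [k w _ _|k _]; first by rewrite lee_fin mulr_ge0// exprn_ge0.
  by apply/measurable_EFinP; apply: measurable_funM => //; exact: measurable_indic.
have <- : (\int[P]_w (\prod_(i < m) g i w)%:E =
    (\prod_(i < m) expR (- (lam * fine (harea (A i)) * (1 - z i))))%:E)%E.
  rewrite (@integral_prod_pgf _ _ _ P C z g p (fun i => expR (- (mu i * (1 - z i)))) _ _ _ _ _ _ _ m setT 1)//.
  - by rewrite mul1r.
  - by move=> i w; case/andP: (g01 i w).
  - by move=> i w; rewrite /g fineK.
  - by move=> i; rewrite poisson_pgf.
  - move=> k; rewrite setTI mul1r.
    transitivity (P (\bigcap_(i in [set: 'I_m]) count_event X (A i) (k i))).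
      congr (P _); apply/seteqP; split=> w /=; first by move=> H i _; exact: H.
      by move=> H i im; exact: (H (Ordinal im)).
    rewrite (poisson_count_indep XP (A := fun i : 'I_m => A i) (fun i : 'I_m => k i))//.
      rewrite -prodEFin; apply: eq_bigr => i _; exact: PC.
    by move=> i j _ _ /(tA _ _ I I) ij; apply: val_inj.
have ae_count i : {ae P, forall w, exists k, C i k w} by exact: ae_count_event.
pose f N w : R := \prod_(n < N) \prod_(i < m) (if X n w \in A i then z i else 1).
have f01 N w : 0 <= f N w <= 1.
  apply: prod_ler1 => n; apply: prod_ler1 => i.
  by case: ifP; rewrite ?z01 ?ler01 ?lexx.
have mf N : measurable_fun setT (f N).
  apply: measurable_prod => n _; apply: measurable_prod => i _.
  rewrite (_ : (fun _ => _) = (fun w => 1 + (z i - 1) * \1_(A i) (X n w))).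
    apply: measurable_funD => //; apply: measurable_funM => //.
    by apply: measurableT_comp => //; exact: measurable_indic.
  by apply/funext => w; rewrite indicE; case: ifP => _; rewrite ?mulr0 ?addr0// mulr1 addrC subrK.
have := @dominated_convergence _ _ R P setT measurableT (fun N w => (f N w)%:E)
  (fun w => (\prod_(i < m) g i w)%:E) (cst 1%E).
case=> //.
- by move=> N; apply/measurable_EFinP.
- by apply/measurable_EFinP; apply: measurable_prod.
- have : {ae P, forall w i, exists k, C i k w} by apply: ae_foralln.
  apply: filterS => w Cw _; apply/cvg_EFin; first exact: nearW.
  have key m' : (\prod_(j < m') \prod_(n < N) (if X n w \in A j then z j else 1))
      @[N --> \oo] --> \prod_(i < m') g i w.
    elim: m' => [|m' IH].
      by under eq_cvg do rewrite big_ord0; rewrite big_ord0; exact: cvg_cst.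
    under eq_cvg do rewrite big_ord_recr/=.
    rewrite big_ord_recr/=; apply: cvgM => //.
    have [k Ck] := Cw m'; rewrite /g (gsE _ _ _ Ck)/=.
    by apply: cvg_near_cst; exact: count_event_eventually Ck.
  rewrite (_ : fine \o _ =
    (fun N => \prod_(j < m) \prod_(n < N) (if X n w \in A j then z j else 1))) //.
  by apply/funext => N; rewrite /= /f exchange_big.
- exact: finite_measure_integrable_cst.
- apply: aeW => w N _; have /andP[f0 f1] := f01 N w.
  by rewrite /= ger0_norm// lee_fin.
Qed.

End count.

Section hintegral.
Variable R : realType.
Local Notation leb := (@lebesgue_measure R).
Implicit Types (A K : set (R * R)) (f g q : R * R -> R).

Definition hdens : R * R -> \bar R := @hdensity R \_ @hplane R.

Definition hintegral f : \bar R := (\int[leb \x leb]_z ((f z)%:E * hdens z))%E.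

Lemma hdens_ge0 z : (0 <= hdens z)%E.
Proof. exact: hdensity_restrict_ge0. Qed.

Lemma measurable_hdens : measurable_fun setT hdens.
Proof. apply: measurable_hdensity_restrict; exact: measurable_hplane. Qed.

Lemma measurable_hintegrand f : measurable_fun setT f ->
  measurable_fun setT (fun z => (f z)%:E * hdens z)%E.
Proof.
move=> mf; apply: emeasurable_funM; last exact: measurable_hdens.
exact/measurable_EFinP.
Qed.

Lemma hintegralD f g : measurable_fun setT f -> measurable_fun setT g ->
  (forall z, 0 <= f z) -> (forall z, 0 <= g z) ->
  hintegral (fun z => f z + g z) = (hintegral f + hintegral g)%E.
Proof.
move=> mf mg f0 g0; rewrite /hintegral -ge0_integralD//.
- by apply: eq_integral => z _; rewrite EFinD ge0_muleDl ?lee_fin.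
- by move=> z _; rewrite mule_ge0 ?hdens_ge0 ?lee_fin.
- exact: measurable_hintegrand.
- by move=> z _; rewrite mule_ge0 ?hdens_ge0 ?lee_fin.
- exact: measurable_hintegrand.
Qed.

Lemma le_hintegral f g : measurable_fun setT f -> measurable_fun setT g ->
  (forall z, 0 <= f z <= g z) -> (hintegral f <= hintegral g)%E.
Proof.
move=> mf mg fg; have f0 z : 0 <= f z by case/andP: (fg z).
have g0 z : 0 <= g z by case/andP: (fg z) => /le_trans; apply.
apply: ge0_le_integral => //.
- by move=> z _; rewrite mule_ge0 ?hdens_ge0 ?lee_fin.
- exact: measurable_hintegrand.
- exact: measurable_hintegrand.
- move=> z _; apply: lee_pmul => //; rewrite ?lee_fin ?hdens_ge0//.
  by case/andP: (fg z).
Qed.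

Lemma hintegral_indic A c : 0 <= c -> measurable A ->
  hintegral (fun z => c * \1_A z) = (c%:E * harea A)%E.
Proof.
move=> c0 mA; rewrite /harea [in RHS]integral_mkcond.
rewrite -ge0_integralZl//.
- apply: eq_integral => z _; rewrite patchE /hdens patchE indicE.
  have [zA|zA] := boolP (z \in A).
    rewrite mulr1 (_ : (z \in A `&` @hplane R) = (z \in @hplane R)); last first.
      by apply/idP/idP; rewrite !inE; [case|split=> //; rewrite inE in zA].
    by case: ifP; rewrite // ?mule0.
  rewrite mulr0 mul0e memNset ?mule0// => -[Az _].
  by move/negP: zA; apply; rewrite inE.
- apply: measurable_hdensity_restrict.
  by apply: measurableI => //; exact: measurable_hplane.
- by move=> z _; exact: hdensity_restrict_ge0.
Qed.

Lemma hintegral_simple (A : nat -> set (R * R)) (c : nat -> R) m :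
  (forall i, measurable (A i)) -> (forall i, 0 <= c i) ->
  hintegral (fun z => \sum_(i < m) c i * \1_(A i) z) =
  (\sum_(i < m) (c i)%:E * harea (A i))%E.
Proof.
move=> mA c0.
have mi i : measurable_fun setT (fun z => c i * \1_(A i) z).
  by apply: measurable_funM => //; exact: measurable_indic.
elim: m => [|m IH].
  rewrite big_ord0 /hintegral; under eq_integral do rewrite big_ord0 mul0e.
  by rewrite integral0.
rewrite big_ord_recr/= -IH -hintegral_indic// -hintegralD//.
- by congr hintegral; apply/funext => z; rewrite big_ord_recr.
- by apply: measurable_sum => i.
- by move=> z; apply: sumr_ge0 => i _; rewrite mulr_ge0.
- by move=> z; rewrite mulr_ge0.
Qed.

End hintegral.

Lemma le0_of_mul_nat (R : realType) (x a : R) :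
  (forall n : nat, x * n.+1%:R <= a) -> x <= 0.
Proof.
move=> H; rewrite leNgt; apply/negP => x0.
have a0 : 0 <= a by rewrite (le_trans _ (H 0%N))// mulr1 ltW.
have := archi_boundP (divr_ge0 a0 (ltW x0)); set n := Num.bound _.
rewrite ltr_pdivrMr// => an.
have := H n; rewrite leNgt => /negP; apply; rewrite (lt_le_trans an)//.
by rewrite mulrC ler_pM2l// ler_nat.
Qed.

Section generating_functional.
Context (R : realType) (d : measure_display) (Om : measurableType d)
  (P : probability Om R) (X : nat -> {RV P >-> (R * R)%type}).
Variables (lam : R) (lam_gt0 : 0 < lam) (XP : poisson_process lam X).

Lemma measurable_prod_RV (r : R * R -> R) N : measurable_fun setT r ->
  measurable_fun setT (fun w => \prod_(n < N) r (X n w)).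
Proof. by move=> mr; apply: measurable_prod => n _; apply: measurableT_comp. Qed.

Lemma le_integral_prod_RV (r s : R * R -> R) N :
  measurable_fun setT r -> measurable_fun setT s -> (forall x, 0 <= r x <= s x) ->
  (\int[P]_w (\prod_(n < N) r (X n w))%:E <= \int[P]_w (\prod_(n < N) s (X n w))%:E)%E.
Proof.
move=> mr ms rs; apply: ge0_le_integral => //.
- by move=> w _; rewrite lee_fin; apply: prodr_ge0 => n _; case/andP: (rs (X n w)).
- by apply/measurable_EFinP; exact: measurable_prod_RV.
- by apply/measurable_EFinP; exact: measurable_prod_RV.
- by move=> w _; rewrite lee_fin; apply: ler_prod.
Qed.

Let slice (K : set (R * R)) (q : R * R -> R) (n i : nat) :=
  K `&` ([set x | i%:R <= q x * n.+1%:R] `&` [set x | q x * n.+1%:R < i.+1%:R]).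

(** Passage from step functions to [q]. At rank n, [K] is cut into level sets of [q] with step 1 /
    (n + 1); the lower and the upper step functions enclose both - ln L / [lam] and the integral of
    [q], and their integrals differ by at most the area of [K] over n + 1. The existence of the
    limit [L] is a hypothesis; it will come from continuity of [P]. *)
Lemma generating_functional_lim (K : set (R * R)) (q : R * R -> R) (L : R) :
  measurable K -> (harea K < +oo)%E -> measurable_fun setT q ->
  (forall x, 0 <= q x <= 1) -> (forall x, ~ K x -> q x = 0) ->
  (\int[P]_w (\prod_(n < N) (1 - q (X n w)))%:E)%E @[N --> \oo] --> L%:E ->
  L = expR (- (lam * fine (hintegral q))).
Proof.
move=> mK Koo mq q01 qK qL.
have hfin A : measurable A -> A `<=` K -> (harea A < +oo)%E.
  move=> mA AK; apply: le_lt_trans Koo.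
  apply: ge0_subset_integral => //.
  - by apply: measurableI => //; exact: measurable_hplane.
  - by apply: measurableI => //; exact: measurable_hplane.
  - by apply: measurable_funTS; exact: measurable_hdensity.
  - by move=> z _; exact: hdensity_ge0.
  - exact: setSI.
pose a := fine (harea K).
have aE : a%:E = harea K by rewrite fineK// ge0_fin_numE// harea_ge0.
have mslice n i : measurable (slice K q n i).
  have mqn : measurable_fun setT (fun x => q x * n.+1%:R) by apply: measurable_funM.
  apply: measurableI => //; apply: measurableI.
    exact: (measurable_set_ler (f := fun=> i%:R)).
  exact: (measurable_set_ltr (g := fun=> i.+1%:R)).
have tslice n : trivIset setT (slice K q n).
  move=> i j _ _ [x [[_ [/= i1 i2]] [_ [/= j1 j2]]]]; apply/eqP; rewrite eqn_leq.
  have := le_lt_trans i1 j2; have := le_lt_trans j1 i2.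
  by rewrite !ltr_nat !ltnS => -> ->.
have slice_ex n x : K x -> exists2 i, (i < n.+2)%N & slice K q n i x.
  move=> Kx; have /andP[q0 q1] := q01 x.
  have /truncn_itv/andP[] : 0 <= q x * n.+1%:R by rewrite mulr_ge0.
  set i := Num.trunc _ => i1 i2; exists i => //.
  rewrite ltnS -(ler_nat R) (le_trans i1)//.
  by rewrite ler_piMl.
have sliceK n i : slice K q n i `<=` K by move=> x [].
(* The slice of index n + 1 is where q = 1; truncation keeps its upper step value in [0, 1]. *)
pose cl (n i : nat) : R := Num.min 1 (i%:R / n.+1%:R).
have cl01 n i : 0 <= cl n i <= 1 by rewrite /cl le_min ler01 divr_ge0//= ge_min lexx.
have cl1 n i : cl n i.+1 <= cl n i + n.+1%:R^-1.
  rewrite /cl -[X in X / _]natr1 mulrDl mul1r.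
  have : 0 <= n.+1%:R^-1 :> R by rewrite invr_ge0.
  move: (n.+1%:R^-1) => v; move: (i%:R * v) => u v0; rewrite !minElt.
  by case: (ltP 1 (u + v)); case: (ltP 1 u); lra.
have qlo n i x : slice K q n i x -> cl n i <= q x.
  by move=> [_ [/= i1 _]]; rewrite ge_min ler_pdivrMr// i1 orbT.
have qhi n i x : slice K q n i x -> q x <= cl n i.+1.
  move=> [_ [/= _ i2]]; rewrite le_min; have /andP[_ ->] := q01 x.
  by rewrite ler_pdivlMr// ltW.
have slice_notin n i j x : slice K q n i x -> i != j -> x \notin slice K q n j.
  move=> si ij; apply/negP; rewrite inE => sj; move/eqP: ij; apply.
  by apply: (tslice n) => //; exists x.
have prodE n (z : nat -> R) i x : (i < n.+2)%N -> slice K q n i x ->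
    \prod_(j < n.+2) (if x \in slice K q n j then z j else 1) = z i.
  move=> ilt si; rewrite (bigD1 (Ordinal ilt))//= mem_set// big1 ?mulr1// => j.
  by rewrite -val_eqE/= eq_sym => ij; rewrite (negbTE (slice_notin _ _ _ _ si ij)).
have sumE n (c : nat -> R) i x : (i < n.+2)%N -> slice K q n i x ->
    \sum_(j < n.+2) c j * \1_(slice K q n j) x = c i.
  move=> ilt si; rewrite (bigD1 (Ordinal ilt))//= indicE mem_set// mulr1 big1 ?addr0// => j.
  by rewrite -val_eqE/= eq_sym => ij; rewrite indicE (negbTE (slice_notin _ _ _ _ si ij)) mulr0.
have prod1 n (z : nat -> R) x : ~ K x ->
    \prod_(j < n.+2) (if x \in slice K q n j then z j else 1) = 1.
  by move=> nK; rewrite big1// => j _; rewrite memNset// => -[].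
have sum0 n (c : nat -> R) x : ~ K x ->
    \sum_(j < n.+2) c j * \1_(slice K q n j) x = 0.
  by move=> nK; rewrite big1// => j _; rewrite indicE memNset ?mulr0// => -[].
pose z1 n i := 1 - cl n i.
pose z2 n i := 1 - cl n i.+1.
have z101 n i : 0 <= z1 n i <= 1 by rewrite /z1; have := cl01 n i; lra.
have z201 n i : 0 <= z2 n i <= 1 by rewrite /z2; have := cl01 n i.+1; lra.
have G1 n := generating_functional lam_gt0 XP (m := n.+2) (mslice n)
  (fun i => hfin _ (mslice n i) (sliceK n i)) (tslice n) (z101 n).
have G2 n := generating_functional lam_gt0 XP (m := n.+2) (mslice n)
  (fun i => hfin _ (mslice n i) (sliceK n i)) (tslice n) (z201 n).
pose h n i := fine (harea (slice K q n i)).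
have hE n i : (h n i)%:E = harea (slice K q n i).
  by rewrite fineK// ge0_fin_numE ?harea_ge0// hfin.
have h0 n i : 0 <= h n i by exact/fine_ge0/harea_ge0.
(* [S n 0] and [S n 1] are the integrals of the lower and of the upper step function. *)
pose S (n k : nat) : R := \sum_(i < n.+2) cl n (k + i)%N * h n i.
have clS n k : hintegral (fun x => \sum_(i < n.+2) cl n (k + i)%N * \1_(slice K q n i) x) = (S n k)%:E.
  rewrite (hintegral_simple (c := fun i => cl n (k + i)%N))//; last first.
    by move=> i; case/andP: (cl01 n (k + i)%N).
  by rewrite -sumEFin; apply: eq_bigr => i _; rewrite EFinM hE.
have msum n (c : nat -> R) :
    measurable_fun setT (fun x => \sum_(i < n.+2) c i * \1_(slice K q n i) x).
  by apply: measurable_sum => i; apply: measurable_funM => //; exact: measurable_indic.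
have qS1 n : (hintegral q <= (S n 1%N)%:E)%E.
  rewrite -clS; apply: (le_hintegral mq (msum n (fun i => cl n (1 + i)%N))) => x.
  have /andP[-> _]/= := q01 x.
  have [Kx|nKx] := pselect (K x); last by rewrite qK// (sum0 _ (fun i => cl n (1 + i)%N)).
  have [i ilt si] := slice_ex n _ Kx.
  by rewrite (sumE _ (fun i => cl n (1 + i)%N) _ _ ilt si); exact: qhi.
have qS0 n : ((S n 0%N)%:E <= hintegral q)%E.
  rewrite -clS; apply: (le_hintegral (msum n (fun i => cl n (0 + i)%N)) mq) => x.
  have [Kx|nKx] := pselect (K x); last by rewrite qK// (sum0 _ (fun i => cl n (0 + i)%N)) ?lexx.
  have [i ilt si] := slice_ex n _ Kx.
  rewrite (sumE _ (fun i => cl n (0 + i)%N) _ _ ilt si) (qlo _ _ _ si) andbT.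
  by case/andP: (cl01 n (0 + i)%N).
pose I := fine (hintegral q).
have IE : I%:E = hintegral q.
  rewrite fineK// ge0_fin_numE; first exact: le_lt_trans (qS1 0%N) (ltry _).
  by apply: le_trans (qS0 0%N); rewrite lee_fin sumr_ge0// => i _; rewrite mulr_ge0//; case/andP: (cl01 0%N (0 + i)%N).
have hsum n : \sum_(i < n.+2) h n i <= a.
  rewrite -lee_fin aE -sumEFin -[leRHS]mul1e -hintegral_indic//.
  rewrite (eq_bigr (fun i : 'I_n.+2 => 1%:E * harea (slice K q n i))%E); last first.
    by move=> i _; rewrite mul1e hE.
  rewrite -(hintegral_simple (c := fun=> 1))//; have mK1 : measurable_fun setT (fun x => 1 * \1_K x : R).
    by apply: measurable_funM => //; exact: measurable_indic.
  apply: (le_hintegral (msum n (fun=> 1)) mK1) => x.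
  have [Kx|nKx] := pselect (K x); last first.
    by rewrite (sum0 _ (fun=> 1))// lexx/= mulr_ge0.
  have [i ilt si] := slice_ex n _ Kx.
  by rewrite (sumE _ (fun=> 1) _ _ ilt si) indicE mem_set// mulr1 ler01/=.
have S10 n : S n 1%N <= S n 0%N + n.+1%:R^-1 * a.
  apply: (@le_trans _ _ (S n 0%N + n.+1%:R^-1 * \sum_(i < n.+2) h n i)).
    rewrite mulr_sumr -big_split/=; apply: ler_sum => i _.
    by rewrite -mulrDl ler_wpM2r// add0n add1n cl1.
  by rewrite lerD2l ler_wpM2l// invr_ge0.
have prodS n k : \prod_(i < n.+2) expR (- (lam * fine (harea (slice K q n i)) *
    (1 - (1 - cl n (k + i)%N)))) = expR (- (lam * S n k)).
  rewrite -expR_sum; congr expR; rewrite /S mulr_sumr -sumrN.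
  by apply: eq_bigr => i _; rewrite /h; ring.
have mprod n (z : nat -> R) :
    measurable_fun setT (fun x => \prod_(i < n.+2) (if x \in slice K q n i then z i else 1)).
  apply: measurable_prod => i _.
  rewrite (_ : (fun _ => _) = (fun x => 1 + (z i - 1) * \1_(slice K q n i) x)).
    by apply: measurable_funD => //; apply: measurable_funM.
  by apply/funext => x; rewrite indicE; case: ifP => _; rewrite ?mulr0 ?addr0// mulr1 addrC subrK.
have m1q : measurable_fun setT (fun x => 1 - q x) by exact: measurable_funB.
have L1 n : L <= expR (- (lam * S n 0%N)).
  rewrite -lee_fin -(prodS n 0%N); apply: (lee_cvg_to qL (G1 n)).
  apply: nearW => N; apply: (le_integral_prod_RV N m1q (mprod n (z1 n))) => x.
  have /andP[q0 q1] := q01 x.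
  rewrite subr_ge0 q1/=; have [Kx|nKx] := pselect (K x); last first.
    by rewrite (prod1 _ (z1 n))// lerBlDr lerDl.
  have [i ilt si] := slice_ex n _ Kx.
  by rewrite (prodE _ (z1 n) _ _ ilt si) lerD2l lerN2; exact: qlo si.
have L2 n : expR (- (lam * S n 1%N)) <= L.
  rewrite -lee_fin -(prodS n 1%N); apply: (lee_cvg_to (G2 n) qL).
  apply: nearW => N; apply: (le_integral_prod_RV N (mprod n (z2 n)) m1q) => x.
  have [Kx|nKx] := pselect (K x); last first.
    by rewrite (prod1 _ (z2 n))// qK// subr0 ler01 lexx.
  have [i ilt si] := slice_ex n _ Kx.
  rewrite (prodE _ (z2 n) _ _ ilt si); apply/andP; split.
    by case/andP: (z201 n i).
  by rewrite lerD2l lerN2; exact: qhi si.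
have L0 : 0 < L by exact: lt_le_trans (expR_gt0 _) (L2 0%N).
have lnL1 n : ln L <= - (lam * S n 0%N) by rewrite -(expRK (- _)) ler_ln ?posrE ?expR_gt0.
have lnL2 n : - (lam * S n 1%N) <= ln L by rewrite -[leLHS]expRK ler_ln ?posrE ?expR_gt0.
have I0 n : S n 0%N <= I by rewrite -lee_fin IE.
have I1 n : I <= S n 1%N by rewrite -lee_fin IE.
rewrite -/I -[LHS](lnK L0); congr expR; apply/eqP; rewrite eq_le.
have bound n u : u <= S n 1%N - S n 0%N -> u * n.+1%:R <= a.
  move=> uS; have : u <= n.+1%:R^-1 * a by rewrite (le_trans uS)// lerBlDl.
  by rewrite mulrC ler_pdivlMr.
apply/andP; split.
  have H : I + ln L / lam <= 0.
    apply: (@le0_of_mul_nat _ _ a) => n; apply: bound; apply: lerD => //.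
    by rewrite ler_pdivrMr// mulNr mulrC.
  have : ln L / lam <= - I by lra.
  by rewrite ler_pdivrMr// mulNr mulrC.
have H : - (I + ln L / lam) <= 0.
  apply: (@le0_of_mul_nat _ _ a) => n; apply: bound.
  rewrite opprD addrC; apply: lerD; last by rewrite lerN2.
  by rewrite lerNl ler_pdivlMr// mulNr mulrC.
have : - I <= ln L / lam by lra.
by rewrite ler_pdivlMr// mulNr mulrC.
Qed.

End generating_functional.

Lemma adde_finI (R : realDomainType) (a x y : \bar R) :
  a \is a fin_num -> (a + x = a + y)%E -> x = y.
Proof. by case: a x y => [a||] [x||] [y||]//= _ [/addrI->]. Qed.

(** * Independent radii attached to the centres *)

Section mark.
Context (R : realType) (nu : probability R R).
Implicit Types S : set (R * R * R).

Definition mark_prob S (x : R * R) : R := fine (nu (xsection S x)).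

Lemma mark_probE S x : measurable S -> (mark_prob S x)%:E = nu (xsection S x).
Proof. by move=> mS; rewrite fineK// fin_num_measure//; exact: measurable_xsection. Qed.

Lemma mark_prob01 S x : measurable S -> 0 <= mark_prob S x <= 1.
Proof.
move=> mS; rewrite fine_ge0//= -lee_fin mark_probE// probability_le1//.
exact: measurable_xsection.
Qed.

Lemma measurable_mark_prob S : measurable S -> measurable_fun setT (mark_prob S).
Proof.
move=> mS; rewrite /mark_prob.
apply: measurableT_comp; first exact: fine_measurable.
exact: (@measurable_fun_xsection _ _ _ _ R nu S).
Qed.

Lemma mark_prob_rect A B x : measurable B ->
  mark_prob (A `*` B) x = \1_A x * fine (nu B).
Proof.
move=> mB; rewrite /mark_prob indicE; have [xA|xA] := boolP (x \in A).
  by rewrite in_xsectionX// mul1r.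
by rewrite notin_xsectionX// measure0 mul0r.
Qed.

Lemma mark_probC S x : measurable S -> mark_prob S x + mark_prob (~` S) x = 1.
Proof.
move=> mS; apply: EFin_inj; rewrite EFinD !mark_probE//; last exact: measurableC.
rewrite -measureU; last 3 first.
- exact: measurable_xsection.
- by apply: measurable_xsection; exact: measurableC.
- by apply/seteqP; split=> y //= []; rewrite /xsection/= !inE.
rewrite (_ : _ `|` _ = setT); first exact: probability_setT.
apply/seteqP; split=> y //= _; rewrite /xsection/= !inE.
by have [|] := pselect (S (x, y)); [left|right].
Qed.

Lemma mark_prob_bigcup (F : nat -> set (R * R * R)) x :
  (forall n, measurable (F n)) -> trivIset setT F ->
  ((mark_prob (\bigcup_n F n) x)%:E = \sum_(n <oo) (mark_prob (F n) x)%:E)%E.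
Proof.
move=> mF tF; rewrite mark_probE; last exact: bigcupT_measurable.
rewrite xsection_bigcup measure_bigcup//; last 2 first.
- by move=> n _; exact: measurable_xsection.
- exact: trivIset_xsection.
apply: congr_lim; apply/funext => n; apply: eq_big => k; first by rewrite in_setT.
by move=> _; rewrite mark_probE.
Qed.

End mark.

Section marking.
Context (R : realType) (d : measure_display) (Om : measurableType d)
  (P : probability Om R) (X : nat -> {RV P >-> (R * R)%type})
  (rho : nat -> {RV P >-> R}).
Variables (lam : R) (nu : probability R R) (lam_gt0 : 0 < lam)
  (BM : poisson_boolean_model lam nu X rho).
Implicit Types (E : nat -> set (R * R * R)) (S : set (R * R * R)).

Let Y n w : R * R * R := (X n w, rho n w).

Let measurable_Y n : measurable_fun setT (Y n).
Proof. by apply: measurable_fun_pair. Qed.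

Let mY S n : measurable S -> measurable (Y n @^-1` S).
Proof. by move=> mS; exact: measurable_preimageT. Qed.

(** The radii are integrated out, given the centres. The hypotheses of the model give this for
    rectangles; the sets [E n] are then made arbitrary one index at a time. *)
Let joint N E := P [set w | forall n, (n < N)%N -> E n (Y n w)] =
  (\int[P]_w (\prod_(n < N) mark_prob nu (E n) (X n w))%:E)%E.

Let joint_rect N E : (forall n, exists A B,
    [/\ measurable A, measurable B & E n = A `*` B]) -> joint N E.
Proof.
move=> /choice[A] /choice[B AB].
have mA n : measurable (A n) by case: (AB n).
have mB n : measurable (B n) by case: (AB n).
have EE n : E n = A n `*` B n by case: (AB n).
have := radii_centers_indep BM (A := fun i : 'I_N => A i) (B := fun i : 'I_N => B i)
  (fun i => mA i) (fun i => mB i).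
set EX := bigcap _ _; set Er := bigcap _ _ => /= PE.
have mEX : measurable EX.
  by apply: fin_bigcap_measurable => // i _; exact: measurable_preimageT.
have PEr : P Er = (\prod_(i < N) fine (nu (B i)))%:E.
  rewrite (radii_indep BM (B := fun i : 'I_N => B i))// -prodEFin.
  apply: eq_bigr => i _; rewrite fineK ?fin_num_measure//.
  exact: (radii_law BM).
rewrite /joint (_ : mkset _ = EX `&` Er); last first.
  apply/seteqP; split=> w /=.
    move=> H; split=> i _ /=; have := H i (ltn_ord i); rewrite EE => -[]//.
  move=> [HX Hr] n nN; rewrite EE; split; first exact: (HX (Ordinal nN)).
  exact: (Hr (Ordinal nN)).
rewrite PE PEr muleC -[P EX]mul1e -integral_cst// -ge0_integralZl//; last first.
  by rewrite lee_fin; apply: prodr_ge0 => i _; exact: fine_ge0.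
rewrite integral_mkcond; apply: eq_integral => w _.
rewrite patchE; have [wX|wX] := boolP (w \in EX).
  rewrite mule1; congr (_%:E); apply: eq_bigr => i _.
  rewrite EE mark_prob_rect// indicE mem_set ?mul1r//.
  by move: wX; rewrite inE => /(_ i I).
have [i Xi] : exists i : 'I_N, ~ A i (X i w).
  apply: contrapT => /forallNP H; move/negP: wX; apply; rewrite inE => i _ /=.
  by apply: contrapT; exact: H.
by rewrite (bigD1 i)//= EE mark_prob_rect// indicE memNset// !mul0r.
Qed.

Let measurable_prod_mark N (p : pred 'I_N) E : (forall n, measurable (E n)) ->
  measurable_fun setT (fun w => \prod_(n < N | p n) mark_prob nu (E n) (X n w)).
Proof.
move=> mE.
rewrite (_ : (fun w => _) = (fun w => \prod_(n < N)
    (if p n then mark_prob nu (E n) (X n w) else 1))); last first.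
  by apply/funext => w; rewrite big_mkcond.
apply: measurable_prod => n _; case: (p n) => //.
by apply: measurableT_comp => //; exact: measurable_mark_prob.
Qed.

(** Dynkin's theorem in the coordinate k alone: with the other sets fixed, both sides are finite
    measures of the set at index k, and they agree on rectangles, which are stable under
    intersection. *)
Let joint_step N k E S0 : (k < N)%N -> (forall n, measurable (E n)) ->
  let E' S n := if n == k then S else E n in
  (forall A B, measurable A -> measurable B -> joint N (E' (A `*` B))) ->
  measurable S0 -> joint N (E' S0).
Proof.
move=> kN mE E' HG mS0.
pose V := [set w | forall n, (n < N)%N -> n != k -> E n (Y n w)].
pose ko : 'I_N := Ordinal kN.
pose h w := \prod_(n < N | n != ko) mark_prob nu (E n) (X n w).
pose Q S := (P (V `&` Y k @^-1` S) = \int[P]_w (h w * mark_prob nu S (X k w))%:E)%E.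
have h0 w : 0 <= h w.
  by apply: prodr_ge0 => i _; case/andP: (mark_prob01 nu (X i w) (mE i)).
have mh : measurable_fun setT h by exact: measurable_prod_mark.
have mV : measurable V.
  rewrite (_ : V = \bigcap_(n in `I_N) (if n == k then setT else Y n @^-1` E n)).
    apply: bigcap_measurableType => n _; case: ifP => // _; exact: mY.
  apply/seteqP; split=> w H n nN /=.
    by case: ifPn => // nk; exact: H.
  by move=> nk; have := H n nN; rewrite /= (negbTE nk).
have QE S : measurable S -> Q S <-> joint N (E' S).
  move=> mS; rewrite /Q /joint.
  rewrite (_ : V `&` _ = [set w | forall n, (n < N)%N -> E' S n (Y n w)]); last first.
    apply/seteqP; split=> w /=.
      by move=> [Vw Sw] n nN; rewrite /E'; case: eqVneq => [->//|nk]; exact: Vw.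
    move=> H; split; last by have := H k kN; rewrite /E' eqxx.
    by move=> n nN nk; have := H n nN; rewrite /E' (negbTE nk).
  rewrite (_ : (fun w => _) = (fun w => (\prod_(n < N) mark_prob nu (E' S n) (X n w))%:E))//.
  apply/funext => w; congr (_%:E); rewrite (bigD1 ko)//= /E' eqxx mulrC; congr (_ * _).
  by apply: eq_bigr => n; rewrite -val_eqE/= => /negbTE ->.
have mhq S : measurable S -> measurable_fun setT (fun w => (h w * mark_prob nu S (X k w))%:E).
  move=> mS; apply/measurable_EFinP; apply: measurable_funM => //.
  by apply: measurableT_comp => //; exact: measurable_mark_prob.
have hq0 S w : measurable S -> (0 <= (h w * mark_prob nu S (X k w))%:E)%E.
  by move=> mS; rewrite lee_fin mulr_ge0//; case/andP: (mark_prob01 nu (X k w) mS).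
apply/QE => //.
have mprodE := measurable_prod_measurableType (R * R)%type R.
apply: (@dynkin_induction _ (R * R * R)%type
  [set A `*` B | A in measurable & B in measurable] Q) => //.
- move=> _ _ [A1 mA1 [B1 mB1 <-]] [A2 mA2 [B2 mB2 <-]].
  exists (A1 `&` A2); first exact: measurableI.
  by exists (B1 `&` B2); [exact: measurableI|rewrite setXI].
- apply/QE => //; rewrite -setXTT; exact: HG.
- by move=> _ [A mA [B mB <-]]; apply/QE; [exact: measurableX|exact: HG].
- move=> S mS QS.
  have mCS := measurableC mS.
  have : Q setT by apply/QE => //; rewrite -setXTT; exact: HG.
  rewrite /Q preimage_setT setIT.
  rewrite [X in P X = _](_ : V = (V `&` Y k @^-1` S) `|` (V `&` Y k @^-1` (~` S))); last first.
    by rewrite -setIUr -preimage_setU setUv preimage_setT setIT.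
  rewrite measureU; last 3 first.
  - by apply: measurableI => //; exact: mY.
  - by apply: measurableI => //; exact: mY.
  - by rewrite setIACA -preimage_setI setICr preimage_set0 setI0.
  move=> H.
  have HE : (\int[P]_w (h w * mark_prob nu setT (X k w))%:E =
      P (V `&` Y k @^-1` S) + \int[P]_w (h w * mark_prob nu (~` S) (X k w))%:E)%E.
    rewrite (_ : (fun w => _) = (fun w => (h w * mark_prob nu S (X k w))%:E +
      (h w * mark_prob nu (~` S) (X k w))%:E)%E); last first.
      apply/funext => w; rewrite -EFinD -mulrDr mark_probC//; congr (_ * _)%:E.
      rewrite -(mark_probC nu (X k w) (@measurableT _ (R * R * R)%type)) setCT.
      by rewrite [X in _ + X]/mark_prob xsection0 measure0 addr0.
    rewrite ge0_integralD//; [|by move=> *; exact: hq0|exact: mhq|by move=> *; exact: hq0|exact: mhq].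
    by congr (_ + _)%E; exact: esym QS.
  apply: (@adde_finI _ (P (V `&` Y k @^-1` S))); last exact: etrans H HE.
  by rewrite fin_num_measure//; apply: measurableI => //; exact: mY.
- move=> F mF tF QF; rewrite /Q preimage_bigcup setI_bigcupr measure_bigcup//; last 2 first.
  - by move=> n _; apply: measurableI => //; exact: mY.
  - move=> i j _ _ [w [[_ Fi] [_ Fj]]].
    exact: (tF i j I I (ex_intro _ (Y k w) (conj Fi Fj))).
  transitivity (\sum_(n <oo) \int[P]_w (h w * mark_prob nu (F n) (X k w))%:E)%E.
    apply: congr_lim; apply/funext => n; apply: eq_big => j; first by rewrite in_setT.
    by move=> _; exact: QF.
  rewrite -integral_nneseries//; [|by move=> n; exact: mhq|by move=> n w _; exact: hq0].
  apply: eq_integral => w _; rewrite [RHS]EFinM mark_prob_bigcup// -nneseriesZl//.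
  by move=> n _; rewrite lee_fin; case/andP: (mark_prob01 nu (X k w) (mF n)).
- by rewrite -mprodE.
Qed.

Let joint_measurable N E : (forall n, measurable (E n)) -> joint N E.
Proof.
move=> mE.
suff H k : (k <= N)%N -> forall E', (forall n, measurable (E' n)) ->
    (forall n, (k <= n)%N -> exists A B, [/\ measurable A, measurable B & E' n = A `*` B]) ->
    joint N E'.
  (* [setT] is a rectangle, which is what the induction wants at every index from k on. *)
  pose E' n := if (n < N)%N then E n else setT.
  have := H N (leqnn N) E'; rewrite /joint => HN.
  have mE' n : measurable (E' n) by rewrite /E'; case: ifP.
  have E'E (n : 'I_N) : E' n = E n by rewrite /E' ltn_ord.
  rewrite (_ : mkset _ = [set w | forall n, (n < N)%N -> E' n (Y n w)]).
    rewrite HN//.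
      by apply: eq_integral => w _; congr (_%:E); apply: eq_bigr => n _; rewrite E'E.
    move=> n Nn; exists setT, setT; split => //.
    by rewrite /E' ltnNge Nn/= setXTT.
  by apply/seteqP; split=> w /= Hw n nN; have := Hw n nN; rewrite /E' nN.
elim: k => [_ E' mE' HE'|k IH kN E' mE' HE']; first by apply: joint_rect => n; exact: HE'.
have := @joint_step N k E' (E' k) kN mE'; cbv beta zeta.
rewrite (_ : (fun n => if n == k then E' k else E' n) = E'); last first.
  by apply/funext => n; case: eqP => [->|].
apply => // A B mA mB; apply: IH; first exact: ltnW.
  by move=> n; case: ifP => // _; exact: measurableX.
move=> n; case: eqVneq => [_ _|nk kn]; first by exists A, B.
by apply: HE'; rewrite ltn_neqAle eq_sym nk.
Qed.

Definition avoids S : set Om := [set w | forall n, ~ S (Y n w)].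

Lemma measurable_avoids S : measurable S -> measurable (avoids S).
Proof.
move=> mS; rewrite (_ : avoids S = \bigcap_n ~` (Y n @^-1` S)).
  by apply: bigcapT_measurable => n; apply: measurableC; exact: mY.
by apply/seteqP; split=> w H n //=; exact: H.
Qed.

(** A point at x escapes [S] with conditional probability 1 - [mark_prob nu S x], so the probability
    that the first N points escape is the integral whose limit is already identified. Continuity
    from above supplies that limit. [K] confines the relevant centres to finite area, where the
    counting laws speak. *)
Theorem void_probability S (K : set (R * R)) :
  measurable S -> measurable K -> (harea K < +oo)%E ->
  (forall x t, S (x, t) -> K x) ->
  P (avoids S) = (expR (- (lam * fine (hintegral (mark_prob nu S)))))%:E.
Proof.
move=> mS mK Koo SK.
have mA := measurable_avoids mS.
have fA : P (avoids S) \is a fin_num by exact: fin_num_measure.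
rewrite -(fineK fA); congr (_%:E).
apply: (@generating_functional_lim _ _ _ P X lam lam_gt0 (boolean_centers BM) K) => //.
- exact: measurable_mark_prob.
- by move=> x; exact: mark_prob01.
- move=> x nK; rewrite /mark_prob (_ : xsection S x = set0) ?measure0//.
  by apply/seteqP; split=> t //; rewrite /xsection/= inE => /SK.
rewrite fineK//.
pose V N := [set w | forall n, (n < N)%N -> (~` S) (Y n w)].
have mV N : measurable (V N).
  rewrite (_ : V N = \bigcap_(n in `I_N) (Y n @^-1` (~` S))).
    by apply: bigcap_measurableType => n _; apply: mY; exact: measurableC.
  by apply/seteqP; split=> w H n nN; exact: H.
rewrite (_ : (fun N => _) = P \o V); last first.
  apply/funext => N /=.
  rewrite -[RHS]/(P [set w | forall n, (n < N)%N -> (fun=> ~` S) n (Y n w)]).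
  rewrite (@joint_measurable N (fun=> ~` S)); last by move=> n; exact: measurableC.
  apply: eq_integral => w _; congr (_%:E); apply: eq_bigr => n _.
  by rewrite -(mark_probC nu (X n w) mS) addrC addKr.
rewrite (_ : avoids S = \bigcap_N V N); last first.
  apply/seteqP; split=> [w H N _ n _|w H n]; first exact: H.
  exact: (H n.+1 I n (ltnSn n)).
apply: nonincreasing_cvg_mu => //.
- by rewrite ltey_eq fin_num_measure.
- exact: bigcapT_measurable.
- move=> M N MN; apply/subsetPset => w H n nM; apply: H; exact: leq_trans MN.
Qed.

End marking.

(** * Exchanging the integrals over centres and radii *)

Section lebesgue2.
Variable R : realType.
Local Notation leb := (@lebesgue_measure R).

Lemma sigma_finite_lebesgue2 : sigma_finite setT (leb \x leb)%E.
Proof.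
exists (fun n => `](- n%:R), n%:R[ `*` `](- n%:R), n%:R[).
  apply/esym; rewrite -subTset => -[x y] _ /=.
  have := archi_boundP (addr_ge0 (normr_ge0 x) (normr_ge0 y)).
  set n := Num.bound _ => xyn; exists n => //=.
  have := normr_ge0 x; have := normr_ge0 y.
  by split; rewrite in_itv/= -ltr_norml; lra.
move=> n; split; first exact: measurableX.
rewrite product_measure1E//= !lebesgue_measure_itv/=.
by case: ifP => _; rewrite ?mule0 ?ltry// -!EFinB -EFinM ltry.
Qed.

Definition lebesgue2 : {sigma_finite_measure set _ -> \bar R} :=
  HB.pack (leb \x leb)%E
    (@Measure_isSigmaFinite.Build _ _ _ (leb \x leb)%E sigma_finite_lebesgue2).

End lebesgue2.

Section fubini.
Context (R : realType) (nu : probability R R).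
Local Notation leb := (@lebesgue_measure R).

(** Tonelli turns the exponent of a void probability into an average, over the radius, of planar
    areas; the geometry bounds these at fixed radius. *)
Lemma hintegral_mark_prob (S : set (R * R * R)) : measurable S ->
  (hintegral (mark_prob nu S) = \int[nu]_t harea (ysection S t))%E.
Proof.
move=> mS; rewrite /hintegral.
pose f (z : R * R * R) := ((\1_S z)%:E * hdens z.1)%E.
have mf : measurable_fun setT f.
  apply: emeasurable_funM; first by apply/measurable_EFinP; exact: measurable_indic.
  by apply: measurableT_comp; [exact: measurable_hdens|exact: measurable_fst].
have f0 z : (0 <= f z)%E by rewrite mule_ge0 ?hdens_ge0// lee_fin.
transitivity (\int[(leb \x leb)%E]_z \int[nu]_t f (z, t))%E.
  apply: eq_integral => z _; rewrite mark_probE//.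
  have mSz : measurable (xsection S z) by exact: measurable_xsection.
  rewrite muleC -[nu _]mul1e -(integral_cst nu mSz) -ge0_integralZl//; last first.
    exact: hdens_ge0.
  rewrite integral_mkcond; apply: eq_integral => t _; rewrite patchE /f indicE/=.
  by rewrite mem_xsection; case: ifP => _; rewrite ?mule1 ?mul1e ?mul0e.
transitivity (\int[nu]_t \int[(leb \x leb)%E]_z f (z, t))%E.
  exact: (@fubini_tonelli _ _ _ _ R (lebesgue2 R) nu f mf f0).
apply: eq_integral => t _.
have mSt : measurable (ysection S t) by exact: measurable_ysection.
rewrite -[RHS]mul1e -hintegral_indic//.
apply: eq_integral => z _; rewrite /f !indicE mul1r.
by rewrite mem_ysection.
Qed.

Lemma measurable_harea_ysection (S : set (R * R * R)) : measurable S ->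
  measurable_fun setT (fun t => harea (ysection S t)).
Proof.
move=> mS.
pose f (z : R * R * R) := ((\1_S z)%:E * hdens z.1)%E.
have mf : measurable_fun setT f.
  apply: emeasurable_funM; first by apply/measurable_EFinP; exact: measurable_indic.
  by apply: measurableT_comp; [exact: measurable_hdens|exact: measurable_fst].
have f0 z : (0 <= f z)%E by rewrite mule_ge0 ?hdens_ge0// lee_fin.
rewrite (_ : (fun t => _) = (fun t => \int[(leb \x leb)%E]_z f (z, t))%E).
  exact: (@measurable_fun_fubini_tonelli_G _ _ _ _ R (lebesgue2 R) f mf f0).
apply/funext => t.
have mSt : measurable (ysection S t) by exact: measurable_ysection.
rewrite -[LHS]mul1e -hintegral_indic//.
apply: eq_integral => z _; rewrite /f !indicE mul1r.
by rewrite mem_ysection.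
Qed.

End fubini.

(** * Balls meeting a geodesic segment *)

Section trig.
Variable R : realType.
Implicit Types x y t : R.

Lemma sin_le_id x : 0 <= x -> sin x <= x.
Proof.
rewrite le_eqVlt => /predU1P[<-|x0]; first by rewrite sin0.
have := @MVT R (@sin R) (@cos R) 0 x x0 (fun y _ => is_derive_sin y).
case; first by apply: continuous_subspaceT => y; exact: continuous_sin.
move=> c _; rewrite sin0 !subr0 => ->.
by apply: ler_piMl; [exact: ltW|exact: cos_le1].
Qed.

Lemma norm_sin_le x : `|sin x| <= `|x|.
Proof.
wlog x0 : x / 0 <= x.
  move=> H; have [|/ltW x0] := leP 0 x; first exact: H.
  by rewrite -normrN -sinN -[leRHS]normrN H// oppr_ge0.
rewrite (ger0_norm x0) ler_norml sin_le_id// andbT.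
have [x1|x1] := leP 1 x; first by rewrite (le_trans _ (sin_geN1 x))// lerN2.
rewrite (@le_trans _ _ 0)// ?oppr_le0//.
have := sin_le_id (ltW (proj1 (andP (pihalf_02 R)))); rewrite sin_pihalf => p1.
by apply: sin_ge0_pi; rewrite x0/=; have := pi_gt0 R; lra.
Qed.

Lemma pi_ge2 : 2 <= pi :> R.
Proof.
have := sin_le_id (ltW (proj1 (andP (pihalf_02 R)))); rewrite sin_pihalf; lra.
Qed.

Lemma norm_atan_le x : `|atan x| <= `|x|.
Proof.
wlog x0 : x / 0 <= x.
  move=> H; have [|/ltW x0] := leP 0 x; first exact: H.
  by rewrite -normrN -atanN -[leRHS]normrN H// oppr_ge0.
have a0 : 0 <= atan x by rewrite -[leLHS]atan0 le_atan.
rewrite !ger0_norm//; move: x0; rewrite le_eqVlt => /predU1P[<-|x0].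
  by rewrite atan0.
have d (y : R) : is_derive y 1 (@atan R) (1 + y ^+ 2)^-1 by exact: is_derive1_atan.
have := @MVT R (@atan R) (fun y => (1 + y ^+ 2)^-1) 0 x x0 (fun y _ => d y).
case; first by apply: continuous_subspaceT => y; exact: continuous_atan.
move=> c _; rewrite atan0 !subr0 => ->.
apply: ler_piMl; first exact: ltW.
rewrite invf_le1 ?lerDl ?sqr_ge0//.
by rewrite ltr_pwDl// sqr_ge0.
Qed.

End trig.

Section hyperbolic.
Variable R : realType.
Implicit Types x y t r : R.

Definition cosh x : R := (expR x + expR (- x)) / 2.

Lemma cosh_gt0 x : 0 < cosh x.
Proof. by rewrite divr_gt0// addr_gt0// expR_gt0. Qed.

Lemma cosh2 x : cosh x ^+ 2 = 1 + sinh x ^+ 2.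
Proof.
rewrite /cosh /sinh expRN; field; rewrite gt_eqF// expR_gt0//.
Qed.

Lemma cosh_ge1 x : 1 <= cosh x.
Proof.
rewrite -(@ler_pXn2r _ 2) ?nnegrE ?(ltW (cosh_gt0 _))//.
by rewrite cosh2 expr1n lerDl sqr_ge0.
Qed.

Lemma coshDsinh x : cosh x + sinh x = expR x.
Proof. by rewrite /cosh /sinh; field. Qed.

Lemma sinh_ge0 x : 0 <= x -> 0 <= sinh x.
Proof.
by move=> x0; rewrite divr_ge0// subr_ge0 ler_expR; lra.
Qed.

Lemma le_sinh x y : x <= y -> sinh x <= sinh y.
Proof.
move=> xy; rewrite ler_pM2r ?invr_gt0// lerD// ?ler_expR// lerN2 ler_expR.
by rewrite lerN2.
Qed.

Lemma le_cosh x y : 0 <= x -> x <= y -> cosh x <= cosh y.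
Proof.
move=> x0 xy; rewrite -(@ler_pXn2r _ 2) ?nnegrE ?(ltW (cosh_gt0 _))//.
have y0 := le_trans x0 xy.
by rewrite !cosh2 lerD2l ler_pXn2r ?nnegrE ?sinh_ge0//; exact: le_sinh.
Qed.

(** Compares x + sqrt (x^2 - 1) with e^t = cosh t + sinh t: the second terms are ordered as the
    first ones, since sinh^2 = cosh^2 - 1. *)
Lemma arcosh_le x t : 1 <= x -> 0 <= t -> (arcosh x <= t) = (x <= cosh t).
Proof.
move=> x1 t0; rewrite /arcosh.
set s := Num.sqrt _.
have x0 : 0 < x by exact: lt_le_trans x1.
have s0 : 0 <= s by exact: sqrtr_ge0.
have s2 : s ^+ 2 = x ^+ 2 - 1.
  by rewrite sqr_sqrtr// subr_ge0 -[leLHS](expr1n _ 2) ler_pXn2r ?nnegrE// (ltW x0).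
have u0 : 0 < x + s by rewrite ltr_pwDl.
rewrite -[t in LHS]expRK ler_ln ?posrE ?expR_gt0// -coshDsinh.
have S0 := sinh_ge0 t0; have C2 := cosh2 t; have C1 := cosh_ge1 t.
apply/idP/idP => H.
  rewrite leNgt; apply/negP => xC.
  have sS : sinh t <= s.
    rewrite -(@ler_pXn2r _ 2)// ?nnegrE// s2.
    have : cosh t ^+ 2 <= x ^+ 2 by rewrite ler_pXn2r ?nnegrE ?(ltW x0) ?(ltW (cosh_gt0 _))// ltW.
    lra.
  lra.
apply: lerD => //; rewrite -(@ler_pXn2r _ 2)// ?nnegrE// s2.
have : x ^+ 2 <= cosh t ^+ 2 by rewrite ler_pXn2r ?nnegrE ?(ltW x0) ?(ltW (cosh_gt0 _)).
lra.
Qed.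

End hyperbolic.

Section geometry.
Variable R : realType.
Implicit Types (z : R * R) (r s t theta : R).

Definition along theta z : R := z.1 * cos theta + z.2 * sin theta.
Definition across theta z : R := z.2 * cos theta - z.1 * sin theta.

Lemma along2Dacross2 theta z :
  along theta z ^+ 2 + across theta z ^+ 2 = sqnorm z.
Proof.
rewrite /along /across /sqnorm -[RHS]mulr1 -(cos2Dsin2 theta); ring.
Qed.

(* Up to a positive factor, [cosh (hdist z (t cos theta, t sin theta)) - cosh s]. *)
Definition ray_quad z s theta t : R :=
  (2 + (cosh s - 1) * (1 - sqnorm z)) * t ^+ 2 - 4 * along theta z * t
  + 2 * sqnorm z - (cosh s - 1) * (1 - sqnorm z).

Lemma sqnorm_ge0 z : 0 <= sqnorm z.
Proof. by rewrite addr_ge0// sqr_ge0. Qed.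

Lemma sqnorm_ray t theta : sqnorm (t * cos theta, t * sin theta) = t ^+ 2.
Proof. by rewrite /sqnorm/= -[RHS]mulr1 -(cos2Dsin2 theta); ring. Qed.

Lemma hball_ray z s theta t : hplane z -> 0 <= s -> 0 <= t < 1 ->
  hball z s (t * cos theta, t * sin theta) <-> ray_quad z s theta t <= 0.
Proof.
rewrite /hplane/= => nz s0 /andP[t0 t1].
have t21 : t ^+ 2 < 1 by rewrite expr_lt1.
rewrite /hball/= /hplane/= sqnorm_ray /hdist sqnorm_ray.
have -> : sqnorm (z.1 - t * cos theta, z.2 - t * sin theta) =
    sqnorm z - 2 * t * along theta z + t ^+ 2.
  by rewrite -(sqnorm_ray t theta) /sqnorm /along/=; ring.
set S := _ - _ + _.
have S0 : 0 <= S.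
  have := along2Dacross2 theta z; have := sqr_ge0 (across theta z).
  have := sqr_ge0 (along theta z - t); rewrite /S; lra.
have D0 : 0 < (1 - sqnorm z) * (1 - t ^+ 2) by rewrite mulr_gt0 ?subr_gt0.
rewrite arcosh_le//; last first.
  by rewrite lerDl; apply: divr_ge0; [exact: mulr_ge0|exact: ltW].
have -> : (1 + 2 * S / ((1 - sqnorm z) * (1 - t ^+ 2)) <= cosh s) =
    (ray_quad z s theta t <= 0).
  rewrite -lerBrDl ler_pdivrMr// -subr_le0; congr (_ <= 0).
  by rewrite /ray_quad /S; ring.
by split=> [[]|].
Qed.

(* tanh (r / 2), the Euclidean norm of a point at distance [r] from 0. *)
Definition htanh r : R := (expR r - 1) / (expR r + 1).

Lemma htanh_lt1 r : htanh r < 1.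
Proof.
by rewrite ltr_pdivrMr ?mul1r; have := expR_gt0 r; lra.
Qed.

Lemma htanh_ge0 r : 0 <= r -> 0 <= htanh r.
Proof.
by move=> r0; rewrite divr_ge0// ?subr_ge0 -?[leLHS]expR0 ?ler_expR// addr_ge0// expR_ge0.
Qed.

Lemma htanh2 r : htanh r ^+ 2 = (cosh r - 1) / (cosh r + 1).
Proof.
rewrite /htanh /cosh expRN; have e0 := expR_gt0 r; field.
by rewrite !gt_eqF//= ?addr_gt0// ; have := exprn_gt0 2 e0; lra.
Qed.

Lemma hsegmentP r theta z : 0 <= r ->
  hsegment r theta z <->
  exists2 t, 0 <= t <= htanh r & z = (t * cos theta, t * sin theta).
Proof.
move=> r0; have T0 := htanh_ge0 r0; have T1 := htanh_lt1 r.
have C0 : 0 < cosh r + 1 by rewrite addr_gt0// cosh_gt0.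
have key t : 0 <= t < 1 -> hball (0, 0) r (t * cos theta, t * sin theta) <-> t <= htanh r.
  move=> /andP[t0 t1]; rewrite hball_ray ?t0//; last first.
    by rewrite /hplane/= /sqnorm/= expr0n/= addr0.
  rewrite /ray_quad /along /sqnorm/= expr0n/= addr0 !mul0r addr0 mulr0 mul0r subr0 mulr0 addr0 subr0 mulr1.
  rewrite (_ : (t <= htanh r) = (t ^+ 2 <= htanh r ^+ 2)); last by rewrite ler_pXn2r ?nnegrE.
  rewrite htanh2 ler_pdivlMr// subr_le0.
  by rewrite (_ : (2 + _) * _ = t ^+ 2 * (cosh r + 1)); last ring.
split.
  move=> [hb [t t0 zE]]; exists t => //; rewrite t0/=; move: hb; rewrite zE => hb.
  have [h1 _] := hb; apply/key => //; rewrite t0/=.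
  by move: h1; rewrite /hplane/= sqnorm_ray expr_lt1.
move=> [t /andP[t0 tT] ->]; split; last by exists t.
by apply/key => //; rewrite t0 (le_lt_trans tT).
Qed.

Lemma hball_meets_hsegment z s theta r : hplane z -> 0 <= s -> 0 <= r ->
  (hball z s `&` hsegment r theta !=set0) <->
  exists2 t, 0 <= t <= htanh r & ray_quad z s theta t <= 0.
Proof.
move=> hz s0 r0; have T1 := htanh_lt1 r; split.
  move=> [w [hb hw]]; have [t /andP[t0 tT] wE] := (hsegmentP theta w r0).1 hw.
  exists t; first by rewrite t0.
  by move: hb; rewrite wE hball_ray// t0 (le_lt_trans tT).
move=> [t /andP[t0 tT] q]; exists (t * cos theta, t * sin theta); split.
  by apply/hball_ray => //; rewrite t0 (le_lt_trans tT).
by apply/hsegmentP => //; exists t => //; rewrite t0.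
Qed.

(* The minimiser of [ray_quad z s theta] over [0, htanh r]. *)
Definition ray_foot z s theta r : R :=
  Num.min (Num.max 0 (2 * along theta z / (2 + (cosh s - 1) * (1 - sqnorm z)))) (htanh r).

(** The leading coefficient is positive, so the minimum over the interval is at the vertex clamped
    to it. An existential statement over the segment thus becomes a single inequality, measurable in
    the ball and continuous in the direction. *)
Lemma ray_quad_foot z s theta r : hplane z -> 0 <= r ->
  (exists2 t, 0 <= t <= htanh r & ray_quad z s theta t <= 0) <->
  ray_quad z s theta (ray_foot z s theta r) <= 0.
Proof.
rewrite /hplane/= => nz r0; have T0 := htanh_ge0 r0.
set a := 2 + (cosh s - 1) * (1 - sqnorm z).
have a0 : 0 < a.
  rewrite ltr_pwDl// mulr_ge0 ?subr_ge0 ?cosh_ge1//; exact: ltW.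
set c := ray_foot _ _ _ _; split=> [[t /andP[t0 tT] qt]|qc]; last first.
  exists c => //; rewrite /c /ray_foot le_min T0 andbT le_max lexx/=.
  by rewrite ge_min lexx orbT.
apply: le_trans qt.
have -> : ray_quad z s theta t = ray_quad z s theta c +
    (t - c) * (a * (t + c) - 4 * along theta z) by rewrite /ray_quad -/a; ring.
rewrite lerDl /c /ray_foot -/a.
set b := along theta z.
have [b0|b0] := leP (2 * b / a) 0.
  have b0' : 2 * b <= 0 by move: b0; rewrite pmulr_lle0// invr_gt0.
  rewrite min_l// subr0 addr0 mulr_ge0// subr_ge0 (@le_trans _ _ 0)//; first lra.
  by rewrite mulr_ge0// ltW.
have [bT|bT] := leP (2 * b / a) (htanh r).
  have -> : (t - 2 * b / a) * (a * (t + 2 * b / a) - 4 * b) = a * (t - 2 * b / a) ^+ 2.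
    by field; rewrite gt_eqF.
  by apply: mulr_ge0; [exact: ltW|exact: sqr_ge0].
rewrite mulr_le0// ?subr_le0//.
move: bT; rewrite ltr_pdivlMr// => bT.
have := ler_pM2r a0 t (htanh r); rewrite tT => ?; lra.
Qed.

End geometry.

Section polar_geometry.
Variable R : realType.
Implicit Types (z : R * R) (r s t theta : R).

Definition angle z : R := atan (z.2 / z.1).

Lemma hplane_gt0 z : hplane z -> 0 < 1 - sqnorm z.
Proof. by rewrite /hplane/= subr_gt0. Qed.

Lemma hcosh_ge1 z : hplane z -> 1 <= hcosh z.
Proof.
move=> hz; have D0 := hplane_gt0 hz; rewrite ler_pdivlMr//.
by have := sqnorm_ge0 z; lra.
Qed.

(** Together with [hcosh] these are the coordinates of z on the hyperboloid, in a frame turned by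
    theta. Up to sign, [hacross] is sinh of the distance from z to the line of direction theta. *)
Definition halong theta z : R := 2 * along theta z / (1 - sqnorm z).
Definition hacross theta z : R := 2 * across theta z / (1 - sqnorm z).

Lemma halong2Dhacross2 theta z : hplane z ->
  halong theta z ^+ 2 + hacross theta z ^+ 2 = hcosh z ^+ 2 - 1.
Proof.
move=> hz; have D0 := hplane_gt0 hz.
rewrite /halong /hacross /hcosh.
have E := along2Dacross2 theta z.
transitivity (4 * (along theta z ^+ 2 + across theta z ^+ 2) / (1 - sqnorm z) ^+ 2).
  by field; rewrite gt_eqF.
by rewrite E; field; rewrite gt_eqF.
Qed.

Lemma ray_quadE z s theta t : hplane z ->
  ray_quad z s theta t = (1 - sqnorm z) *
    (hcosh z * (1 + t ^+ 2) - 2 * halong theta z * t - cosh s * (1 - t ^+ 2)).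
Proof.
move=> hz; have D0 := hplane_gt0 hz.
by rewrite /ray_quad /hcosh /halong; field; rewrite gt_eqF.
Qed.

Lemma angle_polar z : 0 < z.1 ->
  [/\ - (pi / 2) < angle z < pi / 2, 0 < z.1 / cos (angle z) &
      z = (z.1 / cos (angle z) * cos (angle z), z.1 / cos (angle z) * sin (angle z))].
Proof.
move=> z0; have a := atan_gtNpi2 (z.2 / z.1); have b := atan_ltpi2 (z.2 / z.1).
have c0 : 0 < cos (angle z) by apply: cos_gt0_pihalf; rewrite a.
split; [by rewrite a|exact: divr_gt0|].
have tE : tan (angle z) = z.2 / z.1 by rewrite /angle atanK.
rewrite divfK ?gt_eqF// mulrAC -mulrA -/(tan _) tE mulrC divfK ?gt_eqF//.
by case: z {z0 a b c0 tE}.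
Qed.

Lemma angle_of_polar (m phi : R) : 0 < m -> - (pi / 2) < phi < pi / 2 ->
  0 < m * cos phi /\ angle (m * cos phi, m * sin phi) = phi.
Proof.
move=> m0 hphi; have c0 := cos_gt0_pihalf hphi; split; first exact: mulr_gt0.
rewrite /angle/= -mulf_div divff ?gt_eqF// mul1r.
by rewrite -/(tan phi) tanK// in_itv.
Qed.

(** The foot of the perpendicular from z to the line lies in the ball: |[hacross]| is at most
    [hcosh z] times the sine of the angle, hence at most sinh s. The foot is on the ray because the
    angle is at most pi / 2, and within r of the origin because cosh of its distance is at most
    [hcosh z]. *)
Lemma meets_of_angle z s theta r : hplane z -> 0 < z.1 -> 0 <= s -> 0 <= r ->
  hcosh z <= cosh r -> `|angle z - theta| <= sinh s / hcosh z ->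
  `|angle z - theta| <= pi / 2 ->
  hball z s `&` hsegment r theta !=set0.
Proof.
move=> hz z0 s0 r0 wr d1 d2; apply/hball_meets_hsegment => //.
have D0 := hplane_gt0 hz; have w1 := hcosh_ge1 hz.
have w0 : 0 < hcosh z by exact: lt_le_trans w1.
have [_ m0 zE] := angle_polar z0; set m := z.1 / _ in m0 zE.
set phi := angle z in d1 d2 zE.
have alE : along theta z = m * cos (phi - theta) by rewrite zE /along/= cosB; ring.
have acE : across theta z = m * sin (phi - theta) by rewrite zE /across/= sinB; ring.
have xieta := halong2Dhacross2 theta hz.
set xi := halong theta z in xieta; set eta := hacross theta z in xieta.
have xi0 : 0 <= xi.
  rewrite /xi /halong divr_ge0 ?(ltW D0)// mulr_ge0// alE mulr_ge0 ?(ltW m0)//.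
  by apply: cos_ge0_pihalf; rewrite -ler_norml.
have S0 := sinh_ge0 s0.
have ssw : 2 * m / (1 - sqnorm z) <= hcosh z.
  rewrite -(@ler_pXn2r _ 2) ?nnegrE ?(ltW w0)//; last first.
    by rewrite divr_ge0 ?(ltW D0)// mulr_ge0// ltW.
  have : (2 * m / (1 - sqnorm z)) ^+ 2 = hcosh z ^+ 2 - 1.
    rewrite -xieta /xi /eta /halong /hacross alE acE.
    transitivity ((2 * m / (1 - sqnorm z)) ^+ 2 *
        (cos (phi - theta) ^+ 2 + sin (phi - theta) ^+ 2)).
      by rewrite cos2Dsin2 mulr1.
    by field; rewrite gt_eqF.
  by move=> ->; lra.
have etaS : `|eta| <= sinh s.
  have -> : eta = 2 * m / (1 - sqnorm z) * sin (phi - theta).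
    by rewrite /eta /hacross acE; ring.
  rewrite normrM ger0_norm; last by rewrite divr_ge0 ?(ltW D0)// mulr_ge0// ltW.
  apply: (@le_trans _ _ (hcosh z * (sinh s / hcosh z))); last by rewrite mulrC divfK// gt_eqF.
  apply: ler_pM => //; first by rewrite divr_ge0 ?(ltW D0)// mulr_ge0// ltW.
  exact: le_trans (norm_sin_le _) d1.
have eta2 : eta ^+ 2 <= sinh s ^+ 2.
  by rewrite -real_normK ?num_real// ler_pXn2r ?nnegrE.
set g := Num.sqrt (1 + eta ^+ 2).
have g2 : g ^+ 2 = 1 + eta ^+ 2 by rewrite sqr_sqrtr// addr_ge0// sqr_ge0.
have g0 : 0 <= g by exact: sqrtr_ge0.
have g1 : 1 <= g.
  by rewrite -(@ler_pXn2r _ 2) ?nnegrE// g2 expr1n lerDl sqr_ge0.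
have gC : g <= cosh s.
  by rewrite -(@ler_pXn2r _ 2) ?nnegrE ?(ltW (cosh_gt0 _))// g2 cosh2 lerD2l.
have wg : 0 < hcosh z + g by rewrite addr_gt0// (lt_le_trans _ g1).
have xi2 : xi ^+ 2 = hcosh z ^+ 2 - g ^+ 2 by rewrite g2; lra.
(* Euclidean parameter of the foot, with g the cosh of the distance from z to the line: (1 + t^2) /
   (1 - t^2) = [hcosh z] / g, the hyperbolic Pythagoras formula. *)
pose t := xi / (hcosh z + g).
have t2 : t ^+ 2 = (hcosh z - g) / (hcosh z + g).
  by rewrite /t expr_div_n xi2; field; rewrite gt_eqF.
have t0 : 0 <= t by rewrite divr_ge0// ltW.
exists t.
  rewrite t0/= -(@ler_pXn2r _ 2) ?nnegrE ?htanh_ge0// t2 htanh2.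
  rewrite ler_pdivrMr// mulrAC ler_pdivlMr ?addr_gt0 ?cosh_gt0//.
  have : hcosh z <= cosh r * g by rewrite (le_trans wr)// ler_peMr// ltW// cosh_gt0.
  lra.
rewrite ray_quadE// pmulr_rle0// -/xi.
have -> : 2 * xi * t = 2 * (hcosh z ^+ 2 - g ^+ 2) / (hcosh z + g).
  by rewrite -xi2 /t; ring.
rewrite t2.
have -> : hcosh z * (1 + (hcosh z - g) / (hcosh z + g)) -
    2 * (hcosh z ^+ 2 - g ^+ 2) / (hcosh z + g) -
    cosh s * (1 - (hcosh z - g) / (hcosh z + g)) =
    2 * g / (hcosh z + g) * (g - cosh s).
  by field; rewrite gt_eqF.
by rewrite mulr_ge0_le0 ?subr_le0// divr_ge0 ?mulr_ge0// ltW.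
Qed.

(** A weak form of d(0, z) <= r + s. A point of the segment with Euclidean norm t satisfies (1 + t)
    / (1 - t) <= e^r. *)
Lemma hcosh_of_meets z s theta r C : hplane z -> 0 <= s <= C -> 0 <= r ->
  hball z s `&` hsegment r theta !=set0 -> hcosh z <= cosh C * expR r.
Proof.
move=> hz /andP[s0 sC] r0 /hball_meets_hsegment.
move=> /(_ hz s0 r0)[t /andP[t0 tT]].
have D0 := hplane_gt0 hz; have w1 := hcosh_ge1 hz.
have w0 : 0 < hcosh z by exact: lt_le_trans w1.
have xieta := halong2Dhacross2 theta hz.
rewrite ray_quadE// pmulr_rle0//.
set xi := halong theta z in xieta *; set eta := hacross theta z in xieta *.
set w := hcosh z in w0 w1 xieta *.
have t1 : t < 1 by rewrite (le_lt_trans tT) ?htanh_lt1.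
have Cs := cosh_ge1 s; have CC := le_cosh s0 sC.
move=> q.
have xiw : xi <= w.
  have [xi0|xi0] := leP xi 0; first lra.
  rewrite -(@ler_pXn2r _ 2) ?nnegrE ?(ltW w0) ?(ltW xi0)//.
  by have := sqr_ge0 eta; lra.
have e0 := expR_gt0 r.
have h1 : w * (1 - t) <= cosh s * (1 + t).
  rewrite -(@ler_pM2r _ (1 - t)) ?subr_gt0//.
  have : xi * t <= w * t by exact: ler_wpM2r.
  lra.
have h2 : 1 + t <= expR r * (1 - t).
  move: tT; rewrite /htanh ler_pdivlMr; last lra.
  lra.
have h3 : w * (1 - t) <= cosh C * expR r * (1 - t).
  rewrite (le_trans h1)// -mulrA ler_pM//; lra.
by move: h3; rewrite ler_pM2r// subr_gt0.
Qed.

(** Converse of [meets_of_angle] up to an error of order w^-3, where w = [hcosh z]; this error is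
    integrable in w. The tangent of the deviation is [hacross] / [halong], with numerator at most
    sinh s and denominator equal to w up to a relative error of order w^-2. The lower bounds on w
    keep the deviation below 1/4, so with theta in [0, 1/2] the argument stays in the range of
    [atan]. *)
Lemma angle_of_meets z s theta r C : hplane z -> 0 <= s <= C -> 0 <= r ->
  0 <= theta <= 2^-1 -> 2 * cosh C <= hcosh z -> 8 * sinh C <= hcosh z ->
  hball z s `&` hsegment r theta !=set0 ->
  [/\ 0 < z.1, hcosh z <= cosh C * expR r &
    `|angle z - theta| <= sinh s / hcosh z + sinh C * cosh C ^+ 2 / hcosh z ^+ 3].
Proof.
move=> hz /andP[s0 sC] r0 /andP[th0 th1] wC wS hmeet.
have wr : hcosh z <= cosh C * expR r by apply: hcosh_of_meets hmeet => //; rewrite s0.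
have [t /andP[t0 tT] q0] := (hball_meets_hsegment theta hz s0 r0).1 hmeet; move: q0.
have D0 := hplane_gt0 hz; have w1 := hcosh_ge1 hz.
have w0 : 0 < hcosh z by exact: lt_le_trans w1.
have xieta := halong2Dhacross2 theta hz.
rewrite ray_quadE// pmulr_rle0//.
set xi := halong theta z in xieta *; set eta := hacross theta z in xieta *.
set w := hcosh z in w0 w1 wC wS xieta wr *.
have t1 : t < 1 by rewrite (le_lt_trans tT) ?htanh_lt1.
have t21 : t ^+ 2 < 1 by rewrite expr_lt1.
have Cs := cosh_ge1 s; have CC := le_cosh s0 sC.
move=> q; have q' : w * (1 + t ^+ 2) - 2 * xi * t <= cosh s * (1 - t ^+ 2) by lra.
have xiw : xi <= w.
  have [xi0|xi0] := leP xi 0; first lra.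
  rewrite -(@ler_pXn2r _ 2) ?nnegrE ?(ltW w0) ?(ltW xi0)//.
  by have := sqr_ge0 eta; lra.
have q0 : 0 <= w * (1 + t ^+ 2) - 2 * xi * t.
  have : 0 <= w * (1 - t) ^+ 2 by rewrite mulr_ge0 ?(ltW w0)// sqr_ge0.
  have : xi * t <= w * t by exact: ler_wpM2r.
  lra.
(* A point behind the origin would force w <= cosh s, against 2 cosh C <= w. *)
have xi0 : 0 < xi.
  rewrite ltNge; apply/negP => xi0.
  have : xi * t <= 0 by rewrite mulr_le0_ge0.
  have : 0 <= w * t ^+ 2 by rewrite mulr_ge0 ?(ltW w0)// sqr_ge0.
  have : 0 <= cosh s * t ^+ 2 by rewrite mulr_ge0 ?(ltW (cosh_gt0 _))// sqr_ge0.
  lra.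
(* The distance to the line is at most the distance to a point of it. This is the reverse
   Cauchy-Schwarz inequality for the Minkowski form, with defect the square of 2 w t - xi (1 +
   t^2). *)
have eta2 : eta ^+ 2 <= sinh s ^+ 2.
  have := cosh2 s => C2.
  suff : (w ^+ 2 - xi ^+ 2) * (1 - t ^+ 2) ^+ 2 <= cosh s ^+ 2 * (1 - t ^+ 2) ^+ 2.
    rewrite ler_pM2r ?exprn_gt0 ?subr_gt0//; lra.
  rewrite -exprMn; apply: (@le_trans _ _ ((w * (1 + t ^+ 2) - 2 * xi * t) ^+ 2)).
    by have := sqr_ge0 (2 * w * t - xi * (1 + t ^+ 2)); lra.
  by rewrite ler_pXn2r ?nnegrE// (le_trans q0).
have S0 := sinh_ge0 s0; have SC := le_sinh sC.
have etaS : `|eta| <= sinh s.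
  by rewrite -(@ler_pXn2r _ 2) ?nnegrE// real_normK ?num_real.
have c0 := cosh_gt0 C.
set x := cosh C ^+ 2 / w ^+ 2.
have x0 : 0 <= x by rewrite divr_ge0 ?sqr_ge0.
have x1 : x <= 4^-1.
  rewrite ler_pdivrMr ?exprn_gt0//.
  have : (2 * cosh C) ^+ 2 <= w ^+ 2 by rewrite ler_pXn2r ?nnegrE ?(ltW w0)// mulr_ge0// ltW.
  lra.
(* From xi^2 >= w^2 (1 - x), because (1 - x) (1 + x)^2 >= 1 for 0 <= x <= 1/4. *)
have wxi : w <= xi * (1 + x).
  rewrite -(@ler_pXn2r _ 2) ?nnegrE ?(ltW w0)//; last by rewrite mulr_ge0 ?addr_ge0// ltW.
  have hx : w ^+ 2 * (1 - x) <= xi ^+ 2.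
    have -> : w ^+ 2 * (1 - x) = w ^+ 2 - cosh C ^+ 2.
      by rewrite /x; field; rewrite gt_eqF.
    have : cosh s ^+ 2 <= cosh C ^+ 2 by rewrite ler_pXn2r ?nnegrE ?(ltW (cosh_gt0 _)).
    have := cosh2 s; lra.
  apply: (@le_trans _ _ (w ^+ 2 * (1 - x) * (1 + x) ^+ 2)).
    rewrite -mulrA ler_peMr ?sqr_ge0//.
    have : 0 <= x * (1 - x - x ^+ 2).
      rewrite mulr_ge0//; have : x * x <= 4^-1 * 1 by apply: ler_pM => //; lra.
      lra.
    lra.
  by rewrite [leRHS]exprMn; apply: ler_wpM2r; [exact: sqr_ge0|].
have bnd : `|eta / xi| <= sinh s / w + sinh C * cosh C ^+ 2 / w ^+ 3.
  rewrite normf_div [`|xi|]gtr0_norm// ler_pdivrMr//.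
  apply: (le_trans etaS); apply: (@le_trans _ _ (sinh s / w * (xi * (1 + x)))).
    by rewrite mulrAC ler_pdivlMr// ler_wpM2l.
  rewrite (_ : _ * (xi * _) = (sinh s / w + sinh s * cosh C ^+ 2 / w ^+ 3) * xi); last first.
    by rewrite /x; field; rewrite gt_eqF.
  rewrite ler_wpM2r ?(ltW xi0)// lerD2l ler_wpM2r ?invr_ge0 ?exprn_ge0 ?(ltW w0)//.
  by rewrite ler_wpM2r// sqr_ge0.
set u := atan (eta / xi).
have ub : `|u| <= sinh s / w + sinh C * cosh C ^+ 2 / w ^+ 3.
  exact: le_trans (norm_atan_le _) bnd.
have u1 : `|u| <= 4^-1.
  apply: (le_trans ub).
  have -> : sinh C * cosh C ^+ 2 / w ^+ 3 = sinh C / w * x.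
    by rewrite /x; field; rewrite gt_eqF.
  have h1 : sinh s / w <= 8^-1 by rewrite ler_pdivrMr//; lra.
  have h2 : sinh C / w <= 8^-1 by rewrite ler_pdivrMr//; lra.
  have : sinh C / w * x <= 8^-1 * 4^-1.
    by apply: ler_pM => //; rewrite divr_ge0 ?(ltW w0)// (le_trans S0).
  lra.
have uth : - (pi / 2) < u + theta < pi / 2.
  have := pi_ge2 R; move: u1; rewrite ler_norml => /andP[]; lra.
have uc : 0 < cos u.
  by apply: cos_gt0_pihalf; rewrite atan_gtNpi2 atan_ltpi2.
pose m := xi * (1 - sqnorm z) / 2 / cos u.
have m0 : 0 < m by rewrite !divr_gt0// mulr_gt0.
have su : sin u = eta / xi * cos u.
  have : tan u = eta / xi by rewrite /u atanK.
  by move=> <-; rewrite /tan divfK// gt_eqF.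
have alE : along theta z = m * cos u.
  by rewrite /m divfK ?gt_eqF// /xi /halong; field; rewrite gt_eqF.
have acE : across theta z = m * sin u.
  rewrite su /m (_ : across theta z = eta * (1 - sqnorm z) / 2); last first.
    by rewrite /eta /hacross; field; rewrite gt_eqF.
  by field; rewrite !gt_eqF.
have zE : z = (m * cos (u + theta), m * sin (u + theta)).
  rewrite cosD sinD !mulrBr !mulrDr !mulrA -alE -acE /along /across.
  case: (z) => a b /=; congr pair.
    by rewrite -[LHS]mulr1 -(cos2Dsin2 theta); ring.
  by rewrite -[LHS]mulr1 -(cos2Dsin2 theta); ring.
have [z1 az] := angle_of_polar m0 uth.
have aE : angle z = u + theta by rewrite zE.
by rewrite aE addrK; split=> //; rewrite zE.
Qed.

End polar_geometry.

(** * Areas of sets of blocking balls *)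

Section planar_area.
Variable R : realType.
Local Notation leb := (@lebesgue_measure R).
Local Notation leb2 := (leb \x leb)%E.
Implicit Types (A : set (R * R)) (a b h e theta k W : R) (z : R * R).

Lemma area_le A (f u F : R -> R) a b : a <= b -> measurable A ->
  (forall z, A z -> a <= z.1 <= b /\ f z.1 <= z.2 <= f z.1 + u z.1) ->
  (forall w, a <= w <= b -> 0 <= u w) ->
  (forall w : R, a <= w <= b -> is_derive w 1 F (u w)) ->
  (forall w, a <= w <= b -> {for w, continuous u}) ->
  (leb2 A <= (F b - F a)%:E)%E.
Proof.
move=> ab mA Asub u0 dF cu.
rewrite -(integral_itvcc_derive ab dF cu).
rewrite [leRHS]integral_mkcond; apply: ge0_le_integral => //.
- exact: measurable_fun_xsection.
- apply/(measurable_restrictT _ (measurable_itv _)); apply/measurable_EFinP.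
  apply: subspace_continuous_measurable_fun => //.
  by apply: continuous_in_subspaceT => w; rewrite inE/= in_itv/= => /cu.
move=> w _; rewrite patchE; case: ifPn => wab.
  have wab' : a <= w <= b by move: wab; rewrite inE/= in_itv.
  have -> : (u w)%:E = leb `[f w, (f w + u w)].
    rewrite lebesgue_measure_itv/= lte_fin ltrDl.
    have := u0 _ wab'; rewrite le_eqVlt => /predU1P[<-|->]; first by rewrite ltxx.
    by rewrite -EFinB addrC addKr.
  apply: le_measure; rewrite ?inE//; first exact: measurable_xsection.
  move=> phi; rewrite /xsection/= inE => /Asub[_] /=.
  by rewrite in_itv.
rewrite /= (_ : xsection A w = set0) ?measure0//.
apply/seteqP; split=> phi //; rewrite /xsection/= inE => /Asub[/= wab' _].
by move/negP: wab; apply; rewrite inE/= in_itv.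
Qed.

Lemma is_derive_ln_scale (c w : R) : 0 < w ->
  is_derive w (1 : R) (fun w => c * ln w) (c / w).
Proof.
move=> w0; have d := is_derive1_ln w0.
by apply: is_derive_eq; rewrite /GRing.scale/=; ring.
Qed.

Lemma continuous_div (c w : R) : 0 < w -> {for w, continuous (fun w : R => c / w)}.
Proof.
move=> w0; apply: continuousM; first exact: cst_continuous.
by apply: continuousV; [rewrite gt_eqF|exact: cvg_id].
Qed.

(** The fibre of [A] at height w has length at least 2 (h / w - e), trivially so when this is
    negative. The loss due to e is added on the right, which avoids subtracting extended reals. *)
Lemma area_ge A a b h e theta : 0 < a -> a <= b -> 0 <= h -> 0 <= e -> measurable A ->
  (forall z, a <= z.1 <= b -> `|z.2 - theta| <= h / z.1 - e -> A z) ->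
  ((2 * h * ln (b / a))%:E <= leb2 A + (2 * e * (b - a))%:E)%E.
Proof.
move=> a0 ab h0 e0 mA Asup.
have b0 : 0 < b by exact: lt_le_trans ab.
have wpos w : a <= w <= b -> 0 < w by move=> /andP[+ _]; exact: lt_le_trans.
have -> : (2 * h * ln (b / a))%:E = (\int[leb]_(w in `[a, b]) (2 * h / w)%:E)%E.
  have -> := @integral_itvcc_derive R (fun w => 2 * h * ln w) (fun w => 2 * h / w) a b ab
    (fun w hw => is_derive_ln_scale (2 * h) (wpos w hw))
    (fun w hw => @continuous_div (2 * h) w (wpos w hw)).
  by rewrite ln_div ?posrE ?mulrBr.
have mx := measurable_fun_xsection leb mA.
have mI : measurable (`[a, b]%classic : set R) by exact: measurable_itv.
have md : measurable_fun `[a, b] (fun w : R => (2 * h / w)%:E).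
  apply/measurable_EFinP; apply: measurable_funTS; apply: measurable_funM => //.
  exact: measurable_inv.
apply: (@le_trans _ _ (\int[leb]_(w in `[a, b]) (leb (xsection A w) + (2 * e)%:E))%E).
  apply: ge0_le_integral => //.
  - move=> w /=; rewrite in_itv/= => /wpos w0.
    by rewrite lee_fin divr_ge0 ?mulr_ge0// ltW.
  - by apply: emeasurable_funD => //; exact: measurable_funTS.
  move=> w /=; rewrite in_itv/= => wab; have w0 := wpos _ wab.
  have [hw|hw] := leP 0 (h / w - e); last first.
    apply: (@le_trans _ _ (2 * e)%:E); last by rewrite leeDr.
    by rewrite lee_fin; lra.
  have -> : (2 * h / w = 2 * (h / w - e) + 2 * e)%R by ring.
  rewrite EFinD leeD2r//.
  have -> : (2 * (h / w - e))%:E = leb `[theta - (h / w - e), theta + (h / w - e)].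
    rewrite lebesgue_measure_itv/= lte_fin.
    move: hw; set v := _ - e; rewrite le_eqVlt => /predU1P[<-|v0].
      by rewrite subr0 addr0 ltxx mulr0.
    by rewrite ifT; [rewrite -EFinB; congr (_%:E); ring|lra].
  apply: le_measure; rewrite ?inE//; first exact: measurable_xsection.
  move=> phi /=; rewrite in_itv/= => /andP[p1 p2]; rewrite /xsection/= inE.
  by apply: Asup => //=; rewrite ler_norml; lra.
rewrite ge0_integralD//; last first.
- by move=> w _; rewrite lee_fin mulr_ge0.
- exact: measurable_funTS.
rewrite integral_cst//= lebesgue_measure_itv/= lte_fin.
have -> : ((2 * e)%:E * (if (a < b)%R then b%:E + (- a)%:E else 0) = (2 * e * (b - a))%:E)%E.
  case: ltP => ba; first by rewrite -EFinB -EFinM.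
  by rewrite mule0 (_ : b = a) ?subrr ?mulr0//; apply/eqP; rewrite eq_le ab ba.
rewrite leeD2r//; apply: ge0_subset_integral => //.
Qed.

(* In the coordinates (cosh distance, angle), of area measure dw dphi, a ball of
   radius t centred at height w covers the angles within about sinh t / w. [H]
   bounds [sinh] of the radii and [w0] is such that all these arcs are short. *)
Variables (H w0 : R) (H0 : 0 <= H) (w0H : 8 * H <= w0) (w01 : 1 < w0).

(** The arc is shrunk by [W^-1] so that the ball still blocks after a change of direction of that
    size; since heights are at most W, this costs at most 2 in area. *)
Definition shadow W theta h : set (R * R) :=
  [set z | w0 <= z.1 <= W /\ `|z.2 - theta| <= h / z.1 - W^-1].

Lemma measurable_shadow W theta h : measurable (shadow W theta h).
Proof.
have m1 : measurable_fun setT (fun z : R * R => z.1) by exact: measurable_fst.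
have m2 : measurable_fun setT (fun z : R * R => `|z.2 - theta|).
  apply: measurableT_comp => //; apply: measurable_funB => //; exact: measurable_snd.
have m3 : measurable_fun setT (fun z : R * R => h / z.1 - W^-1).
  apply: measurable_funB => //; apply: measurable_funM => //.
  exact: measurable_funV.
rewrite (_ : shadow _ _ _ = [set z | w0 <= z.1] `&` [set z | z.1 <= W] `&`
   [set z | `|z.2 - theta| <= h / z.1 - W^-1]).
  apply: measurableI; last exact: measurable_set_ler.
  by apply: measurableI; apply: measurable_set_ler.
by apply/seteqP; split=> z /=; [case=> /andP[]|rewrite /shadow/=; case=> -[-> ->]].
Qed.

(** The slack 1/8 beyond pi / 4 is room for the arcs scanned past the end of the sector. *)
Lemma shadow_strip W theta h z : 0 < W -> 0 <= h <= H -> `|theta| <= pi / 4 + 8^-1 ->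
  shadow W theta h z -> strip z.
Proof.
move=> W0 /andP[h0 hH] th [/andP[zw zW] zt]; split=> /=.
  by rewrite in_itv/= andbT (lt_le_trans w01).
have z0 : 0 < z.1 by rewrite (lt_le_trans _ zw)// (lt_trans _ w01).
have h1 : h / z.1 <= 8^-1.
  by rewrite ler_pdivrMr// (le_trans hH)// ler_pdivlMl// (le_trans w0H).
have : 0 < W^-1 by rewrite invr_gt0.
have := pi_ge2 R.
rewrite in_itv/=; move: zt th; rewrite !ler_norml => /andP[? ?] /andP[? ?]; lra.
Qed.

Lemma shadow_area_ge W theta h : w0 <= W -> 0 <= h <= H ->
  `|theta| <= pi / 4 + 8^-1 ->
  ((2 * h * ln (W / w0))%:E <= leb2 (shadow W theta h `&` @strip R) + 2%:E)%E.
Proof.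
move=> wW hH th; have w00 : 0 < w0 by rewrite (lt_trans _ w01).
have W0 : 0 < W by exact: lt_le_trans wW.
have Wi : 0 <= W^-1 by rewrite invr_ge0 ltW.
have mS : measurable (shadow W theta h `&` @strip R).
  by apply: measurableI; [exact: measurable_shadow|apply: measurableX; exact: measurable_itv].
have h0 : 0 <= h by case/andP: hH.
apply: le_trans (area_ge (theta := theta) w00 wW h0 Wi mS _) _.
- move=> z zw zt; have Sz : shadow W theta h z by split.
  by split=> //; exact: shadow_strip Sz.
rewrite leeD2l// lee_fin -mulrA ler_piMr// mulrC ler_pdivrMr// mul1r; lra.
Qed.

(** Above the height 3 [w0] W / k the arcs are too short to bridge the gap k / W, so the two shadows
    are disjoint and a whole piece of shadow remains. The condition k <= 3 W keeps that height at
    least [w0]; for k <= 3 [w0] the logarithm is not positive. *)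
Lemma shadow_diff_area_ge W th1 th2 h k : w0 <= W -> 0 <= h <= H ->
  `|th2| <= pi / 4 + 8^-1 -> 1 <= k <= 3 * W -> th2 - th1 = k / W ->
  ((2 * h * ln (k / (3 * w0)))%:E <=
   leb2 ((shadow W th2 h `\` shadow W th1 h) `&` @strip R) + 2%:E)%E.
Proof.
move=> wW /andP[h0 hH] th /andP[k1 kW] dth.
have w00 : 0 < w0 by rewrite (lt_trans _ w01).
have W0 : 0 < W by exact: lt_le_trans wW.
have k0 : 0 < k by exact: lt_le_trans k1.
have Wi : 0 < W^-1 by rewrite invr_gt0.
have mS : measurable ((shadow W th2 h `\` shadow W th1 h) `&` @strip R).
  apply: measurableI; last by apply: measurableX; exact: measurable_itv.
  by apply: measurableD; exact: measurable_shadow.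
have [kw|kw] := leP k (3 * w0).
  apply: (@le_trans _ _ 0%E); last by rewrite adde_ge0// lee_fin.
  rewrite lee_fin mulr_ge0_le0 ?mulr_ge0//.
  by rewrite ln_le0// ler_pdivrMr ?mul1r// mulr_gt0.
pose a := 3 * w0 * W / k.
have a0 : 0 < a by rewrite divr_gt0// !mulr_gt0.
have aw : w0 <= a.
  by rewrite ler_pdivlMr// -mulrA mulrCA ler_pM2l.
have aW : a <= W by rewrite ler_pdivrMr// mulrC ler_pM2l// ltW.
have -> : k / (3 * w0) = W / a by rewrite /a; field; rewrite !gt_eqF.
apply: le_trans (area_ge (theta := th2) a0 aW h0 (ltW Wi) mS _) _.
- move=> z /andP[za zW] zt.
  have z0 : 0 < z.1 by exact: lt_le_trans za.
  have Sz : shadow W th2 h z by split=> //; rewrite (le_trans aw za).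
  split; last by apply: shadow_strip Sz => //; rewrite h0.
  split=> // -[_ zt1].
  have hz : 2 * (h / z.1) < k / W + W^-1.
    apply: (@le_lt_trans _ _ (2 * (H / a))).
      by rewrite ler_pM2l// ler_pM ?invr_ge0 ?(ltW z0)// lef_pV2.
    have -> : H / a = k / W * (H / (3 * w0)) by rewrite /a; field; rewrite !gt_eqF.
    have w0H' : 8 * H <= w0 := w0H.
    have : H / (3 * w0) <= 2^-1 by rewrite ler_pdivrMr; lra.
    have kW0 : 0 < k / W by rewrite divr_gt0.
    by move=> /(ler_wpM2l (ltW kW0)); lra.
  by move: zt zt1; rewrite !ler_norml => /andP[? ?] /andP[? ?]; lra.
rewrite leeD2l// lee_fin -mulrA ler_piMr// mulrC ler_pdivrMr// mul1r; lra.
Qed.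

(** Below the height W / k the fibres of the shadows are translates by k / W, so the fibres of the
    difference have length at most k / W and contribute at most 1. Above that height the whole
    second shadow is counted, which gives 2 h ln k. *)
Lemma shadow_diff_area_le W th1 th2 h k : w0 <= W -> 0 <= h <= H ->
  1 <= k -> th2 - th1 = k / W ->
  (leb2 ((shadow W th2 h `\` shadow W th1 h) `&` @strip R) <= (2 * h * ln k + 1)%:E)%E.
Proof.
move=> wW /andP[h0 hH] k1 dth.
have w00 : 0 < w0 by rewrite (lt_trans _ w01).
have W0 : 0 < W by exact: lt_le_trans wW.
have k0 : 0 < k by exact: lt_le_trans k1.
have Wi : 0 < W^-1 by rewrite invr_gt0.
set A := _ `&` _.
have mA : measurable A.
  apply: measurableI; last by apply: measurableX; exact: measurable_itv.
  by apply: measurableD; exact: measurable_shadow.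
have upper a B : w0 <= a -> a <= W -> measurable B -> B `<=` A ->
    (forall z, B z -> a <= z.1) -> (leb2 B <= (2 * h * ln (W / a))%:E)%E.
  move=> wa aW mB BA Ba.
  have wpos w : a <= w <= W -> 0 < w.
    by move=> /andP[aw _]; rewrite (lt_le_trans w00)// (le_trans wa).
  have -> : 2 * h * ln (W / a) = 2 * h * ln W - 2 * h * ln a.
    by rewrite ln_div ?posrE ?mulrBr// (lt_le_trans w00).
  apply: (area_le (f := fun w => th2 - h / w) (u := fun w => 2 * h / w)
    (F := fun w => 2 * h * ln w)) => //.
  - move=> z Bz; have [[[/andP[_ zW] zt] _] _] := BA _ Bz.
    rewrite (Ba _ Bz) zW; split=> //.
    move: zt; rewrite ler_norml -!mulrA => /andP[? ?]; lra.
  - by move=> w /wpos w0'; rewrite divr_ge0 ?mulr_ge0// ltW.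
  - by move=> w /wpos w0'; exact: is_derive_ln_scale.
  - by move=> w /wpos w0'; exact: continuous_div.
have [ww|ww] := leP (W / k) w0.
  apply: (le_trans (upper w0 A _ _ _ _ _)) => //.
    by move=> z [[[/andP[]]]].
  rewrite lee_fin -[leLHS]addr0 lerD// ler_wpM2l ?mulr_ge0// ler_ln ?posrE ?divr_gt0//.
  by rewrite ler_pdivrMr// mulrC -ler_pdivrMr.
pose a := W / k.
have a0 : 0 < a by rewrite divr_gt0.
have aW : a <= W by rewrite ler_pdivrMr// ler_peMr// ltW.
have m1 : measurable_fun setT (fun z : R * R => z.1) by exact: measurable_fst.
pose A1 := A `&` [set z | z.1 <= a].
pose A2 := A `&` [set z | a <= z.1].
have mA1 : measurable A1 by apply: measurableI => //; exact: measurable_set_ler.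
have mA2 : measurable A2 by apply: measurableI => //; exact: measurable_set_ler.
have -> : A = A1 `|` A2.
  rewrite -setIUr (_ : _ `|` _ = setT) ?setIT//.
  by apply/seteqP; split=> z //= _; have [|/ltW] := leP z.1 a; [left|right].
apply: (le_trans (measureU2 _ _ _)) => //.
rewrite addrC EFinD; apply: leeD.
  have kE : k = W / a by rewrite /a; field; rewrite !gt_eqF.
  rewrite [in leRHS]kE.
  by apply: upper => //; [exact: ltW|exact: subIsetl|move=> z []].
apply: (@le_trans _ _ (k / W * a - k / W * w0)%:E).
  apply: (area_le (a := w0) (b := a) (f := fun w => th1 + (h / w - W^-1))
     (u := fun=> k / W) (F := fun w => k / W * w) (ltW ww) mA1).
  - move=> z [[[[/andP[zw zW] zt] nz] _] /= za]; rewrite zw za; split=> //.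
    have z0 : 0 < z.1 by exact: lt_le_trans zw.
    have : ~ (`|z.2 - th1| <= h / z.1 - W^-1) by move=> ?; apply: nz; split=> //; rewrite zw.
    have kW0 : 0 < k / W by rewrite divr_gt0.
    move=> /negP; rewrite ler_norml negb_and -!ltNge.
    by move: zt; rewrite ler_norml => /andP[? ?] /orP[]; lra.
  - by move=> w _; rewrite divr_ge0// ltW.
  - by move=> w _; apply: is_derive_eq; rewrite /GRing.scale/=; ring.
  - by move=> w _; exact: cst_continuous.
have -> : k / W * a = 1 by rewrite /a; field; rewrite !gt_eqF.
rewrite lee_fin lerBlDr lerDl mulr_ge0 ?(ltW w00)// divr_ge0// ltW//.
Qed.

End planar_area.

(** * Elementary bounds on hyperbolic area *)

Section harea_basic.
Variable R : realType.
Local Notation leb := (@lebesgue_measure R).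
Local Notation leb2 := (leb \x leb)%E.
Implicit Types (A : set (R * R)).

Lemma harea_hplane A : harea (A `&` @hplane R) = harea A.
Proof. by rewrite /harea -setIA setIid. Qed.

Lemma le_harea A B : measurable A -> measurable B -> A `&` @hplane R `<=` B ->
  (harea A <= harea B)%E.
Proof.
move=> mA mB AB; apply: ge0_subset_integral => //.
- by apply: measurableI => //; exact: measurable_hplane.
- by apply: measurableI => //; exact: measurable_hplane.
- by apply: measurable_funTS; exact: measurable_hdensity.
- by move=> z _; exact: hdensity_ge0.
- by move=> z Az; split; [exact: AB|case: Az].
Qed.

Lemma harea_setU_le A B : measurable A -> measurable B ->
  (harea (A `|` B) <= harea A + harea B)%E.
Proof.
move=> mA mB.
have i (S : set (R * R)) : measurable S -> harea S = hintegral (\1_S : _ -> R).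
  move=> mS; rewrite -[LHS]mul1e -hintegral_indic//.
  by congr hintegral; apply/funext => z; rewrite mul1r.
have mAB : measurable (A `|` B) by exact: measurableU.
rewrite !i// -hintegralD//; try exact: measurable_indic.
apply: le_hintegral; try exact: measurable_indic.
  by apply: measurable_funD; exact: measurable_indic.
move=> z; rewrite !indicE in_setU; case: (_ \in A); case: (_ \in B) => /=; lra.
Qed.

(** The density equals ([hcosh] + 1)^2, and the unit disc lies in a square of area 4. *)
Lemma harea_disc_le (B : R) : 1 <= B ->
  (harea [set z : R * R | (hcosh z <= B)%R] <= (4 * (B + 1) ^+ 2)%:E)%E.
Proof.
move=> B1; pose Q : set (R * R) := `[-1, 1] `*` `[-1, 1].
have mQ : measurable Q by apply: measurableX; exact: measurable_itv.
have mA : measurable ([set z | hcosh z <= B] `&` @hplane R).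
  apply: measurableI; last exact: measurable_hplane.
  apply: measurable_set_ler => //; exact: measurable_hcosh.
have b0 : 0 <= B + 1 by lra.
apply: (@le_trans _ _ (\int[leb2]_(z in Q) ((B + 1) ^+ 2)%:E)%E).
  rewrite /harea integral_mkcond [leRHS]integral_mkcond.
  apply: ge0_le_integral => //.
  - by move=> z _; exact: hdensity_restrict_ge0.
  - exact: measurable_hdensity_restrict.
  - by apply: (iffLR (measurable_restrictT _ mQ)).
  move=> z _; rewrite !patchE; case: ifPn => zA; last first.
    by case: ifPn => // _; rewrite lee_fin exprn_ge0.
  move: zA; rewrite inE => -[/= zB zh].
  have D0 := hplane_gt0 zh.
  rewrite mem_set; last first.
    move: D0; rewrite /Q /sqnorm/= !in_itv/= => D0.
    have := sqr_ge0 z.1; have := sqr_ge0 z.2 => y2 x2.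
    by split; rewrite -ler_norml -(@ler_pXn2r _ 2) ?nnegrE// expr1n real_normK ?num_real; lra.
  rewrite lee_fin; have -> : 4 / (1 - sqnorm z) ^+ 2 = (2 / (1 - sqnorm z)) ^+ 2.
    by field; rewrite gt_eqF.
  rewrite ler_pXn2r ?nnegrE//; last by rewrite divr_ge0// ltW.
  suff -> : 2 / (1 - sqnorm z) = hcosh z + 1 by rewrite lerD2r.
  by rewrite /hcosh; field; rewrite gt_eqF.
rewrite integral_cst//= product_measure1E//= lebesgue_measure_itv/= lte_fin ifT; last lra.
by rewrite -!EFinB -!EFinM lee_fin; lra.
Qed.

End harea_basic.

(** * Averaging areas over the radius *)

Section mean.
Context (R : realType) (nu : probability R R) (C : R).
Hypotheses (C1 : 1 <= C) (nuC : nu (~` `]0, C]) = 0%E).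

Let mI : measurable (`]0, C]%classic : set R). Proof. exact: measurable_itv. Qed.

Lemma measurable_sinh : measurable_fun setT (@sinh R).
Proof.
apply: measurable_funM => //; apply: measurable_funB; first exact: measurable_expR.
by apply: measurableT_comp; [exact: measurable_expR|].
Qed.

Lemma measurable_cosh : measurable_fun setT (@cosh R).
Proof.
apply: measurable_funM => //; apply: measurable_funD; first exact: measurable_expR.
by apply: measurableT_comp; [exact: measurable_expR|].
Qed.

Lemma radii_set1 : nu `]0, C]%classic = 1%E.
Proof.
have := probability_setC nu mI; rewrite nuC => H.
have : nu `]0, C]%classic \is a fin_num by exact: fin_num_measure.
by move: H; case: (nu `]0, C]%classic) => //= x [] /eqP; rewrite eq_sym subr_eq0 => /eqP ->.
Qed.

Definition mean_sinh : R := fine ('E_nu[@sinh R])%E.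

Lemma mean_sinhE : (mean_sinh%:E = \int[nu]_(t in `]0%R, C]) (sinh t)%:E)%E.
Proof.
have E : ('E_nu[@sinh R] = \int[nu]_(t in `]0%R, C]) (sinh t)%:E)%E.
  rewrite unlock [RHS]integral_mkcond; apply: ae_eq_integral => //.
  - by apply/measurable_EFinP; exact: measurable_sinh.
  - apply: (iffLR (measurable_restrictT _ mI)); apply: measurable_funTS.
    by apply/measurable_EFinP; exact: measurable_sinh.
  exists (~` `]0, C]%classic); split=> //; first exact: measurableC.
  move=> t /= H It; apply: H => _; rewrite patchE mem_set//.
rewrite /mean_sinh E fineK// ge0_fin_numE; last first.
  by apply: integral_ge0 => t /=; rewrite in_itv/= => /andP[t0 _]; rewrite lee_fin sinh_ge0// ltW.
apply: (@le_lt_trans _ _ (\int[nu]_(t in `]0%R, C]) (sinh C)%:E)%E).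
  apply: ge0_le_integral => //.
  - by move=> t /=; rewrite in_itv/= => /andP[t0 _]; rewrite lee_fin sinh_ge0// ltW.
  - by apply: measurable_funTS; apply/measurable_EFinP; exact: measurable_sinh.
  by move=> t /=; rewrite in_itv/= => /andP[_ tC]; rewrite lee_fin le_sinh.
by rewrite integral_cst//= radii_set1 mule1 ltry.
Qed.

Lemma mean_sinh_ge0 : 0 <= mean_sinh.
Proof.
rewrite -lee_fin mean_sinhE; apply: integral_ge0 => t /=.
by rewrite in_itv/= => /andP[t0 _]; rewrite lee_fin sinh_ge0// ltW.
Qed.

Definition mass (S : set (R * R * R)) : \bar R := (\int[nu]_t harea (ysection S t))%E.

Lemma mass_restrict S : measurable S ->
  mass S = (\int[nu]_(t in `]0%R, C]) harea (ysection S t))%E.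
Proof.
move=> mS; rewrite /mass (ge0_negligible_integral (measurableC mI) measurableT _ _ nuC).
- by rewrite setTD setCK.
- exact: measurable_harea_ysection.
- by move=> t _; exact: harea_ge0.
Qed.

Let m2sinh (L : R) : measurable_fun setT (fun t : R => (2 * L * sinh t)%:E).
Proof.
by apply/measurable_EFinP; apply: measurable_funM => //; exact: measurable_sinh.
Qed.

Lemma mass_le S (L K : R) : measurable S -> 0 <= L -> 0 <= K ->
  (forall t : R, (0 < t <= C)%R -> harea (ysection S t) <= (2 * sinh t * L + K)%:E)%E ->
  (mass S <= (2 * mean_sinh * L + K)%:E)%E.
Proof.
move=> mS L0 K0 H; rewrite mass_restrict//.
have mh := measurable_harea_ysection mS.
apply: (@le_trans _ _ (\int[nu]_(t in `]0%R, C]) ((2 * L * sinh t)%:E + K%:E))%E).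
  apply: ge0_le_integral => //.
  - by move=> t _; exact: harea_ge0.
  - exact: measurable_funTS.
  - by apply: measurable_funTS; apply: emeasurable_funD.
  move=> t /=; rewrite in_itv/= => It; apply: le_trans (H _ It) _.
  by rewrite -EFinD lee_fin; lra.
rewrite ge0_integralD//; last 2 first.
- move=> t /=; rewrite in_itv/= => /andP[t0 _]; rewrite lee_fin.
  by apply: mulr_ge0; [exact: mulr_ge0|exact/sinh_ge0/ltW].
- exact: measurable_funTS.
rewrite integral_cst//= radii_set1 mule1.
under eq_integral do rewrite EFinM.
rewrite ge0_integralZl//; last 3 first.
- by apply: measurable_funTS; apply/measurable_EFinP; exact: measurable_sinh.
- by move=> t /=; rewrite in_itv/= => /andP[t0 _]; rewrite lee_fin sinh_ge0// ltW.
- by rewrite lee_fin mulr_ge0.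
by rewrite -mean_sinhE -EFinM -EFinD lee_fin; lra.
Qed.

(** [L] may have any sign: it will be the logarithm of a ratio that can be less than 1. *)
Lemma mass_ge S (L : R) : measurable S ->
  (forall t : R, (0 < t <= C)%R -> (2 * sinh t * L)%:E <= harea (ysection S t) + 2%:E)%E ->
  ((2 * mean_sinh * L)%:E <= mass S + 2%:E)%E.
Proof.
move=> mS H.
have mass0 : (0 <= mass S)%E by apply: integral_ge0 => t _; exact: harea_ge0.
have [L0|L0] := leP L 0.
  apply: (@le_trans _ _ 0%E); last by rewrite adde_ge0// lee_fin.
  by rewrite lee_fin mulr_ge0_le0// mulr_ge0// mean_sinh_ge0.
rewrite mass_restrict//.
have mh := measurable_harea_ysection mS.
apply: (@le_trans _ _ (\int[nu]_(t in `]0%R, C]) (harea (ysection S t) + 2%:E))%E).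
  have -> : ((2 * mean_sinh * L)%:E = \int[nu]_(t in `]0%R, C]) (2 * L * sinh t)%:E)%E.
    under eq_integral do rewrite EFinM.
    rewrite ge0_integralZl//; last 3 first.
    - by apply: measurable_funTS; apply/measurable_EFinP; exact: measurable_sinh.
    - by move=> t /=; rewrite in_itv/= => /andP[t0 _]; rewrite lee_fin sinh_ge0// ltW.
    - by rewrite lee_fin mulr_ge0// ltW.
    by rewrite -mean_sinhE -EFinM; congr (_%:E); ring.
  apply: ge0_le_integral => //.
  - move=> t /=; rewrite in_itv/= => /andP[t0 _]; rewrite lee_fin.
    by apply: mulr_ge0; [apply: mulr_ge0 => //; exact: ltW|exact/sinh_ge0/ltW].
  - exact: measurable_funTS.
  - by apply: measurable_funTS; apply: emeasurable_funD.
  move=> t /=; rewrite in_itv/= => It; apply: le_trans (H _ It).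
  by rewrite lee_fin; lra.
rewrite ge0_integralD//; last 2 first.
- by move=> t _; exact: harea_ge0.
- exact: measurable_funTS.
by rewrite integral_cst//= radii_set1 mule1.
Qed.

End mean.

(** * Obstacles of a segment and their mass *)

Section blockers.
Context (R : realType) (C : R).
Hypothesis C1 : 1 <= C.
Local Notation leb := (@lebesgue_measure R).
Local Notation leb2 := (leb \x leb)%E.
Implicit Types (z : R * R) (r s t theta th W k : R) (p : R * R * R).

Let C0 : 0 <= C. Proof. by rewrite (le_trans _ C1). Qed.

(** A height above which 8 sinh C and 2 cosh C are both dominated, as [angle_of_meets] asks; the
    first is also what the shadows ask of [w0]. *)
Definition core : R := 8 * sinh C + 2 * cosh C.

Lemma core_ge2 : 2 <= core.
Proof.
by have := sinh_ge0 C0; have := cosh_ge1 C; rewrite /core; lra.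
Qed.

Let core_gt1 : 1 < core. Proof. by have := core_ge2; lra. Qed.
Let core_gt0 : 0 < core. Proof. by have := core_ge2; lra. Qed.

Let core_sinh : 8 * sinh C <= core.
Proof. by have := cosh_ge1 C; rewrite /core; lra. Qed.

Let sinhC0 : 0 <= sinh C. Proof. exact: sinh_ge0. Qed.

(* Marked points whose ball crosses every segment of length r in a direction
   within [W^-1] of [theta], for any r with [W <= cosh r]; see [blk_hit]. *)
Definition blk W theta : set (R * R * R) :=
  [set p : R * R * R | [/\ 0 < p.1.1, 0 < p.2 <= C, hplane p.1 &
               shadow core W theta (sinh p.2) (hpolar p.1)]].

Let mfst : measurable_fun setT (fun p : R * R * R => p.1). Proof. exact: measurable_fst. Qed.
Let msnd : measurable_fun setT (fun p : R * R * R => p.2). Proof. exact: measurable_snd. Qed.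
Let mfst1 : measurable_fun setT (fun p : R * R * R => p.1.1).
Proof. by apply: (measurableT_comp measurable_fst mfst). Qed.
Let mfst2 : measurable_fun setT (fun p : R * R * R => p.1.2).
Proof. by apply: (measurableT_comp measurable_snd mfst). Qed.

Let mradius : measurable [set p : R * R * R | 0 < p.2 <= C].
Proof.
rewrite (_ : mkset _ = [set p : R * R * R | 0 < p.2] `&` [set p : R * R * R | p.2 <= C]).
  by apply: measurableI; [exact: (measurable_set_ltr (f := fun=> 0))|
    exact: (measurable_set_ler (g := fun=> C))].
by apply/seteqP; split=> p /=; [move/andP|move=> ?; apply/andP].
Qed.

Let mplane : measurable [set p : R * R * R | hplane p.1].
Proof.
by apply: (measurable_preimageT (B := @hplane R) mfst); exact: measurable_hplane.
Qed.

Lemma measurable_blk W theta : measurable (blk W theta).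
Proof.
have mw : measurable_fun setT (fun p : R * R * R => hcosh p.1).
  exact: (measurableT_comp (@measurable_hcosh R) mfst).
have ma : measurable_fun setT (fun p : R * R * R => angle p.1).
  have h : measurable_fun setT (fun p : R * R * R => (hpolar p.1).2).
    by apply: (measurableT_comp measurable_snd); exact: (measurableT_comp (@measurable_hpolar R) mfst).
  exact: h.
rewrite (_ : blk W theta = [set p : R * R * R | 0 < p.1.1] `&` [set p : R * R * R | 0 < p.2 <= C] `&`
   [set p : R * R * R | hplane p.1] `&` ([set p : R * R * R | core <= hcosh p.1] `&` [set p : R * R * R | hcosh p.1 <= W] `&`
   [set p : R * R * R | `|angle p.1 - theta| <= sinh p.2 / hcosh p.1 - W^-1])).
  apply: measurableI; last apply: measurableI.
  - apply: measurableI => //; apply: measurableI => //.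
    exact: (measurable_set_ltr (f := fun=> 0)).
  - apply: measurableI; first exact: (measurable_set_ler (f := fun=> core)).
    exact: (measurable_set_ler (g := fun=> W)).
  apply: measurable_set_ler.
    by apply: measurableT_comp => //; apply: measurable_funB.
  apply: measurable_funB => //; apply: measurable_funM.
    exact: (measurableT_comp (@measurable_sinh R) msnd).
  exact: measurable_funV.
apply/seteqP; split=> p /=.
  by move=> [p1 p2 p3 [/andP[p4 p5] p6]].
by move=> [[[p1 p2] p3] [[p4 p5] p6]]; split=> //; split=> //; apply/andP.
Qed.

Lemma harea_hpolar (A S : set (R * R)) : measurable S ->
  A `&` @hplane R = ([set z : R * R | 0 < z.1] `&` @hpolar R @^-1` S) `&` @hplane R ->
  harea A = leb2 (S `&` @strip R).
Proof. by move=> mS AS; rewrite -harea_hplane AS harea_hplane harea_polar. Qed.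

Lemma harea_blk W theta t : 0 < t <= C ->
  harea (ysection (blk W theta) t) = leb2 (shadow core W theta (sinh t) `&` @strip R).
Proof.
move=> It; apply: harea_hpolar; first exact: measurable_shadow.
apply/seteqP; split=> z /=; rewrite /ysection/= inE.
  by move=> [[z1 _ z3 z4] _].
by move=> [[z1 z2] z3].
Qed.

Lemma harea_blkD W th1 th2 t : 0 < t <= C ->
  harea (ysection (blk W th2 `\` blk W th1) t) =
  leb2 ((shadow core W th2 (sinh t) `\` shadow core W th1 (sinh t)) `&` @strip R).
Proof.
move=> It; apply: harea_hpolar.
  by apply: measurableD; exact: measurable_shadow.
apply/seteqP; split=> z /=; rewrite /ysection/= inE.
  move=> [[[z1 _ z3 z4] n] _]; split=> //; split=> //; split=> // z5; apply: n.
  by split.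
by move=> [[z1 [z2 n]] z3]; split=> //; split=> // -[].
Qed.

Let sinhI t : 0 < t <= C -> 0 <= sinh t <= sinh C.
Proof. by move=> /andP[t0 tC]; rewrite sinh_ge0 ?le_sinh// ltW. Qed.

Context (nu : probability R R).
Hypothesis nuC : nu (~` `]0, C]) = 0%E.
Let E := mean_sinh nu.

Lemma mass_blk_ge W theta : core <= W -> `|theta| <= pi / 4 + 8^-1 ->
  ((2 * E * ln (W / core))%:E <= mass nu (blk W theta) + 2%:E)%E.
Proof.
move=> cW th; apply: (mass_ge nuC); first exact: measurable_blk.
move=> t It; rewrite harea_blk//.
by apply: (shadow_area_ge core_sinh core_gt1 cW) => //; exact: sinhI.
Qed.

Lemma mass_blkD_ge W th1 th2 k : core <= W -> `|th2| <= pi / 4 + 8^-1 ->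
  1 <= k <= 3 * W -> th2 - th1 = k / W ->
  ((2 * E * ln (k / (3 * core)))%:E <= mass nu (blk W th2 `\` blk W th1) + 2%:E)%E.
Proof.
move=> cW th kW dth; apply: (mass_ge nuC).
  by apply: measurableD; exact: measurable_blk.
move=> t It; rewrite harea_blkD//.
by apply: (shadow_diff_area_ge (H := sinh C)) => //; exact: sinhI.
Qed.

Lemma mass_blkD_le W th1 th2 k : core <= W -> 1 <= k -> th2 - th1 = k / W ->
  (mass nu (blk W th2 `\` blk W th1) <= (2 * E * ln k + 1)%:E)%E.
Proof.
move=> cW k1 dth; apply: (mass_le nuC); rewrite ?ln_ge0//.
  by apply: measurableD; exact: measurable_blk.
move=> t It; rewrite harea_blkD//.
by apply: (shadow_diff_area_le core_gt1 cW (sinhI It)).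
Qed.

(** Expressed through the foot to be visibly measurable; [hitP] gives back the geometric meaning. *)
Definition hit r theta : set (R * R * R) :=
  [set p : R * R * R | [/\ hplane p.1, 0 < p.2 <= C &
               ray_quad p.1 p.2 theta (ray_foot p.1 p.2 theta r) <= 0]].

Lemma hitP r theta z s : hplane z -> 0 < s <= C -> 0 <= r ->
  hit r theta (z, s) <-> hball z s `&` hsegment r theta !=set0.
Proof.
move=> hz /[dup] sC /andP[s0 _] r0; rewrite hball_meets_hsegment ?(ltW s0)//.
by rewrite ray_quad_foot// /hit/=; split=> [[]|].
Qed.

Lemma measurable_hit r theta : measurable (hit r theta).
Proof.
have mn : measurable_fun setT (fun p : R * R * R => sqnorm p.1).
  exact: (measurableT_comp (@measurable_sqnorm R) mfst).
have mal : measurable_fun setT (fun p : R * R * R => along theta p.1).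
  by apply: measurable_funD; apply: measurable_funM.
have mk : measurable_fun setT (fun p : R * R * R => (cosh p.2 - 1) * (1 - sqnorm p.1)).
  apply: measurable_funM; last exact: measurable_funB.
  by apply: measurable_funB => //; exact: (measurableT_comp (@measurable_cosh R) msnd).
have mf : measurable_fun setT (fun p : R * R * R => ray_foot p.1 p.2 theta r).
  apply: measurable_minr => //; apply: measurable_maxr => //.
  apply: measurable_funM; first exact: measurable_funM.
  by apply: measurable_funV; exact: measurable_funD.
rewrite (_ : hit r theta = [set p : R * R * R | hplane p.1] `&` [set p : R * R * R | 0 < p.2 <= C] `&`
  [set p : R * R * R | ray_quad p.1 p.2 theta (ray_foot p.1 p.2 theta r) <= 0]).
  apply: measurableI; first exact: measurableI.
  apply: (measurable_set_ler (g := fun=> 0)) => //.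
  apply: measurable_funB => //; apply: measurable_funD; last exact: measurable_funM.
  apply: measurable_funB; apply: measurable_funM => //.
  - exact: measurable_funD.
  - exact: measurable_funX.
  - exact: measurable_funM.
by apply/seteqP; split=> p /=; [move=> []|move=> [[]]].
Qed.

Lemma hit_hcosh_le r theta z s : 0 <= r -> hit r theta (z, s) ->
  hcosh z <= cosh C * expR r.
Proof.
move=> r0 h; have [/= hz sC _] := h; have H := (hitP theta hz sC r0).1 h.
by case/andP: sC => s0 sC; apply: hcosh_of_meets H => //; rewrite ltW.
Qed.

(** The margin [W^-1] of the shadow pays for the change of direction, and W <= cosh r keeps the foot
    of the perpendicular on the segment. *)
Lemma blk_hit W theta theta' r z s : 0 <= r -> 0 < W -> W <= cosh r ->
  `|theta' - theta| <= W^-1 -> blk W theta (z, s) -> hit r theta' (z, s).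
Proof.
move=> r0 W0 Wr dth [/= z1 sC hz [/andP[/= cw wW] aw]].
have w0 : 0 < hcosh z by exact: lt_le_trans cw.
have s0 : 0 <= s by case/andP: sC => /ltW.
have d1 : `|angle z - theta'| <= sinh s / hcosh z.
  rewrite (_ : angle z - theta' = (angle z - theta) - (theta' - theta)); last ring.
  by rewrite (le_trans (ler_normB _ _))//; move: aw dth; rewrite /angle; lra.
apply/hitP => //; apply: meets_of_angle => //; first exact: le_trans Wr.
rewrite (le_trans d1)// ler_pdivrMr//.
have S1 : sinh s <= sinh C by apply: le_sinh; case/andP: sC.
have c8 := core_sinh; have := pi_ge2 R => pi2.
have : 1 * hcosh z <= pi / 2 * hcosh z by rewrite ler_pM2r//; lra.
lra.
Qed.

Definition hit_cst : R := 4 * (core + 1) ^+ 2 + sinh C * cosh C ^+ 2.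

Lemma harea_hit_le r theta t : 0 <= r -> 0 <= theta <= 2^-1 -> 0 < t <= C ->
  (harea (ysection (hit r theta) t) <= (2 * sinh t * (r + ln (cosh C)) + hit_cst)%:E)%E.
Proof.
move=> r0 th It; have S0 : 0 <= sinh t by case/andP: (sinhI It).
set K := sinh C * cosh C ^+ 2.
have K0 : 0 <= K by rewrite mulr_ge0// sqr_ge0.
have Cc1 := cosh_ge1 C; have Cc0 := cosh_gt0 C.
have er0 := expR_gt0 r.
(* A bound on the height of all obstacles, enlarged by the factor [core] so that ln W - ln [core] is
   exactly r + ln (cosh C). *)
pose W := core * (cosh C * expR r).
have e1 : 1 <= expR r by rewrite -expR0 ler_expR.
have ce1 : 1 <= cosh C * expR r by rewrite mulr_ege1.
have cW : core <= W by rewrite ler_peMr// ltW.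
have W0 : 0 < W by exact: lt_le_trans cW.
pose arc (w : R) := sinh t / w + K / w ^+ 3.
pose T : set (R * R) := [set z : R * R | core <= z.1] `&` [set z : R * R | z.1 <= W] `&`
   [set z : R * R | `|z.2 - theta| <= arc z.1].
have m1 : measurable_fun setT (fun z : R * R => z.1) by exact: measurable_fst.
have mT : measurable T.
  apply: measurableI; first apply: measurableI.
  - exact: (measurable_set_ler (f := fun=> core)).
  - exact: (measurable_set_ler (g := fun=> W)).
  apply: measurable_set_ler.
    by apply: measurableT_comp => //; apply: measurable_funB => //; exact: measurable_snd.
  apply: measurable_funD; apply: measurable_funM => //; apply: measurable_funV => //.
  exact: measurable_funX.
have mB1 : measurable [set z : R * R | hcosh z <= core].
  by apply: (measurable_set_ler (g := fun=> core)) => //; exact: measurable_hcosh.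
have mB2 : measurable ([set z : R * R | 0 < z.1] `&` @hpolar R @^-1` T).
  apply: measurableI; first exact: (measurable_set_ltr (f := fun=> 0)).
  by apply: measurable_preimageT => //; exact: measurable_hpolar.
have mS : measurable (ysection (hit r theta) t).
  by apply: measurable_ysection; exact: measurable_hit.
apply: (@le_trans _ _ (harea ([set z : R * R | hcosh z <= core] `|`
    ([set z : R * R | 0 < z.1] `&` @hpolar R @^-1` T)))%R).
  apply: le_harea => //; first exact: measurableU.
  move=> z /= [+ hz]; rewrite /ysection/= inE => h.
  have hmeet := (hitP theta hz It r0).1 h.
  have [wc|/ltW wc] := leP (hcosh z) core; [by left|right].
  have It' : 0 <= t <= C by case/andP: It => /ltW ->.
  have c2 : 2 * cosh C <= core by rewrite /core; have := sinhC0; lra.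
  have [z1 wr az] := angle_of_meets hz It' r0 th (le_trans c2 wc)
    (le_trans core_sinh wc) hmeet.
  split=> //; split; last exact: az.
  split=> //=; apply: (le_trans wr); rewrite /W ler_peMl//; last exact: ltW.
  by rewrite mulr_ge0// ltW.
apply: (le_trans (harea_setU_le mB1 mB2)).
have -> : 2 * sinh t * (r + ln (cosh C)) + hit_cst =
    4 * (core + 1) ^+ 2 + (2 * sinh t * (r + ln (cosh C)) + K) by rewrite /hit_cst -/K; ring.
rewrite harea_polar// EFinD; apply: leeD.
  by apply: harea_disc_le; exact: ltW.
pose F (w : R) := 2 * sinh t * ln w - K * (w ^+ 2)^-1.
apply: (@le_trans _ _ (F W - F core)%:E).
  apply: (area_le (f := fun w => theta - arc w) (u := fun w => 2 * arc w) (F := F) cW).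
  - by apply: measurableI => //; apply: measurableX; exact: measurable_itv.
  - move=> z [[[/= zc zW] zt] _]; rewrite zc zW; split=> //.
    by move: zt; rewrite ler_norml => /andP[]; lra.
  - move=> w /andP[cw _]; have w0 : 0 < w by exact: lt_le_trans cw.
    by rewrite /arc mulr_ge0// addr_ge0// divr_ge0 ?exprn_ge0// ltW.
  - move=> w /andP[cw _]; have w0 : 0 < w by exact: lt_le_trans cw.
    have dl := is_derive1_ln w0.
    have d2 : is_derive w (1 : R) (fun w : R => w ^+ 2) (2 * w).
      by apply: is_derive_eq; rewrite /GRing.scale/=; ring.
    have w20 : w ^+ 2 != 0 by rewrite expf_neq0// gt_eqF.
    have dV := is_deriveV (f := fun w : R => w ^+ 2) w20 d2.
    apply: is_derive_eq; rewrite /GRing.scale/= /arc.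
    by field; rewrite gt_eqF.
  - move=> w /andP[cw _]; have w0 : 0 < w by exact: lt_le_trans cw.
    apply: continuousM; first exact: cst_continuous.
    apply: continuousD; first exact: continuous_div.
    apply: continuousM; first exact: cst_continuous.
    by apply: continuousV; [rewrite expf_neq0// gt_eqF|exact: exprn_continuous].
rewrite lee_fin /F.
have -> : ln W = ln core + (ln (cosh C) + r).
  have -> : ln W = ln core + ln (cosh C * expR r).
    by apply: lnM; rewrite posrE// mulr_gt0.
  have -> : ln (cosh C * expR r) = ln (cosh C) + ln (expR r) by apply: lnM; rewrite posrE.
  by rewrite expRK.
have h1 : 0 <= K * (W ^+ 2)^-1 by rewrite mulr_ge0// invr_ge0 exprn_ge0// ltW.
have h2 : K * (core ^+ 2)^-1 <= K.
  by rewrite ler_piMr// invf_le1 ?exprn_gt0// exprn_ege1// ltW.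
lra.
Qed.

Lemma mass_hit_le r theta : 0 <= r -> 0 <= theta <= 2^-1 ->
  (mass nu (hit r theta) <= (2 * E * (r + ln (cosh C)) + hit_cst)%:E)%E.
Proof.
move=> r0 th; apply: (mass_le nuC).
- exact: measurable_hit.
- by rewrite addr_ge0// ln_ge0// cosh_ge1.
- by apply: addr_ge0; apply: mulr_ge0 => //; exact: sqr_ge0.
- by move=> t It; exact: harea_hit_le.
Qed.

End blockers.

(** * Additivity and finiteness of the mass *)

Section mass_additive.
Context (R : realType) (nu : probability R R).
Implicit Types S T : set (R * R * R).

(** Centres in a disc about the origin: this gives the finite area required by [void_probability],
    and a finite mass. *)
Definition hbounded S := exists2 B : R, 1 <= B & forall x t, S (x, t) -> hcosh x <= B.

Lemma hboundedS S T : S `<=` T -> hbounded T -> hbounded S.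
Proof. by move=> ST [B B1 TB]; exists B => // x t /ST /TB. Qed.

Lemma hboundedU S T : hbounded S -> hbounded T -> hbounded (S `|` T).
Proof.
move=> [B B1 SB] [B' B'1 TB]; exists (Num.max B B'); first by rewrite le_max B1.
by move=> x t [/SB|/TB]; rewrite le_max => ->; rewrite ?orbT.
Qed.

Lemma measurable_hcosh_le (B : R) : measurable [set z : R * R | hcosh z <= B].
Proof. by apply: (measurable_set_ler (g := fun=> B)) => //; exact: measurable_hcosh. Qed.

Lemma mass_ge0 S : (0 <= mass nu S)%E.
Proof. by apply: integral_ge0 => t _; exact: harea_ge0. Qed.

Lemma mass_fin_num S : measurable S -> hbounded S -> mass nu S \is a fin_num.
Proof.
move=> mS [B B1 SB]; rewrite ge0_fin_numE ?mass_ge0//.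
apply: (@le_lt_trans _ _ (\int[nu]_t (4 * (B + 1) ^+ 2)%:E)%E).
  apply: ge0_le_integral => //.
  - by move=> t _; exact: harea_ge0.
  - exact: measurable_harea_ysection.
  move=> t _; apply: le_trans (harea_disc_le B1); apply: le_harea.
  - exact: measurable_ysection.
  - exact: measurable_hcosh_le.
  - by move=> z [+ _]; rewrite /ysection/= inE => /SB.
by rewrite integral_cst//= probability_setT mule1 ltry.
Qed.

Lemma harea_hintegral (A : set (R * R)) : measurable A ->
  harea A = hintegral (\1_A : _ -> R).
Proof.
move=> mA; rewrite -[LHS]mul1e -hintegral_indic//.
by congr hintegral; apply/funext => z; rewrite mul1r.
Qed.

Lemma mass_setU S T : measurable S -> measurable T -> S `&` T = set0 ->
  mass nu (S `|` T) = (mass nu S + mass nu T)%E.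
Proof.
move=> mS mT ST; rewrite /mass -ge0_integralD//; last 4 first.
- by move=> t _; exact: harea_ge0.
- exact: measurable_harea_ysection.
- by move=> t _; exact: harea_ge0.
- exact: measurable_harea_ysection.
apply: eq_integral => t _.
have mSt : measurable (ysection S t) by exact: measurable_ysection.
have mTt : measurable (ysection T t) by exact: measurable_ysection.
have mU : measurable (S `|` T) by exact: measurableU.
have mUt : measurable (ysection (S `|` T) t) by exact: measurable_ysection.
rewrite !harea_hintegral// -hintegralD//; try exact: measurable_indic.
congr hintegral; apply/funext => z; rewrite !indicE !mem_ysection in_setU.
have [zS|] := boolP ((z, t) \in S); last by rewrite add0r.
have [zT|] := boolP ((z, t) \in T); last by rewrite addr0.
have : (S `&` T) (z, t) by split; rewrite -in_setE.
by rewrite ST.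
Qed.

End mass_additive.

(** * First and second moment bounds *)

Section second_moment.
Context (R : realType) (d : measure_display) (Om : measurableType d)
  (P : probability Om R).

Definition prob (A : set Om) : R := fine (P A).

Lemma probE A : measurable A -> (prob A)%:E = P A.
Proof. by move=> mA; rewrite fineK// fin_num_measure. Qed.

Lemma prob_ge0 A : 0 <= prob A.
Proof. exact: fine_ge0. Qed.

Lemma le_prob A B : measurable A -> measurable B -> A `<=` B -> prob A <= prob B.
Proof. by move=> mA mB AB; rewrite -lee_fin !probE// le_measure ?inE. Qed.

Lemma probD A B : measurable A -> measurable B -> B `<=` A ->
  prob (A `\` B) = prob A - prob B.
Proof.
move=> mA mB BA; apply: EFin_inj; rewrite EFinB !probE//; last exact: measurableD.
rewrite measureD ?setIidr//; rewrite ltey_eq fin_num_measure//.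
Qed.

Lemma prob_setU A B : measurable A -> measurable B -> A `&` B = set0 ->
  prob (A `|` B) = prob A + prob B.
Proof.
move=> mA mB AB; apply: EFin_inj; rewrite EFinD !probE//; last exact: measurableU.
exact: measureU.
Qed.

Lemma prob_setU_le A B : measurable A -> measurable B ->
  prob (A `|` B) <= prob A + prob B.
Proof.
move=> mA mB; rewrite -lee_fin EFinD !probE//; last exact: measurableU.
exact: measureU2.
Qed.

Lemma integral_count (I : Type) (s : seq I) (V : I -> set Om) :
  (forall i, measurable (V i)) ->
  (\int[P]_w (\sum_(i <- s) \1_(V i) w)%:E = (\sum_(i <- s) prob (V i))%:E)%E.
Proof.
move=> mV; under eq_integral do rewrite -sumEFin.
rewrite ge0_integral_sum//.
  2: by move=> i; apply/measurable_EFinP; exact: measurable_indic.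
rewrite -sumEFin; apply: eq_bigr => i _.
by rewrite integral_indic// setIT probE.
Qed.

(* The second moment method: E[N]^2 <= P(N > 0) E[N^2]. *)
Lemma second_moment (n : nat) (V : nat -> set Om) (U : set Om) :
  (forall i, measurable (V i)) -> measurable U ->
  (forall i, (i < n)%N -> V i `<=` U) ->
  0 < \sum_(i < n) prob (V i) ->
  (\sum_(i < n) prob (V i)) ^+ 2 <=
    prob U * \sum_(i < n) \sum_(j < n) prob (V i `&` V j).
Proof.
move=> mV mU VU S1; set s1 := \sum_(i < n) prob (V i) in S1 *.
set s2 := \sum_(i < n) \sum_(j < n) _.
have s12 : s1 <= s2.
  apply: ler_sum => i _; rewrite (bigD1 i)//= setIid lerDl.
  by apply: sumr_ge0 => j _; exact: prob_ge0.
have s20 : 0 < s2 by exact: lt_le_trans s12.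
pose N w : R := \sum_(i < n) \1_(V i) w.
have mN : measurable_fun setT N.
  by apply: measurable_sum => i; exact: measurable_indic.
have EN : (\int[P]_w (N w)%:E = s1%:E)%E by rewrite integral_count.
have EN2 : (\int[P]_w (N w ^+ 2)%:E = s2%:E)%E.
  rewrite /s2 pair_big/= -(@integral_count _ _ (fun p : 'I_n * 'I_n => V p.1 `&` V p.2)); last first.
    by move=> p; exact: measurableI.
  apply: eq_integral => w _; congr (_%:E); rewrite expr2 /N mulr_suml.
  under eq_bigr do rewrite mulr_sumr.
  rewrite pair_big/=; apply: eq_bigr => p _; rewrite !indicE in_setI.
  by case: (_ \in _); rewrite ?mul1r ?mul0r.
have EU : (\int[P]_w (\1_U w)%:E = (prob U)%:E)%E by rewrite integral_indic// setIT probE.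
(* Integrate (N - t 1_U)^2 >= 0, where N vanishes off [U]. *)
have key t : 0 <= t -> 2 * t * s1 <= s2 + t ^+ 2 * prob U.
  move=> t0; rewrite -lee_fin EFinD (EFinM (2 * t)) (EFinM (t ^+ 2)) -EN -EN2 -EU.
  rewrite -ge0_integralZl//; last 3 first.
  - by apply/measurable_EFinP.
  - by move=> w _; rewrite lee_fin sumr_ge0.
  - by rewrite lee_fin mulr_ge0.
  rewrite -ge0_integralZl//; last 2 first.
  - by apply/measurable_EFinP; exact: measurable_indic.
  - by rewrite lee_fin exprn_ge0.
  rewrite -ge0_integralD//; last 4 first.
  - by move=> w _; rewrite lee_fin exprn_ge0// sumr_ge0.
  - by apply/measurable_EFinP; exact: measurable_funX.
  - by move=> w _; rewrite -EFinM lee_fin mulr_ge0// exprn_ge0.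
  - by apply: measurable_funeM; apply/measurable_EFinP; exact: measurable_indic.
  apply: ge0_le_integral => //.
  - by move=> w _; rewrite -EFinM lee_fin !mulr_ge0// sumr_ge0.
  - by apply: measurable_funeM; apply/measurable_EFinP.
  - apply: emeasurable_funD.
      by apply/measurable_EFinP; exact: measurable_funX.
    by apply: measurable_funeM; apply/measurable_EFinP; exact: measurable_indic.
  move=> w _; rewrite -!EFinM -EFinD lee_fin indicE.
  have [wU|wU] := boolP (w \in U); first by rewrite mulr1; have := sqr_ge0 (N w - t); lra.
  suff -> : N w = 0 by rewrite mulr0 expr0n/= mulr0 addr0.
  rewrite /N big1// => i _; rewrite indicE memNset// => /(VU _ (ltn_ord i)) Uw.
  by move/negP: wU; apply; rewrite inE.
(* In the case of equality this is the optimal t = s1 / P(U); it is used because it does not divide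
   by P(U). *)
have := key (s2 / s1) (divr_ge0 (ltW s20) (ltW S1)).
have -> : 2 * (s2 / s1) * s1 = 2 * s2 by field; rewrite gt_eqF.
move=> H; have : s2 * s1 ^+ 2 <= s2 * (prob U * s2).
  have H2 : s2 <= (s2 / s1) ^+ 2 * prob U by lra.
  rewrite -(@ler_pM2r _ (s1 ^+ 2)) ?exprn_gt0// in H2.
  apply: (le_trans H2); rewrite le_eqVlt; apply/orP; left; apply/eqP.
  by field; rewrite gt_eqF.
by rewrite ler_pM2l.
Qed.

End second_moment.

Section avoid.
Context (R : realType) (d : measure_display) (Om : measurableType d)
  (P : probability Om R) (X : nat -> {RV P >-> (R * R)%type})
  (rho : nat -> {RV P >-> R}).
Variables (lam : R) (nu : probability R R) (lam_gt0 : 0 < lam)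
  (BM : poisson_boolean_model lam nu X rho).
Implicit Types (S T A B : set (R * R * R)).

Let av := avoids X rho.
Let p := @prob R d Om P.
Let pD (A B : set Om) : measurable A -> measurable B -> B `<=` A ->
  p (A `\` B) = p A - p B := @probD R d Om P A B.
Let pU (A B : set Om) : measurable A -> measurable B -> A `&` B = set0 ->
  p (A `|` B) = p A + p B := @prob_setU R d Om P A B.

Lemma avoids_setU S T : av (S `|` T) = av S `&` av T.
Proof.
apply/seteqP; split=> w /=.
  by move=> H; split=> n Sn; apply: (H n); [left|right].
by move=> [HS HT] n [/HS|/HT].
Qed.

Lemma prob_avoids S : measurable S -> hbounded S ->
  p (av S) = expR (- (lam * fine (mass nu S))).
Proof.
move=> mS [B B1 SB].
rewrite /p /prob (void_probability lam_gt0 BM mS (measurable_hcosh_le B) _ SB).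
  by rewrite /= hintegral_mark_prob.
exact: le_lt_trans (harea_disc_le B1) (ltry _).
Qed.

Let mav S : measurable S -> measurable (av S).
Proof. exact: measurable_avoids. Qed.

(** Masses of disjoint sets add, so void probabilities multiply. This is the independence of the
    marked process on disjoint sets, obtained from void probabilities alone. *)
Lemma prob_avoids_setU S T : measurable S -> measurable T ->
  hbounded S -> hbounded T -> S `&` T = set0 ->
  p (av S `&` av T) = p (av S) * p (av T).
Proof.
move=> mS mT bS bT ST; rewrite -avoids_setU !prob_avoids//; last 2 first.
- exact: measurableU.
- exact: hboundedU.
rewrite mass_setU// fineD ?mass_fin_num// -expRD.
by rewrite mulrDr opprD.
Qed.

Definition some_avoided (A : nat -> set (R * R * R)) (n : nat) : set Om :=
  [set w | exists2 k, (k < n)%N & av (A k) w].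

Lemma measurable_some_avoided (A : nat -> set (R * R * R)) n :
  (forall k, measurable (A k)) -> measurable (some_avoided A n).
Proof.
move=> mA; rewrite (_ : some_avoided A n = \bigcup_(k in `I_n) av (A k)).
  by apply: bigcup_measurable => k _; exact: mav.
by apply/seteqP; split=> w [k kn Ak]; exists k.
Qed.

Lemma some_avoidedS (A : nat -> set (R * R * R)) n :
  some_avoided A n.+1 = some_avoided A n `|` av (A n).
Proof.
apply/seteqP; split=> w /=.
  by move=> [k]; rewrite ltnS leq_eqVlt => /predU1P[->|kn] Ak; [right|left; exists k].
by move=> [[k kn Ak]|An]; [exists k => //; exact: ltnW|exists n].
Qed.

(** Inclusion-exclusion: forbidding the avoidance of one more set [A n] subtracts an event of the
    same kind with [S] enlarged by [A n]. The induction therefore needs every [S]. *)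
Lemma avoids_indep (A : nat -> set (R * R * R)) B n :
  (forall k, measurable (A k)) -> (forall k, hbounded (A k)) ->
  measurable B -> hbounded B -> (forall k, (k < n)%N -> A k `&` B = set0) ->
  forall S, measurable S -> hbounded S -> S `&` B = set0 ->
  p (av B `&` (av S `\` some_avoided A n)) =
  p (av B) * p (av S `\` some_avoided A n).
Proof.
move=> mA bA mB bB; elim: n => [|n IH] AB S mS bS SB.
  have -> : some_avoided A 0 = set0 by apply/seteqP; split=> w //= [].
  by rewrite setD0 prob_avoids_setU// setIC.
have IH' := IH (fun k kn => AB k (ltnW kn)).
have mU k := measurable_some_avoided k mA.
have -> : av S `\` some_avoided A n.+1 =
    (av S `\` some_avoided A n) `\` (av (S `|` A n) `\` some_avoided A n).
  rewrite some_avoidedS avoids_setU; apply/seteqP; split=> w /=.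
    move=> [Sw nU]; split; first by split=> // Uw; apply: nU; left.
    by move=> [[_ Aw] _]; apply: nU; right.
  move=> [[Sw nU] H]; split=> // -[//|Aw]; apply: H; split=> //.
have mSA : measurable (S `|` A n) by exact: measurableU.
have mF1 : measurable (av S `\` some_avoided A n) by apply: measurableD => //; exact: mav.
have mF2 : measurable (av (S `|` A n) `\` some_avoided A n).
  by apply: measurableD => //; exact: mav.
have F21 : av (S `|` A n) `\` some_avoided A n `<=` av S `\` some_avoided A n.
  by rewrite avoids_setU => w [[Sw _] nU].
rewrite setIDA -{1}[av B]setIid -[X in _ `\` X]setTI.
rewrite (_ : _ `\` _ = (av B `&` (av S `\` some_avoided A n)) `\`
    (av B `&` (av (S `|` A n) `\` some_avoided A n))); last first.
  rewrite setTI setIid; apply/seteqP; split=> w /=.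
    by move=> [[Bw Fw] H]; split=> // -[_ /H].
  by move=> [[Bw Fw] H]; split=> // H2; apply: H.
rewrite [LHS]pD//; last 3 first.
- by apply: measurableI => //; exact: mav.
- by apply: measurableI => //; exact: mav.
- by move=> w [Bw /F21].
have SAB : (S `|` A n) `&` B = set0 by rewrite setIUl SB AB ?setU0.
rewrite [X in _ = _ * X]pD// (IH' _ mS)// (IH' _ mSA) ?mulrBr//.
exact: hboundedU.
Qed.

(* Scanning the arcs in order, the first uncovered one is independent of what
   lies beyond it, because an obstacle meeting both sides would cover it. *)
Lemma cover_bound (D : nat -> set (R * R * R)) (n m : nat) (b : R) :
  (forall i, measurable (D i)) -> (forall i, hbounded (D i)) ->
  (forall k i j, (k < i)%N -> (i < j)%N -> D k `&` D j `<=` D i) ->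
  (forall i, (i < n)%N -> b <= \sum_(k < m) p (av (D (i + k.+1)%N `\` D i))) ->
  b * p (some_avoided D n) <= \sum_(j < n + m) p (av (D j)).
Proof.
move=> mD bD interval Hb.
pose F i := av (D i) `\` some_avoided D i.
have mU k := measurable_some_avoided k mD.
have mF i : measurable (F i) by apply: measurableD => //; exact: mav.
(* [F i] says that i is the first avoided index. Once [D i] is avoided, only the part of [D k]
   outside [D i] counts; by [interval] these parts, like [D i] itself, are disjoint from the part of
   a later [D j] outside [D i]. *)
have FE i : F i = av (D i) `\` some_avoided (fun k => D k `\` D i) i.
  apply/seteqP; split=> w /= [Di H]; split=> // -[k ki Hk]; apply: H; exists k => //.
    move=> q Dq; have [Diq|nDiq] := pselect (D i (X q w, rho q w)).
      exact: (Di q).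
    by apply: (Hk q); split.
  by move=> q [Dq _]; exact: (Hk q).
have FD i j : (i < j)%N -> p (F i `&` av (D j)) = p (F i) * p (av (D j `\` D i)).
  move=> ij.
  have -> : F i `&` av (D j) = av (D j `\` D i) `&` F i.
    apply/seteqP; split=> w /=.
      by move=> [Fi Dj]; split=> // q [Dq _]; exact: (Dj q).
    move=> [Dji [Di nU]]; split=> // q Dq.
    have [Diq|nDiq] := pselect (D i (X q w, rho q w)); first exact: (Di q).
    by apply: (Dji q).
  rewrite mulrC FE; apply: avoids_indep => //.
  - by move=> k; exact: measurableD.
  - by move=> k; exact: hboundedS (@subDsetl _ _ _) (bD k).
  - exact: measurableD.
  - exact: hboundedS (@subDsetl _ _ _) (bD j).
  - move=> k ki; apply/seteqP; split=> q //= [[Dk nDi] [Dj _]].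
    by apply: nDi; exact: interval ki ij _ (conj Dk Dj).
  - by apply/seteqP; split=> q //= [Di [_ nDi]].
have sumF (B : set Om) : measurable B -> forall k, \sum_(i < k) p (F i `&` B) =
    p (some_avoided D k `&` B).
  move=> mB; elim=> [|k IH].
    rewrite big_ord0 (_ : some_avoided D 0 `&` B = set0); first by rewrite /p /prob measure0.
    by apply/seteqP; split=> w //= [[]].
  rewrite big_ord_recr/= IH -pU.
  - congr p; rewrite -setIUl; congr (_ `&` _); rewrite some_avoidedS /F.
    by rewrite setUDr setDv setD0.
  - by apply: measurableI.
  - by apply: measurableI.
  - by apply/seteqP; split=> w //= [[U _] [[_ nU] _]].
have mT : measurable [set: Om] by [].
rewrite -[some_avoided D n]setIT -sumF// mulr_sumr.
(* Every i < n has its m successors below n + m. Afterwards the sum over i is taken first: the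
   events [F i] are disjoint, so it is at most the probability of avoiding [D j]. *)
apply: (@le_trans _ _ (\sum_(i < n) \sum_(j < n + m) p (F i `&` av (D j)))).
  apply: ler_sum => i _.
  apply: (@le_trans _ _ (\sum_(k < m) p (F i `&` av (D (i + k.+1)%N)))).
    rewrite setIT; apply: (@le_trans _ _ ((\sum_(k < m) p (av (D (i + k.+1)%N `\` D i))) * p (F i))).
      by rewrite ler_wpM2r ?prob_ge0// Hb.
    rewrite mulr_suml; apply: ler_sum => k _; rewrite FD; last by rewrite addnS ltnS leq_addr.
    by rewrite [leLHS]mulrC.
  have Hle : (i.+1 + m <= n + m)%N by rewrite leq_add2r.
  rewrite -!(big_mkord xpredT (fun j => p (F i `&` av (D j)))).
  rewrite -(big_mkord xpredT (fun k => p (F i `&` av (D (i + k.+1)%N)))).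
  rewrite (@big_cat_nat _ _ _ i.+1 0 (n + m))//=; last by rewrite (leq_trans (ltn_ord i))// leq_addr.
  rewrite (@big_cat_nat _ _ _ (i.+1 + m) i.+1 (n + m))//=; last exact: leq_addr.
  have -> : \sum_(i.+1 <= j < i.+1 + m) p (F i `&` av (D j)) =
      \sum_(0 <= k < m) p (F i `&` av (D (i + k.+1)%N)).
    rewrite -{1}[i.+1]add0n big_addn [(i.+1 + m)%N]addnC addnK.
    by apply: eq_bigr => k _; rewrite [(k + _)%N]addnC addnS.
  have q0 (I : seq nat) : 0 <= \sum_(j <- I) p (F i `&` av (D j)).
    by apply: sumr_ge0 => j _; exact: prob_ge0.
  by rewrite ler_wpDl// lerDl.
rewrite exchange_big; apply: ler_sum => j _; rewrite sumF; last exact: mav.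
by apply: le_prob; [apply: measurableI => //; exact: mav|exact: mav|exact: subIsetr].
Qed.

End avoid.

(** * Invariance under quarter turns *)

Section rotation.
Context (R : realType).
Local Notation leb := (@lebesgue_measure R).
Implicit Types (z : R * R) (S T : set (R * R * R)).

(* Only directions within pi / 4 of 0 are analysed; quarter turns give the rest. *)
Definition qturn z : R * R := (- z.2, z.1).

Lemma measurable_qturn : measurable_fun setT qturn.
Proof.
apply: measurable_fun_pair => //=.
by apply: measurableT_comp => //; exact: measurable_snd.
Qed.

Lemma sqnorm_qturn z : sqnorm (qturn z) = sqnorm z.
Proof. by rewrite /sqnorm/= sqrrN addrC. Qed.

Lemma along_qturn theta z : along theta (qturn z) = along (theta - pi / 2) z.
Proof. by rewrite /along/= cosBpihalf sinBpihalf; ring. Qed.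

Lemma ge0_integral_opp (g : R -> \bar R) :
  measurable_fun setT g -> (forall y, 0 <= g y)%E ->
  (\int[leb]_y g (- y)%R = \int[leb]_y g y)%E.
Proof.
move=> mg g0.
have mN : measurable_fun setT (-%R : R -> R) by [].
rewrite [RHS](eq_measure_integral (pushforward leb (-%R : R -> measurableTypeR R))); last first.
  by move=> A mA _; symmetry; exact: lebesgue_measureN.
by rewrite ge0_integral_pushforward.
Qed.

(** A quarter turn is a swap of the coordinates, handled by Tonelli, combined with a reflection,
    under which Lebesgue measure on the line is invariant. *)
Lemma harea_qturn (A : set (R * R)) : measurable A -> harea (qturn @^-1` A) = harea A.
Proof.
move=> mA; pose F := (@hdensity R) \_ (A `&` @hplane R).
have mAH : measurable (A `&` @hplane R) by apply: measurableI => //; exact: measurable_hplane.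
have F0 z : (0 <= F z)%E by exact: hdensity_restrict_ge0.
have mF : measurable_fun setT F by exact: measurable_hdensity_restrict.
have mFq : measurable_fun setT (F \o qturn) by apply: measurableT_comp => //; exact: measurable_qturn.
have EA : harea A = (\int[leb \x leb]_z F z)%E by rewrite /harea integral_mkcond.
have -> : harea (qturn @^-1` A) = (\int[leb \x leb]_z F (qturn z))%E.
  rewrite /harea integral_mkcond; apply: eq_integral => z _.
  rewrite /F /patch /= /hdensity sqnorm_qturn.
  congr (if _ then _ else _); apply/idP/idP; rewrite !inE /hplane/= sqnorm_qturn//.
have -> : (\int[leb \x leb]_z F (qturn z) = \int[leb]_x fubini_F leb (F \o qturn) x)%E.
  by rewrite fubini_tonelli1; [|exact: mFq|move=> z; exact: F0].
have -> : harea A = (\int[leb]_x fubini_G leb F x)%E.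
  by rewrite EA fubini_tonelli2; [|exact: mF|exact: F0].
apply: eq_integral => x _ /=.
apply: (ge0_integral_opp (g := fun u => F (u, x))) => //.
by apply: measurableT_comp => //; exact: measurable_pair2.
Qed.

Definition turn S : set (R * R * R) := [set p : R * R * R | S (qturn p.1, p.2)].

Lemma measurable_turn S : measurable S -> measurable (turn S).
Proof.
move=> mS; pose f (p : R * R * R) : R * R * R := (qturn p.1, p.2).
apply: (measurable_preimageT (f := f) _ mS).
apply: measurable_fun_pair => //.
by apply: measurableT_comp; [exact: measurable_qturn|exact: measurable_fst].
Qed.

Lemma mass_turn (nu : probability R R) S : measurable S -> mass nu (turn S) = mass nu S.
Proof.
move=> mS; apply: eq_integral => t _.
rewrite -(harea_qturn (measurable_ysection _ mS)); congr harea.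
Qed.

Lemma hbounded_turn S : hbounded S -> hbounded (turn S).
Proof.
by move=> [B B1 SB]; exists B => // z t /SB; rewrite /hcosh sqnorm_qturn.
Qed.

Lemma turn_hit C r theta : turn (hit C r theta) = hit C r (theta - pi / 2).
Proof.
apply/seteqP; split=> -[z s]; rewrite /turn /hit/= /hplane/=
  /ray_quad /ray_foot sqnorm_qturn along_qturn//.
Qed.

Lemma iter_turn_hit C r theta j :
  iter j turn (hit C r theta) = hit C r (theta - j%:R * (pi / 2)).
Proof.
elim: j => [|j IH]; first by rewrite mul0r subr0.
rewrite iterS IH turn_hit; congr hit; rewrite -natr1; ring.
Qed.

Lemma hit_periodic (C r theta : R) : hit C r (theta + 2 * pi) = hit C r theta.
Proof.
rewrite mulrC mulr_natr; apply/seteqP.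
by split=> -[z s]; rewrite /hit/= /ray_quad /ray_foot /along cosD2pi sinD2pi.
Qed.

Lemma measurable_iter_turn j S : measurable S -> measurable (iter j turn S).
Proof. by move=> mS; elim: j => //= j; exact: measurable_turn. Qed.

Lemma mass_iter_turn (nu : probability R R) j S : measurable S ->
  mass nu (iter j turn S) = mass nu S.
Proof.
move=> mS; elim: j => [//|j IH].
by rewrite iterS (mass_turn nu (measurable_iter_turn j mS)).
Qed.

Lemma hbounded_iter_turn j S : hbounded S -> hbounded (iter j turn S).
Proof. by move=> bS; elim: j => //= j; exact: hbounded_turn. Qed.

Lemma iter_turnS j S T : S `<=` T -> iter j turn S `<=` iter j turn T.
Proof. by move=> ST; elim: j => //= j IH p /IH. Qed.

Lemma iter_turnD j S T : iter j turn (S `\` T) = iter j turn S `\` iter j turn T.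
Proof. by elim: j => //= j ->. Qed.

Lemma iter_turnI j S T : iter j turn (S `&` T) = iter j turn S `&` iter j turn T.
Proof. by elim: j => //= j ->. Qed.

End rotation.

Section ae_sub.
Context (R : realType) (d : measure_display) (Om : measurableType d)
  (P : probability Om R).

Lemma ae_le_prob (U A : set Om) : measurable U -> measurable A ->
  {ae P, forall w, U w -> A w} -> prob P U <= prob P A.
Proof.
move=> mU mA [B [mB PB UAB]].
have pB : prob P B = 0 by rewrite /prob PB.
have mAB : measurable (A `|` B) by exact: measurableU.
apply: (@le_trans _ _ (prob P (A `|` B))).
  apply: le_prob => // w Uw; have [Aw|nAw] := pselect (A w); first by left.
  by right; apply: UAB => /= /(_ Uw).
by rewrite (le_trans (prob_setU_le _ mA mB))// pB addr0.
Qed.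

End ae_sub.

(** * The visibility event *)

Section visible.
Context (R : realType) (d : measure_display) (Om : measurableType d)
  (P : probability Om R) (X : nat -> {RV P >-> (R * R)%type})
  (rho : nat -> {RV P >-> R}).
Variables (lam C : R) (nu : probability R R) (lam_gt0 : 0 < lam)
  (BM : poisson_boolean_model lam nu X rho).
Hypothesis nuC : nu (~` `]0%R, C]%classic) = 0%E.

Let av := avoids X rho.

(** Radii in range and finitely many centres in each disc: for such configurations the events below
    are compared pointwise. *)
Definition good : set Om := [set w | (forall n, 0 < rho n w <= C) /\
  forall m, exists N, forall n, (N <= n)%N -> ~ (hcosh (X n w) <= m%:R)].

Lemma ae_good : {ae P, forall w, good w}.
Proof.
have mI : measurable (~` `]0%R, C]%classic : set R) by exact: measurableC.
have aeR : {ae P, forall w n, 0 < rho n w <= C}.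
  apply: ae_foralln => n; exists (rho n @^-1` (~` `]0%R, C]%classic)); split.
  - by apply: measurable_preimageT.
  - by have := radii_law BM n mI; rewrite /distribution/= /pushforward => ->.
  - by move=> w /= H; rewrite in_itv.
have aeX : {ae P, forall w m, exists k, count_event X [set z | hcosh z <= m.+1%:R] k w}.
  apply: ae_foralln => m.
  apply: (ae_count_event lam_gt0 (boolean_centers BM)); first exact: measurable_hcosh_le.
  by apply: le_lt_trans (harea_disc_le _) (ltry _); rewrite ler1n.
apply: filterS2 aeR aeX => w Rw Xw; split=> // m.
(* With z = 2 the products over the first points freeze at 2^k, whereas a further point in the disc
   would double them. *)
have [k /(@count_event_eventually _ _ _ _ _ _ _ _ 2)[N _ HN]] := Xw m.
exists N => n Nn Hn.
have Hn' : X n w \in [set z | hcosh z <= m.+1%:R].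
  by rewrite inE/= (le_trans Hn)// ler_nat.
have := HN n.+1 (leqW Nn); rewrite /= big_ord_recr/= Hn' (HN n Nn).
by have := exprn_gt0 k (ltr0Sn R 1) => h /eqP; rewrite mulr_natr -subr_eq0 mulr2n addrK gt_eqF.
Qed.

Lemma avoids_visibility w s theta : good w -> 0 <= s ->
  av (hit C s theta) w <->
  forall r, 0 <= r <= s -> hsegment r theta `&` occupied X rho w = set0.
Proof.
move=> [Rw _] s0; have hX n := poisson_in_hplane (boolean_centers BM) n w.
split=> [Hav r /andP[r0 rs]|H n].
  apply: contrapT => /eqP/set0P[z [[[hz zr] zt] [n _ Bz]]].
  apply: (Hav n); apply/hitP => //; exists z; split=> //; split=> //; split=> //.
  exact: le_trans rs.
move=> /(hitP _ (hX n) (Rw n) s0)[z [Bz Sz]].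
have /seteqP[+ _] := H s (introT andP (conj s0 (lexx s))).
by apply; split; [exact: Sz|exists n].
Qed.

Lemma avoids_le_visibility w s theta : good w -> 0 <= s ->
  av (hit C s theta) w -> (s%:E <= visibility (occupied X rho w) theta)%E.
Proof.
move=> Gw s0 /(avoids_visibility _ Gw s0) H; apply: le_ereal_inf_tmp => _ [r [r0 [z Hz]] <-].
rewrite lee_fin leNgt; apply/negP => rs.
by have /seteqP[+ _] := H r (introT andP (conj r0 (ltW rs))); apply; exact: Hz.
Qed.

Lemma visibility_gt_avoids w s theta : good w -> 0 <= s ->
  (s%:E < visibility (occupied X rho w) theta)%E -> av (hit C s theta) w.
Proof.
move=> Gw s0 H; apply/(avoids_visibility _ Gw s0) => r /andP[r0 rs].
apply: contrapT => /eqP/set0P Hr.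
have : (visibility (occupied X rho w) theta <= r%:E)%E by apply: ereal_inf_lbound; exists r.
by move=> /(lt_le_trans H); rewrite lte_fin ltNge rs.
Qed.

(** Only finitely many centres are near enough to obstruct a segment of length s. Each of these
    balls is missed as long as the quadratic at the foot, continuous in the direction, is
    positive. *)
Lemma avoids_hit_open w s theta : good w -> 0 <= s -> av (hit C s theta) w ->
  \forall t \near theta, av (hit C s t) w.
Proof.
move=> [Rw Xw] s0 Hav; have hX n := poisson_in_hplane (boolean_centers BM) n w.
have [m Hm] : exists m : nat, cosh C * expR s <= m%:R.
  by exists (Num.bound (cosh C * expR s)); rewrite ltW// archi_boundP// mulr_ge0// ?expR_ge0// ltW// cosh_gt0.
have [N HN] := Xw m.
have near_n n : \forall t \near theta, ~ hit C s t (X n w, rho n w).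
  pose q t := ray_quad (X n w) (rho n w) t (ray_foot (X n w) (rho n w) t s).
  have q0 : 0 < q theta.
    rewrite ltNge; apply/negP => Hq; apply: (Hav n);
    split; [exact: hX|exact: Rw|exact: Hq].
  have cal : continuous (fun t => along t (X n w)).
    rewrite /along/= => t; apply: (@continuousD _ R^o _ (fun t => (X n w).1 * cos t) (fun t => (X n w).2 * sin t)).
      by apply: continuousM; [exact: cst_continuous|exact: continuous_cos].
    by apply: continuousM; [exact: cst_continuous|exact: continuous_sin].
  have cq : {for theta, continuous q}.
    rewrite /q /ray_quad.
    have cf : {for theta, continuous (fun t => ray_foot (X n w) (rho n w) t s)}.
      apply: continuous_min; last exact: cst_continuous.
      apply: continuous_max; first exact: cst_continuous.
      apply: continuousM; last exact: cst_continuous.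
      by apply: continuousM; [exact: cst_continuous|exact: cal].
    apply: continuousB; last exact: cst_continuous.
    apply: continuousD; last exact: cst_continuous.
    apply: continuousB.
      apply: continuousM; first exact: cst_continuous.
      by apply: continuousM; exact: cf.
    apply: continuousM; last exact: cf.
    by apply: continuousM; [exact: cst_continuous|exact: cal].
  have : \forall t \near theta, 0 < q t by exact: (cq _ (lt_nbhsr q0)).
  by apply: filterS => t qt [_ _ /=]; rewrite leNgt qt.
have near_N k : \forall t \near theta, forall n, (n < k)%N -> ~ hit C s t (X n w, rho n w).
  elim: k => [|k IH]; first by apply: (@nearW _ (nbhs theta)) => t n; rewrite ltn0.
  apply: filterS2 IH (near_n k) => t Ht Hk n.
  by rewrite ltnS leq_eqVlt => /predU1P[->//|]; exact: Ht.
apply: filterS (near_N N) => t Ht n Hn.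
have [nN|Nn] := ltnP n N; first exact: (Ht n).
by apply: (HN n Nn); rewrite (le_trans (hit_hcosh_le s0 Hn)).
Qed.

(* Avoiding finitely many balls is an open condition on the direction, so the
   rational directions suffice. *)
Definition visible_dir s : set Om :=
  \bigcup_(q in [set q : rat | 0 <= (ratr q : R) < 2 * pi]) av (hit C s (ratr q)).

(** The supremum over directions need not be attained, so a supremum at least r only gives
    directions visible up to each r - 1 / (k + 1). *)
Definition visible_approx r : set Om := \bigcap_k visible_dir (r - k.+1%:R^-1).

Lemma measurable_visible_approx r : measurable (visible_approx r).
Proof.
apply: bigcapT_measurable => k; rewrite /visible_dir bigcup_mkcond.
apply: bigcupT_measurable_rat => q; case: ifPn => // _.
by apply: measurable_avoids; exact: measurable_hit.
Qed.

Lemma visible_eventP w r : good w -> 1 <= r ->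
  visible_event X rho r w <-> visible_approx r w.
Proof.
move=> Gw r1.
have s0 k : 0 <= r - k.+1%:R^-1 :> R.
  by rewrite subr_ge0 (le_trans _ r1)// invf_le1// ler1n.
split=> [Hr k _|H].
  set s := r - _; have : (s%:E < total_visibility (occupied X rho w))%E.
    by apply: lt_le_trans Hr; rewrite lte_fin /s gtrBl invr_gt0.
  move=> /ereal_sup_gt[_ [theta /= thI <-]] /(visibility_gt_avoids Gw (s0 k)).
  move=> /(avoids_hit_open Gw (s0 k)) /nbhs_ballP[e /= e0 He].
  move: thI; rewrite in_itv/= => /andP[th0 thpi].
  have /rat_in_itvoo[q] : theta < Num.min (theta + e) (2 * pi).
    by rewrite lt_min thpi andbT ltrDl.
  rewrite in_itv/= lt_min => /andP[tq /andP[qe qpi]].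
  exists q => /=; first by rewrite (le_trans th0 (ltW tq)).
  by apply: He; rewrite /ball/= ltr_distlC; apply/andP; split; lra.
apply/lee_addgt0Pr => e e0.
have [k ke] : exists k : nat, k.+1%:R^-1 < e.
  have := near_infty_natSinv_lt (PosNum e0) => -[N _ /(_ N (leqnn N))] ?; by exists N.
have [q qI Hq] := H k I.
have := avoids_le_visibility Gw (s0 k) Hq => Hv.
rewrite -leeBlDr// -EFinB; apply: (@le_trans _ _ (r - k.+1%:R^-1)%:E).
  by rewrite lee_fin lerB// ltW.
apply: (le_trans Hv); apply: ereal_sup_ubound; exists (ratr q) => //.
Qed.

Lemma completed_visible r : 1 <= r ->
  completed_prob P (visible_event X rho r) (prob P (visible_approx r))%:E.
Proof.
move=> r1; exists (visible_approx r); split.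
- exact: measurable_visible_approx.
- by apply: filterS ae_good => w Gw; exact: visible_eventP.
- by rewrite probE//; exact: measurable_visible_approx.
Qed.

(* [U] lies inside [visible_approx r] only up to a null set. *)
Lemma prob_visible_ge r (U : set Om) : 1 <= r -> measurable U ->
  (forall w, U w -> exists2 theta, 0 <= theta < 2 * pi & av (hit C r theta) w) ->
  prob P U <= prob P (visible_approx r).
Proof.
move=> r1 mU HU; apply: ae_le_prob => //; first exact: measurable_visible_approx.
apply: filterS ae_good => w Gw /HU[theta thI Ha]; apply/visible_eventP => //.
have r0 : 0 <= r by lra.
apply: (le_trans (avoids_le_visibility Gw r0 Ha)).
by apply: ereal_sup_ubound; exists theta => //=; rewrite in_itv.
Qed.

End visible.

(** * Two-sided bounds *)

Section power_sums.
Variable R : realType.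
Implicit Types (a x : R) (n : nat).

(** The sum of k^(-a) over k from 1 to n, in the form in which the void probabilities produce it. *)
Definition power_sum a n : R := \sum_(k < n) expR (- a * ln k.+1%:R).

Lemma power_sum_ge1 a n : (0 < n)%N -> 1 <= power_sum a n.
Proof.
case: n => // n _; rewrite /power_sum big_ord_recl/= ln1 mulr0 expR0 lerDl.
by apply: sumr_ge0 => k _; exact: expR_ge0.
Qed.


Lemma ln_diff_ge (x y : R) : 0 < x -> 0 < y -> 1 - x / y <= ln y - ln x.
Proof.
move=> x0 y0; have := expR_ge1Dx (ln x - ln y).
by rewrite expRD expRN !lnK ?posrE//; lra.
Qed.

Lemma expRN_ln x : 0 < x -> expR (- 1 * ln x) = x^-1.
Proof. by move=> x0; rewrite mulN1r expRN lnK ?posrE. Qed.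

Lemma power_sum1_ge n : ln n.+1%:R <= power_sum 1 n.
Proof.
elim: n => [|n IH]; first by rewrite ln1 /power_sum big_ord0.
rewrite /power_sum big_ord_recr/= -/(power_sum 1 n) expRN_ln//.
have := @ln_diff_ge n.+2%:R n.+1%:R (ltr0Sn _ _) (ltr0Sn _ _).
have -> : n.+2%:R / n.+1%:R = 1 + n.+1%:R^-1 :> R.
  by rewrite -[n.+2]addn1 natrD mulrDl divff ?mul1r// pnatr_eq0.
move: IH; move: (ln n.+1%:R) (ln n.+2%:R) (n.+1%:R^-1) => l1 l2 u *; lra.
Qed.

Lemma power_sum1_le n : power_sum 1 n.+1 <= 1 + ln n.+1%:R.
Proof.
elim: n => [|n IH]; first by rewrite /power_sum big_ord1/= !ln1 mulr0 expR0 addr0.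
rewrite /power_sum big_ord_recr/= -/(power_sum 1 n.+1) expRN_ln//.
have := @ln_diff_ge n.+1%:R n.+2%:R (ltr0Sn _ _) (ltr0Sn _ _).
have -> : 1 - n.+1%:R / n.+2%:R = n.+2%:R^-1 :> R.
  rewrite -[n.+1%:R](addrK 1) natr1 mulrBl divff ?mul1r ?pnatr_eq0//; ring.
move: IH; move: (ln n.+1%:R) (ln n.+2%:R) (n.+2%:R^-1) => l1 l2 u *; lra.
Qed.

(** Comparison with the integral of x^(-a) in telescoping form: y^(-a) <= ((y - 1)^(1 - a) - y^(1 -
    a)) / (a - 1), which follows from e^u >= 1 + u. *)
Lemma power_sum_le a n : 1 < a -> power_sum a n <= 1 + (a - 1)^-1.
Proof.
move=> a1; have b0 : 0 < a - 1 by lra.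
suff H m : power_sum a m.+1 <= 1 + (a - 1)^-1 * (1 - expR (- (a - 1) * ln m.+1%:R)).
  case: n => [|n]; first by rewrite /power_sum big_ord0 addr_ge0// invr_ge0 ltW.
  apply: (le_trans (H n)); rewrite lerD2l ler_piMr//; first by rewrite invr_ge0 ltW.
elim: m => [|m IH].
  by rewrite /power_sum big_ord1/= !ln1 !mulr0 expR0 subrr mulr0 addr0.
rewrite /power_sum big_ord_recr/= -/(power_sum a m.+1).
apply: (le_trans (lerD IH (lexx _))); rewrite -addrA lerD2l -lerBrDl -mulrBr.
rewrite [leRHS]mulrC ler_pdivlMr//.
set x : R := m.+1%:R; set y : R := m.+2%:R.
have y0 : 0 < y by [].
have xy : y = x + 1 by rewrite natr1.
have Hl : y^-1 <= ln y - ln x.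
  apply: le_trans (ln_diff_ge _ _) => //.
  rewrite -[X in _ <= X - _](divff (lt0r_neq0 y0)) -mulrBl.
  by rewrite (_ : y - x = 1) ?mul1r// xy addrAC subrr add0r.
have -> : - a * ln y = - (a - 1) * ln y + - 1 * ln y by ring.
rewrite expRD expRN_ln//.
have -> : - (a - 1) * ln x = - (a - 1) * ln y + (a - 1) * (ln y - ln x) by ring.
rewrite expRD; set e := expR (- (a - 1) * ln y).
have e0 : 0 < e by exact: expR_gt0.
have Hb : (a - 1) * y^-1 <= (a - 1) * (ln y - ln x) by rewrite ler_pM2l.
have := expR_ge1Dx ((a - 1) * (ln y - ln x)) => He.
have : e * (1 + (a - 1) * y^-1) <= e * expR ((a - 1) * (ln y - ln x)).
  by rewrite ler_pM2l// (le_trans _ He)// lerD2l.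
move: (expR _) => g; rewrite mulrDr mulr1 mulrA => H.
have -> : 1 - e - (1 - e * g) = e * g - e by ring.
by rewrite lerBrDl (le_trans _ H)// mulrAC.
Qed.

End power_sums.

(** * Upper bound: scanning the arcs of a sector *)

Section upper.
Context (R : realType) (d : measure_display) (Om : measurableType d)
  (P : probability Om R) (X : nat -> {RV P >-> (R * R)%type})
  (rho : nat -> {RV P >-> R}).
Variables (lam C : R) (nu : probability R R) (lam_gt0 : 0 < lam) (C1 : 1 <= C)
  (BM : poisson_boolean_model lam nu X rho).
Hypothesis nuC : nu (~` `]0%R, C]%classic) = 0%E.

Let p S := prob P (avoids X rho S).
Let E := mean_sinh nu.
Let a := 2 * lam * E.
Let core0 : 0 < core C. Proof. by have := core_ge2 C1; lra. Qed.

Lemma prob_avoids_le S L K : measurable S -> hbounded S ->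
  ((2 * E * L)%:E <= mass nu S + K%:E)%E ->
  p S <= expR (lam * K) * expR (- a * L).
Proof.
move=> mS bS; rewrite -(fineK (mass_fin_num nu mS bS)) -EFinD lee_fin => H.
rewrite /p (prob_avoids lam_gt0 BM)// -expRD ler_expR.
have lam0 := lam_gt0; have H' := ler_wpM2l (ltW lam0) H.
rewrite /a; move: (fine _) H H' => m H H'; lra.
Qed.

Lemma prob_avoids_ge S L K : measurable S -> hbounded S ->
  (mass nu S <= (2 * E * L + K)%:E)%E ->
  expR (- (lam * K)) * expR (- a * L) <= p S.
Proof.
move=> mS bS; rewrite -(fineK (mass_fin_num nu mS bS)) lee_fin => H.
rewrite /p (prob_avoids lam_gt0 BM)// -expRD ler_expR.
have lam0 := lam_gt0; have H' := ler_wpM2l (ltW lam0) H.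
rewrite /a; move: (fine _) H H' => m H H'; lra.
Qed.

Lemma hbounded_blk W theta : hbounded (blk C W theta).
Proof.
exists (Num.max 1 W); first by rewrite le_max lexx.
by move=> z t [_ _ _ [/andP[_ /= zW] _]]; rewrite le_max zW orbT.
Qed.

Lemma hbounded_hit r theta : 0 <= r -> hbounded (hit C r theta).
Proof.
move=> r0; exists (cosh C * expR r); last by move=> z t; exact: hit_hcosh_le.
by apply: mulr_ege1; [exact: cosh_ge1|rewrite -expR0 ler_expR].
Qed.

Lemma prob_avoids_turn j S : measurable S -> hbounded S -> p (iter j (@turn R) S) = p S.
Proof.
move=> mS bS.
have mj := measurable_iter_turn j mS; have bj := hbounded_iter_turn j bS.
by rewrite /p (prob_avoids lam_gt0 BM mj bj) (prob_avoids lam_gt0 BM mS bS) mass_iter_turn.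
Qed.

Lemma prob_bigsetU_le (F : nat -> set Om) n : (forall i, measurable (F i)) ->
  prob P (\big[setU/set0]_(i < n) F i) <= \sum_(i < n) prob P (F i).
Proof.
move=> mF; elim: n => [|n IH]; first by rewrite !big_ord0 /prob measure0.
rewrite !big_ord_recr/=; apply: (le_trans (prob_setU_le _ _ _)) => //.
  exact: bigsetU_measurable.
by rewrite lerD2r.
Qed.

Let grid W i : R := - (pi / 4) + i%:R / W.
Let blocks W j i := iter j (@turn R) (blk C W (grid W i)).

(** Turning a set of obstacles lowers its direction by pi / 2, so j turns lead from theta - 2 pi + j
    pi / 2 to theta, up to the period. The sectors are centred at multiples of pi / 2, so both ends
    of [0, 2 pi[ need a value of j, which makes five. *)
Lemma sector_reduction (theta : R) : 0 <= theta < 2 * pi ->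
  exists j, (j < 5)%N /\ `|theta - 2 * pi + j%:R * (pi / 2)| <= pi / 4.
Proof.
move=> /andP[th0 thpi]; have pi0 : 0 < pi :> R := pi_gt0 R.
pose x : R := (2 * pi - theta + pi / 4) / (pi / 2).
have pi20 : 0 < pi / 2 :> R by lra.
have x0 : 0 <= x by apply: divr_ge0; lra.
have xE : x * (pi / 2) = 2 * pi - theta + pi / 4 by rewrite divfK ?gt_eqF.
have /andP[jx xj] := truncn_itv x0.
exists (Num.truncn x); split.
  rewrite -(ltr_nat R) (le_lt_trans jx)// -(ltr_pM2r pi20) xE.
  by move: th0 pi0 => /=; lra.
have h1 : (Num.truncn x)%:R * (pi / 2) <= x * (pi / 2) by rewrite ler_pM2r.
have h2 : x * (pi / 2) < (Num.truncn x)%:R * (pi / 2) + pi / 2.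
  by rewrite -[X in _ + X]mul1r -mulrDl natr1 ltr_pM2r.
rewrite xE in h1 h2.
move: h1 h2; move: (_ * _) => y h1 h2.
by rewrite ler_norml; apply/andP; split; lra.
Qed.

(** The index k = 0 of [visible_approx] supplies a direction visible up to r - 1; replacing r by r -
    1 costs a constant factor. This direction is within 1 / W of a grid direction, whose block is
    then avoided as a whole. *)
Lemma visible_cover r : 1 <= r -> let W := expR (r - 1) / 2 in
  visible_approx X rho C r `<=`
  \big[setU/set0]_(j < 5) some_avoided X rho (blocks W j) (Num.truncn (pi / 2 * W)).+1.
Proof.
move=> r1 W w /(_ 0%N I) [q /= /sector_reduction[j [j5]]].
rewrite invr1; set phi := _ + _ => hphi Hav.
have W0 : 0 < W by rewrite divr_gt0// expR_gt0.
have Wr : W <= cosh (r - 1).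
  by rewrite /W /cosh ler_pM2r ?invr_gt0// lerDl expR_ge0.
have r10 : 0 <= r - 1 by rewrite subr_ge0.
have hitE : hit C (r - 1) (ratr q) = iter j (@turn R) (hit C (r - 1) phi).
  rewrite iter_turn_hit -[RHS]hit_periodic; congr hit; rewrite /phi; ring.
have x0 : 0 <= (phi + pi / 4) * W.
  by apply: mulr_ge0; [move: hphi; rewrite ler_norml => /andP[]; lra|exact: ltW].
have /andP[ix xi] := truncn_itv x0.
set i := Num.truncn _ in ix xi.
rewrite -(bigcup_mkord 5 (fun j => some_avoided X rho (blocks W j) _)).
exists j => //; exists i.
  rewrite ltnS /i; apply: Num.Theory.le_truncn; rewrite ler_pM2r//.
  by move: hphi; rewrite ler_norml => /andP[]; lra.
move=> m; move: (X m w) (rho m w) (Hav m) => z s; rewrite hitE => nH Hb; apply: nH.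
apply: iter_turnS Hb => -[z' s']; apply: (blk_hit C1 r10 W0 Wr).
have h1 : i%:R / W <= phi + pi / 4 by rewrite ler_pdivrMr.
have h2 : phi + pi / 4 < i%:R / W + W^-1.
  have -> : i%:R / W + W^-1 = i.+1%:R / W by rewrite -natr1 mulrDl mul1r.
  by rewrite ltr_pdivlMr.
by rewrite /grid ler_norml; apply/andP; split; move: (W^-1) h1 h2 => v h1 h2; lra.
Qed.

(** Five sectors, at most (pi / 2 + 2) W arcs in the sum for each, exp(3 [lam]) from the additive
    errors 2 and 1 of the two mass bounds, and a last factor from ln (W / [core]) = r - 1 - ln (2
    [core]). *)
Definition upper_cst : R :=
  5 * (pi / 2 + 2) * expR (3 * lam) * expR (a * (1 + ln (2 * core C))).

Lemma visible_upper r : 1 + ln (2 * core C) <= r ->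
  prob P (visible_approx X rho C r) * power_sum a (Num.truncn (expR (r - 1) / 16)) <=
  upper_cst * expR (- (a - 1) * r).
Proof.
move=> r0; have c2 := core_ge2 C1; have pi0 : 0 < pi :> R := pi_gt0 R.
have ln0 : 0 <= ln (2 * core C) by apply: ln_ge0; lra.
have r1 : 1 <= r by lra.
(* m is the integer part of W / 8: scanning m arcs past the end of the sector adds an angle of at
   most 1/8. *)
pose W := expR (r - 1) / 2; pose m := Num.truncn (expR (r - 1) / 16).
pose n := (Num.truncn (pi / 2 * W)).+1.
have cW : core C <= W.
  rewrite ler_pdivlMr// mulrC -[leLHS]lnK ?posrE; last by lra.
  by rewrite ler_expR; lra.
have W0 : 0 < W by lra.
have mW : m%:R <= W / 8.
  have /andP[+ _] := truncn_itv (divr_ge0 (expR_ge0 (r - 1)) (ler0n R 16)).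
  by rewrite -/m => /le_trans; apply; rewrite /W; lra.
have nW : n%:R <= pi / 2 * W + 1.
  have h0 : 0 <= pi / 2 * W by apply: mulr_ge0; lra.
  have /andP[hn _] := truncn_itv h0.
  by rewrite /n -[X in X <= _]natr1 lerD2r.
have gridB i : (i < n + m)%N -> `|grid W i| <= pi / 4 + 8^-1.
  move=> inm; have : i.+1%:R <= (n + m)%:R :> R by rewrite ler_nat.
  rewrite natrD -natr1 => hi; have iW : i%:R <= (pi / 2 + 8^-1) * W by lra.
  have i0 : 0 <= i%:R / W by rewrite divr_ge0// ltW.
  have : i%:R / W <= pi / 2 + 8^-1 by rewrite ler_pdivrMr.
  by rewrite /grid ler_norml => h; apply/andP; split; lra.
have blk_le i : (i < n + m)%N ->
    p (blk C W (grid W i)) <= expR (lam * 2) * expR (- a * ln (W / core C)).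
  move=> inm; apply: prob_avoids_le; first exact: measurable_blk.
    exact: hbounded_blk.
  exact: mass_blk_ge (gridB _ inm).
have gridD i k : grid W (i + k.+1)%N - grid W i = k.+1%:R / W.
  by rewrite /grid natrD; ring.
have blkD_ge i k : expR (- (lam * 1)) * expR (- a * ln k.+1%:R) <=
    p (blk C W (grid W (i + k.+1)%N) `\` blk C W (grid W i)).
  apply: prob_avoids_ge.
  - by apply: measurableD; exact: measurable_blk.
  - by apply: hboundedS (@hbounded_blk W (grid W (i + k.+1)%N)); exact: subDsetl.
  - by apply: (mass_blkD_le C1 nuC cW); [rewrite ler1n|exact: gridD].
have grid_mono i l : (i < l)%N -> grid W i <= grid W l.
  by move=> /ltnW il; rewrite lerD2l ler_wpM2r ?ler_nat// invr_ge0 ltW.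
have one j : power_sum a m * prob P (some_avoided X rho (blocks W j) n) <=
    expR lam * ((pi / 2 + 2) * W * (expR (lam * 2) * expR (- a * ln (W / core C)))).
  have mb i : measurable (blocks W j i) by apply: measurable_iter_turn; exact: measurable_blk.
  have bb i : hbounded (blocks W j i) by apply: hbounded_iter_turn; exact: hbounded_blk.
  have H := @cover_bound R d Om P X rho lam nu lam_gt0 BM (blocks W j) n m
    (expR (- (lam * 1)) * power_sum a m) mb bb.
  rewrite -ler_pdivrMl ?expR_gt0// -expRN [leLHS]mulrA -{1}[lam]mulr1.
  apply: (le_trans (H _ _)).
  (* At given height and radius the directions whose block contains the point form an interval, and
     the grid is increasing. *)
  - move=> k i l ki il; rewrite /blocks -iter_turnI; apply: iter_turnS => -[z s].
    move=> [[z1 sC hz [/= cz ak]] [_ _ _ [_ /= al]]]; split=> //; split=> //=.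
    move: ak al (grid_mono _ _ ki) (grid_mono _ _ il).
    move: (sinh s / _ - _) => h; rewrite !ler_norml => /andP[h3 h4] /andP[h5 h6] h1 h2.
    by apply/andP; split; lra.
  - move=> i _; rewrite mulr_sumr; apply: ler_sum => k _.
    rewrite /blocks -iter_turnD -/(p _) prob_avoids_turn//.
      by apply: measurableD; exact: measurable_blk.
    by apply: hboundedS (@hbounded_blk W (grid W (i + k.+1)%N)); exact: subDsetl.
  apply: (@le_trans _ _ (\sum_(i < n + m) (expR (lam * 2) * expR (- a * ln (W / core C))))).
    apply: ler_sum => i _; rewrite /blocks -/(p _) prob_avoids_turn ?blk_le//.
      exact: measurable_blk.
    exact: hbounded_blk.
  rewrite sumr_const card_ord -[leLHS]mulr_natl ler_wpM2r ?mulr_ge0 ?expR_ge0//.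
  by rewrite natrD; lra.
have mS j : measurable (some_avoided X rho (blocks W j) n).
  by apply: measurable_some_avoided => k; apply: measurable_iter_turn; exact: measurable_blk.
have H0 : 0 <= power_sum a m by apply: sumr_ge0 => k _; exact: expR_ge0.
have : prob P (visible_approx X rho C r) * power_sum a m <=
    \sum_(j < 5) power_sum a m * prob P (some_avoided X rho (blocks W j) n).
  rewrite -mulr_sumr mulrC ler_wpM2l//.
  apply: le_trans (prob_bigsetU_le 5 mS); apply: le_prob.
  - exact: measurable_visible_approx.
  - exact: bigsetU_measurable.
  - exact: visible_cover r1.
move=> /le_trans; apply.
apply: (@le_trans _ _ (\sum_(j < 5) expR lam * ((pi / 2 + 2) * W *
    (expR (lam * 2) * expR (- a * ln (W / core C)))))).
  by apply: ler_sum => j _; exact: one.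
rewrite sumr_const card_ord -[leLHS]mulr_natl.
have lnW : ln (W / core C) = r - 1 - ln (2 * core C).
  have -> : W / core C = expR (r - 1) / (2 * core C).
    by rewrite /W; field; rewrite gt_eqF.
  by rewrite ln_div ?posrE ?expR_gt0 ?expRK// mulr_gt0.
have WE : W <= expR r.
  rewrite /W; have : expR (r - 1) <= expR r by rewrite ler_expR; lra.
  by have := expR_ge0 (r - 1); lra.
rewrite lnW /upper_cst.
have -> : expR (3 * lam) = expR lam * expR (lam * 2) by rewrite -expRD; congr expR; ring.
have -> : expR (- (a - 1) * r) = expR r * expR (- a * r) by rewrite -expRD; congr expR; ring.
have -> : expR (- a * (r - 1 - ln (2 * core C))) =
    expR (a * (1 + ln (2 * core C))) * expR (- a * r) by rewrite -expRD; congr expR; ring.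
have := expR_ge0 lam; have := expR_ge0 (lam * 2); have := expR_ge0 (- a * r).
have := expR_ge0 (a * (1 + ln (2 * core C))); move: WE.
move: (expR lam) (expR (lam * 2)) (expR (- a * r)) (expR (a * _)) (expR r) => e1 e2 e3 e4 e5.
move=> We5 h4 h3 h2 h1.
have -> : 5 * (e1 * ((pi / 2 + 2) * W * (e2 * (e4 * e3)))) =
    (5 * (pi / 2 + 2) * (e1 * e2) * e4 * e3) * W by ring.
have -> : 5 * (pi / 2 + 2) * (e1 * e2) * e4 * (e5 * e3) =
    (5 * (pi / 2 + 2) * (e1 * e2) * e4 * e3) * e5 by ring.
by apply: ler_wpM2l => //; rewrite !mulr_ge0//; lra.
Qed.

End upper.

(** One row of a matrix that decays away from the diagonal: the entries on each side of i are
    dominated by one copy of [f]. *)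
Lemma sum_le_dist (R : realType) (G f : nat -> R) (u : R) (n i : nat) :
  (i < n)%N -> (forall k, 0 <= f k) -> G i <= u ->
  (forall j, (i < j)%N -> (j < n)%N -> G j <= f (j - i.+1)%N) ->
  (forall j, (j < i)%N -> G j <= f (i - j.+1)%N) ->
  \sum_(j < n) G j <= u + 2 * \sum_(k < n) f k.
Proof.
move=> ni f0 Gi Gr Gl; rewrite -!(big_mkord xpredT).
have fle k : (k <= n)%N -> \sum_(0 <= j < k) f j <= \sum_(0 <= j < n) f j.
  move=> kn; rewrite [leRHS](@big_cat_nat _ _ _ k)//= lerDl.
  by apply: sumr_ge0 => j _.
rewrite (@big_cat_nat _ _ _ i)//=; last exact: ltnW.
rewrite [X in _ + X]big_ltn//.
have hl : \sum_(0 <= j < i) G j <= \sum_(0 <= j < n) f j.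
  apply: le_trans (fle i (ltnW ni)); rewrite [leRHS]big_nat_rev/= add0n.
  by rewrite !big_mkord; apply: ler_sum => j _; exact: Gl.
have hr : \sum_(i.+1 <= j < n) G j <= \sum_(0 <= j < n) f j.
  apply: le_trans (fle (n - i.+1)%N (leq_subr _ _)).
  rewrite -{1}[i.+1]add0n big_addn !big_mkord; apply: ler_sum => j _.
  apply: (le_trans (Gr _ _ _)); first by rewrite addnS ltnS leq_addl.
    by rewrite addnC -ltn_subRL.
  by rewrite addnK.
by move: hl hr; move: (\sum_(_ <= _ < _) _) (\sum_(_ <= _ < _) _) (\sum_(_ <= _ < _) _) => *; lra.
Qed.

(** * Lower bound: moments of the number of visible directions *)

Section lower.
Context (R : realType) (d : measure_display) (Om : measurableType d)
  (P : probability Om R) (X : nat -> {RV P >-> (R * R)%type})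
  (rho : nat -> {RV P >-> R}).
Variables (lam C : R) (nu : probability R R) (lam_gt0 : 0 < lam) (C1 : 1 <= C)
  (BM : poisson_boolean_model lam nu X rho).
Hypothesis nuC : nu (~` `]0%R, C]%classic) = 0%E.

Let p S := prob P (avoids X rho S).
Let E := mean_sinh nu.
Let a := 2 * lam * E.
Let core0 : 0 < core C. Proof. by have := core_ge2 C1; lra. Qed.

Definition hit_prob_cst : R := expR (- (lam * hit_cst C)) * expR (- a * ln (cosh C)).
(** 1 for the diagonal, 2 for its two sides; the remaining product is the constant in the bound for
    avoiding the second block outside the first. *)
Definition pair_cst : R := 1 + 2 * (expR (lam * 2) * expR (a * ln (3 * core C))).
(** The 8 comes from having at least W / 4 directions, with W = e^r / 2. *)
Definition lower_cst : R := hit_prob_cst ^+ 2 /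
  (8 * (expR (lam * 2) * expR (a * ln (2 * core C)) * pair_cst)).

Let pair_ge1 : 1 <= pair_cst.
Proof. by rewrite lerDl !mulr_ge0 ?expR_ge0. Qed.

Lemma lower_cst_gt0 : 0 < lower_cst.
Proof.
have := pair_ge1 => h.
by rewrite divr_gt0 ?exprn_gt0 ?mulr_gt0 ?expR_gt0//; lra.
Qed.

Lemma visible_lower r : 1 + ln (2 * core C) <= r ->
  lower_cst * expR (- (a - 1) * r) <=
  prob P (visible_approx X rho C r) * power_sum a (Num.truncn (expR r / 4)).
Proof.
move=> r0; have c2 := core_ge2 C1; have pi2 := pi_ge2 R.
have ln0 : 0 <= ln (2 * core C) by apply: ln_ge0; lra.
have r1 : 1 <= r by lra.
have r00 : 0 <= r by lra.
(* n is the integer part of W / 2, so all directions i / W lie in [0, 1/2], where [mass_hit_le]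
   applies. *)
pose W := expR r / 2; pose n := Num.truncn (expR r / 4).
have cW : core C <= W.
  rewrite ler_pdivlMr// mulrC -[leLHS]lnK ?posrE; last by lra.
  by rewrite ler_expR; lra.
have W0 : 0 < W by lra.
have Wr : W <= cosh r by rewrite /W /cosh ler_pM2r ?invr_gt0// lerDl expR_ge0.
have W20 : 0 <= expR r / 4 by apply: divr_ge0 => //; exact: expR_ge0.
have /andP[nW Wn] := truncn_itv W20; rewrite -/n in nW Wn.
have n0 : (0 < n)%N.
  by rewrite /n truncn_gt0; move: cW; rewrite /W; lra.
have nW2 : n%:R <= W / 2 by rewrite (le_trans nW)// /W; lra.
have Wn4 : W / 4 <= n%:R.
  have : 1 <= n%:R :> R by rewrite ler1n.
  by rewrite -(natr1 n) in Wn; rewrite /W; move: Wn; lra.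
pose th i : R := i%:R / W.
have thB i : (i < n)%N -> 0 <= th i <= 2^-1.
  move=> ni; apply/andP; split; first by rewrite divr_ge0 ?ler0n ?(ltW W0).
  rewrite /th ler_pdivrMr//.
  have : i%:R <= n%:R :> R by rewrite ler_nat ltnW.
  by move: nW2; lra.
have thB' i : (i < n)%N -> `|th i| <= pi / 4 + 8^-1.
  by move=> /thB /andP[h0 h1]; rewrite ger0_norm//; lra.
pose V i := avoids X rho (hit C r (th i)).
have mV i : measurable (V i) by apply: measurable_avoids; exact: measurable_hit.
have mb i : measurable (blk C W (th i)) by exact: measurable_blk.
have bb i : hbounded (blk C W (th i)) by exact: hbounded_blk.
pose U := some_avoided X rho (fun i => hit C r (th i)) n.
have mU : measurable U by apply: measurable_some_avoided => k; exact: measurable_hit.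
have VU i : (i < n)%N -> V i `<=` U by move=> ni w Vw; exists i.
have UP : prob P U <= prob P (visible_approx X rho C r).
  apply: (prob_visible_ge lam_gt0 BM nuC r1 mU) => w [i ni Vi]; exists (th i) => //.
  by have /andP[-> h] := thB _ ni; rewrite /=; lra.
pose l := hit_prob_cst * expR (- a * r).
have l0 : 0 < l by rewrite !mulr_gt0 ?expR_gt0.
have Vl i : (i < n)%N -> l <= prob P (V i).
  move=> ni; rewrite /l /hit_prob_cst -mulrA -expRD.
  rewrite -mulrDr [ln _ + _]addrC; apply: (prob_avoids_ge lam_gt0 BM (nu := nu)).
  - exact: measurable_hit.
  - exact: hbounded_hit.
  - exact: mass_hit_le (thB _ ni).
have blkV i : blk C W (th i) `<=` hit C r (th i).
  move=> -[z s]; apply: (blk_hit C1 r00 W0 Wr).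
  by rewrite subrr normr0 invr_ge0 ltW.
have Vblk i : V i `<=` avoids X rho (blk C W (th i)).
  by move=> w Vw m Hm; apply: (Vw m); exact: blkV.
pose u := expR (lam * 2) * expR (- a * ln (W / core C)).
have u0 : 0 < u by rewrite mulr_gt0 ?expR_gt0.
have blku i : (i < n)%N -> p (blk C W (th i)) <= u.
  move=> ni; apply: (prob_avoids_le lam_gt0 BM (nu := nu)) => //.
  exact: mass_blk_ge (thB' _ ni).
have Vu i : (i < n)%N -> prob P (V i) <= u.
  move=> ni; apply: le_trans (blku _ ni); apply: le_prob => //.
  exact: measurable_avoids.
pose v := expR (lam * 2) * expR (a * ln (3 * core C)).
have v0 : 0 < v by rewrite mulr_gt0 ?expR_gt0.
have VV i k : (i + k.+1 < n)%N ->
    prob P (V i `&` V (i + k.+1)%N) <= u * (v * expR (- a * ln k.+1%:R)).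
  move=> ikn; have ni : (i < n)%N by apply: leq_ltn_trans ikn; exact: leq_addr.
  set j := (i + k.+1)%N in ikn *.
  have mD : measurable (blk C W (th j) `\` blk C W (th i)) by exact: measurableD.
  have bD : hbounded (blk C W (th j) `\` blk C W (th i)).
    by apply: hboundedS (bb j); exact: subDsetl.
  (* Avoiding both segments is relaxed to avoiding two disjoint sets of obstacles, whose
     probabilities multiply. *)
  apply: (@le_trans _ _ (prob P (avoids X rho (blk C W (th i)) `&`
      avoids X rho (blk C W (th j) `\` blk C W (th i))))).
    apply: le_prob; first exact: measurableI.
      by apply: measurableI; exact: measurable_avoids.
    move=> w [/Vblk Vi /Vblk Vj]; split=> // m [Hm _]; exact: (Vj m).
  rewrite (prob_avoids_setU lam_gt0 BM (mb i) mD (bb i) bD); last first.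
    by apply/seteqP; split=> q //= [? []].
  apply: ler_pM; rewrite ?prob_ge0//; first exact: blku.
  have -> : v * expR (- a * ln k.+1%:R) =
      expR (lam * 2) * expR (- a * ln (k.+1%:R / (3 * core C))).
    rewrite /v -mulrA -expRD ln_div ?posrE ?mulr_gt0//; congr (_ * expR _); ring.
  apply: (prob_avoids_le lam_gt0 BM (nu := nu)) => //.
  apply: (mass_blkD_ge C1 nuC cW (thB' _ ikn)).
    rewrite ler1n/=; have : k.+1%:R <= n%:R :> R.
      by rewrite ler_nat ltnW// (leq_ltn_trans _ ikn)// leq_addl.
    lra.
  by rewrite /th /j natrD; ring.
have H1 := @power_sum_ge1 R a n n0.
set H := power_sum a n in H1 *.
have S2 : \sum_(i < n) \sum_(j < n) prob P (V i `&` V j) <= n%:R * (u * pair_cst * H).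
  rewrite -[n in n%:R]card_ord mulr_natl -sumr_const; apply: ler_sum => i _.
  apply: (@le_trans _ _ (u + 2 * \sum_(k < n) u * (v * expR (- a * ln k.+1%:R)))).
    apply: (@sum_le_dist R (fun j => prob P (V i `&` V j))
      (fun k => u * (v * expR (- a * ln k.+1%:R))) u n i) => //.
    - by move=> k; rewrite !mulr_ge0 ?expR_ge0.
    - by rewrite setIid Vu.
    - move=> j ij jn; have jE : j = (i + (j - i.+1).+1)%N by rewrite addnS -addSn subnKC.
      by rewrite {1}jE; apply: VV; rewrite -jE.
    - move=> j ji; have iE : i = (j + (i - j.+1).+1)%N :> nat by rewrite addnS -addSn subnKC.
      by rewrite setIC {1}iE; apply: VV; rewrite -iE.
  rewrite -!mulr_sumr -/(power_sum a n) -/H /pair_cst -/v.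
  (* The diagonal term is absorbed by [H], which is at least 1. *)
  have : u * 1 <= u * H by rewrite ler_pM2l.
  by rewrite mulr1; lra.
have S1 : n%:R * l <= \sum_(i < n) prob P (V i).
  rewrite -[n in n%:R]card_ord mulr_natl -sumr_const; apply: ler_sum => i _.
  exact: Vl.
have nR0 : 0 < n%:R :> R by rewrite ltr0n.
have := @second_moment R d Om P n V U mV mU VU (lt_le_trans (mulr_gt0 nR0 l0) S1).
move=> M.
have M2 : (n%:R * l) ^+ 2 <= prob P (visible_approx X rho C r) * (n%:R * (u * pair_cst * H)).
  apply: (@le_trans _ _ ((\sum_(i < n) prob P (V i)) ^+ 2)).
    by rewrite ler_pXn2r// nnegrE; [rewrite mulr_ge0// ltW|apply: sumr_ge0 => i _; exact: prob_ge0].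
  apply: (le_trans M); apply: ler_pM => //; first exact: prob_ge0.
  by apply: sumr_ge0 => i _; apply: sumr_ge0 => j _; exact: prob_ge0.
set Q := prob P (visible_approx X rho C r) in M2 *.
have M3 : W / 4 * l ^+ 2 <= Q * H * (u * pair_cst).
  apply: (@le_trans _ _ (n%:R * l ^+ 2)); first by rewrite ler_pM2r// exprn_gt0.
  rewrite -(ler_pM2l nR0); move: M2.
  have -> : (n%:R * l) ^+ 2 = n%:R * (n%:R * l ^+ 2) by ring.
  by have -> : Q * (n%:R * (u * pair_cst * H)) = n%:R * (Q * H * (u * pair_cst)) by ring.
have pc0 : 0 < pair_cst by have := pair_ge1; lra.
have upc0 : 0 < u * pair_cst by rewrite mulr_gt0.
rewrite -(ler_pM2r upc0); apply: (le_trans _ M3).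
have lnW : ln (W / core C) = r - ln (2 * core C).
  have -> : W / core C = expR r / (2 * core C) by rewrite /W; field; rewrite gt_eqF.
  by rewrite ln_div ?posrE ?expR_gt0 ?expRK// mulr_gt0.
rewrite /u lnW /l /W /lower_cst.
have -> : expR (- (a - 1) * r) = expR r * expR (- a * r) by rewrite -expRD; congr expR; ring.
have -> : expR (- a * (r - ln (2 * core C))) =
    expR (a * ln (2 * core C)) * expR (- a * r) by rewrite -expRD; congr expR; ring.
have := expR_gt0 (lam * 2); have := expR_gt0 (a * ln (2 * core C)); move: pc0.
move: hit_prob_cst pair_cst (expR (lam * 2)) (expR (a * _)) (expR r) (expR (- a * r)).
move=> h q e1 e2 e3 e4 q0 e20 e10.
by rewrite le_eqVlt; apply/orP; left; apply/eqP; field; rewrite !gt_eqF.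
Qed.

End lower.

Theorem theorem2 (R : realType) (lam : R) (nu : probability R R)
  (lam_gt0 : 0 < lam)
  (nu_bounded : exists C : R, {ae nu, forall x : R, 0 < x <= C})
  (alpha : R)
  (alphaE : alpha = 2 * lam * fine ('E_nu[@sinh R])%E) :
  exists c c' r0 : R,
    [/\ 0 < c, c <= c' &
    forall (d : measure_display) (Om : measurableType d)
      (P : probability Om R)
      (X : nat -> {RV P >-> (R * R)%type}) (rho : nat -> {RV P >-> R}),
    poisson_boolean_model lam nu X rho ->
    forall r : R, r0 <= r ->
    exists p : \bar R,
      [/\ completed_prob P (visible_event X rho r) p,
          alpha = 1 ->
            ((c * (1 / r))%:E <= p <= (c' * (1 / r))%:E)%E &
          1 < alpha ->
            ((c * expR (- (alpha - 1) * r))%:E <= p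
               <= (c' * expR (- (alpha - 1) * r))%:E)%E]].
Proof.
have [C0 [N [mN nuN N0]]] := nu_bounded.
pose C := Num.max 1 C0; have C1 : 1 <= C by rewrite le_max lexx.
have nuC : nu (~` `]0, C]%classic) = 0%E.
  apply: (subset_measure0 _ mN _ nuN); first exact: measurableC.
  apply: subset_trans N0 => x /=; rewrite in_itv/= => H /andP[x0 xC]; apply: H.
  by rewrite x0 le_max xC orbT.
have c2 := core_ge2 C1.
pose l1 := ln (2 * core C); have l10 : 0 <= l1 by apply: ln_ge0; lra.
pose l2 : R := ln 16; have l20 : 0 <= l2 by apply: ln_ge0; lra.
(* Large enough for e^(r - 1) / 16 >= 1, for r - 1 - ln 16 >= r / 2, and for the threshold 1 + ln (2
   [core]) of both bounds. *)
pose r0 := 3 + 2 * l2 + l1.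
pose lc := lower_cst lam C nu; pose uc := upper_cst lam C nu.
have lc0 : 0 < lc by exact: lower_cst_gt0.
have aE : alpha = 2 * lam * mean_sinh nu by exact: alphaE.
have small (r : R) : r0 <= r -> 1 <= r /\ 1 + l1 <= r by rewrite /r0; lra.
have e16 (r : R) : expR (r - 1) / 16 = expR (r - 1 - l2).
  by rewrite [RHS]expRD expRN lnK ?posrE.
(* What remains is to size the power sums. For alpha = 1 the one in the upper bound is at least r /
   2 and the one in the lower bound at most 2 r. For alpha > 1 they are respectively at least 1 and
   at most 1 + 1 / (alpha - 1). *)
have [a1|a1] := eqVneq alpha 1.
  exists (lc / 2), (Num.max (lc / 2) (2 * uc)), r0; split.
  - by rewrite divr_gt0.
  - by rewrite le_max lexx.
  move=> d Om P X rho BM r rr0; have [r1 rl1] := small r rr0.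
  exists (prob P (visible_approx X rho C r))%:E; split.
  - exact: (completed_visible lam_gt0 BM nuC r1).
  - move=> _; rewrite !lee_fin.
    have := visible_lower lam_gt0 C1 BM nuC rl1.
    have := visible_upper lam_gt0 C1 BM nuC rl1.
    rewrite -aE a1 subrr oppr0 mul0r expR0 !mulr1 -/lc -/uc.
    have p0 : 0 <= prob P (visible_approx X rho C r) by exact: prob_ge0.
    move: (prob _ _) p0 => p p0 Hu Hl.
    have r_gt0 : 0 < r by lra.
    rewrite div1r; apply/andP; split.
      rewrite ler_pdivrMr//.
      have e4 : 1 <= expR r / 4.
        have : expR (r - 1 - l2) <= expR r by rewrite ler_expR; lra.
        have : 1 <= expR (r - 1 - l2) by rewrite -[leLHS]expR0 ler_expR; rewrite /r0 in rr0; lra.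
        have : expR (r - 1) <= expR r by rewrite ler_expR; lra.
        rewrite -e16; lra.
      have n0 : (0 < Num.truncn (expR r / 4))%N by rewrite truncn_gt0.
      have /andP[nr _] := truncn_itv (le_trans ler01 e4).
      move: n0 nr Hl; case: (Num.truncn _) => // n _ nr Hl.
      have ln_r : ln n.+1%:R <= r.
        rewrite -[leRHS]expRK ler_ln ?posrE ?expR_gt0//; apply: (le_trans nr).
        by have := expR_gt0 r; lra.
      have := power_sum1_le R n => Hs.
      have : p * power_sum 1 n.+1 <= p * (2 * r) by rewrite ler_wpM2l//; lra.
      lra.
    rewrite ler_pdivlMr// le_max; apply/orP; right.
    have /andP[_ mr] := truncn_itv (divr_ge0 (expR_ge0 (r - 1)) (ler0n R 16)).
    have : r / 2 <= power_sum 1 (Num.truncn (expR (r - 1) / 16)).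
      apply: le_trans (power_sum1_ge _ _).
      apply: (@le_trans _ _ (r - 1 - l2)); first by rewrite /r0 in rr0; lra.
      rewrite -[leLHS]expRK ler_ln ?posrE ?expR_gt0//.
      by rewrite -e16 ltW.
    move: (power_sum _ _) Hu => s Hu rs.
    have : p * (r / 2) <= p * s by rewrite ler_wpM2l.
    lra.
  - by rewrite a1 ltxx.
have [a2|a2] := ltP 1 alpha; last first.
  (* For alpha < 1 only the measurability claim is left, and it holds from r = 1 on. *)
  exists 1, 1, 1; split=> // d Om P X rho BM r r1.
  exists (prob P (visible_approx X rho C r))%:E; split.
  - exact: (completed_visible lam_gt0 BM nuC r1).
  - by move=> /eqP; rewrite (negPf a1).
  - by [].
pose K := 1 + (alpha - 1)^-1.
have K0 : 0 < K by rewrite addr_gt0// invr_gt0 subr_gt0.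
exists (lc / K), (Num.max (lc / K) uc), r0; split.
- by rewrite divr_gt0.
- by rewrite le_max lexx.
move=> d Om P X rho BM r rr0; have [r1 rl1] := small r rr0.
exists (prob P (visible_approx X rho C r))%:E; split.
- exact: (completed_visible lam_gt0 BM nuC r1).
- by move=> /eqP; rewrite (negPf a1).
move=> _; rewrite !lee_fin.
have := visible_lower lam_gt0 C1 BM nuC rl1.
have := visible_upper lam_gt0 C1 BM nuC rl1.
rewrite -aE -/lc -/uc.
have p0 : 0 <= prob P (visible_approx X rho C r) by exact: prob_ge0.
move: (prob _ _) p0 => p p0 Hu Hl.
have e0 := expR_ge0 (- (alpha - 1) * r).
apply/andP; split.
  rewrite mulrAC ler_pdivrMr//; apply: (le_trans Hl).
  by rewrite ler_wpM2l//; exact: power_sum_le.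
apply: (@le_trans _ _ (uc * expR (- (alpha - 1) * r))); last first.
  by rewrite ler_wpM2r// le_max lexx orbT.
apply: le_trans Hu; rewrite ler_peMr//; apply: power_sum_ge1.
rewrite truncn_gt0 e16 -[leLHS]expR0 ler_expR; rewrite /r0 in rr0; lra.
Qed.
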